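(* Let $\mu(dt)=\eta(t)\,dt$ be a weighted Lebesgue measure on $(0,\infty)$ with a continuous positive weight function $\eta$ satisfying $\int_0^\infty 2^{-y}\eta(y)\,dy<\infty$. Suppose furthermore that $\eta$ is monotone on $(0,\infty)$ with finite right limit $\eta(0_+)=\lim_{t\to 0^+}\eta(t)$. (i) If $\eta(t)\geq \eta(0_+)$ for all $t>0$ (i.e., $\eta$ is non-decreasing), then $x\,\widehat{\eta}(x)\geq \eta(0_+)$ and $x\,\widehat{\eta}(x)\to\eta(0_+)$ as $x\to\infty$. On the other hand, if $\eta(t)\leq\eta(0_+)$ for all $t>0$ (i.e., $\eta$ is non-increasing), then $x\,\widehat{\eta}(x)\leq\eta(0_+)$ and $x\,\widehat{\eta}(x)\to\eta(0_+)$ as $x\to\infty$. (Here the inequalities are for $x \geq \ln 2$.) In both these cases, $$\|H_\mu\|\leq \pi\,\Big(\sup_{x\geq \ln 2} x\,\widehat{\eta}(x)\Big).$$ Moreover, $H_\mu-\eta(0_+)H_\lambda$ in the non-decreasing case (respectively $\eta(0_+)H_\lambda-H_\mu$ in the non-increasing case) is positive, self-adjoint and compact, and $\sigma_{ess}(H_\mu)=[0,\eta(0_+)\pi]$. (ii) If, in either of the two cases above, in addition, for some $p>0$ there exist $D\equiv D(p)>0$ and a positive measurable function $g$ on $(0,\infty)$ such that $\int_0^\infty y^p g(y)e^{-y}\,dy<\infty$ and $$\Big|\eta\Big(\frac{y}{x}\Big)-\eta(0_+)\Big|\leq D\Big(\frac{y}{x}\Big)^p g(y),\qquad y>0,\ x\geq\ln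 2,$$ then $H_\mu-\eta(0_+)H_\lambda$ in the non-decreasing case (respectively $\eta(0_+)H_\lambda-H_\mu$ in the non-increasing case) is positive, self-adjoint and trace-class.
   Context: $\mathbb N_2=\{2,3,\dots\}$, and $\ell^2(\mathbb N_2)$ is the Hilbert space of square-summable complex sequences indexed by $\mathbb N_2$. For a positive regular Borel measure $\mu$ on $(0,\infty)$ the Laplace transform is $\widehat\mu(s)=\int_0^\infty e^{-st}\mu(dt)$ (for $s>0$ when the integral converges); if $\mu(dt)=\eta(t)\,dt$ we write $\widehat\eta=\widehat\mu$. If $\int_0^\infty 2^{-t}\mu(dt)<\infty$, the Helson matrix induced by $\mu$ is $$H_\mu=\Big(\frac{\widehat\mu(\ln(mn))}{\sqrt{mn}}\Big)_{m,n=2}^\infty,$$ regarded as an operator on $\ell^2(\mathbb N_2)$ with respect to the standard basis. $\lambda$ denotes Lebesgue measure on $(0,\infty)$, so $\widehat\lambda(x)=1/x$ and $H_\lambda=\big(\frac{1}{\sqrt{mn}\ln(mn)}\big)_{m,n=2}^\infty$. A bounded operator $T$ is positive if $\langle Tx,x\rangle\geq 0$ for all $x$. $\sigma_{ess}$ denotes the essential spectrum of a self-adjoint operator. *)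

(* Defs.v *)
From HB Require Import structures.
From mathcomp Require Import all_boot all_order all_algebra.
From mathcomp Require Import all_classical all_reals all_analysis.
From mathcomp Require Import complex.

Set Implicit Arguments.
Unset Strict Implicit.
Unset Printing Implicit Defensive.

Import Order.TTheory GRing.Theory Num.Theory numFieldNormedType.Exports.

Local Open Scope classical_set_scope.
Local Open Scope ring_scope.
Local Open Scope complex_scope.

Section l2_sequences.
Variable R : realType.
Implicit Types x y : nat -> R[i].

Definition sqnorm x : \bar R :=
  (\sum_(0 <= n <oo) (Normc.normc (x n) ^+ 2)%:E)%E.

Definition l2norm x : R := Num.sqrt (fine (sqnorm x)).

Definition square_summable x : bool := `[< (sqnorm x < +oo)%E >].

Lemma sqnorm_ge0 x : (0 <= sqnorm x)%E.
Proof. by apply: nneseries_ge0 => n _ _; rewrite lee_fin sqr_ge0. Qed.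

Lemma normc_ge0 (z : R[i]) : (0 <= Normc.normc z :> R).
Proof. by case: z => a b; rewrite /Normc.normc sqrtr_ge0. Qed.

Let nf x : nat -> R := fun n => Normc.normc (x n).

Lemma Lnorm_sqnorm x :
  ('N[counting]_2%:E [EFin \o nf x] = sqnorm x `^ 2^-1)%E.
Proof.
rewrite Lnorm_counting; last by rewrite ltr0n.
congr (_ `^ _)%E; apply: eq_eseriesr => n _ /=.
by rewrite ger0_norm ?normc_ge0// powR_mulrn// normc_ge0.
Qed.

Lemma square_summableP x :
  reflect (sqnorm x < +oo)%E (square_summable x).
Proof. exact: asboolP. Qed.

Lemma l2normE x : square_summable x ->
  (sqnorm x `^ 2^-1)%E = (l2norm x)%:E.
Proof.
move=> /square_summableP xfin.
have /fineK <- : sqnorm x \is a fin_num by rewrite ge0_fin_numE ?sqnorm_ge0.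
by rewrite poweR_EFin powR12_sqrt// fine_ge0 ?sqnorm_ge0.
Qed.

Lemma sqnorm_triangle x y :
  (sqnorm (x + y)%R `^ 2^-1 <= sqnorm x `^ 2^-1 + sqnorm y `^ 2^-1)%E.
Proof.
rewrite -!Lnorm_sqnorm.
apply: le_trans; last first.
  by apply: minkowski_EFin => //; rewrite ler1n.
rewrite !Lnorm_counting ?ltr0n//.
apply: gt0_ler_poweR; rewrite ?invr_ge0 ?ler0n//.
- by rewrite in_itv/= leey andbT; apply: nneseries_ge0 => n _ _; rewrite lee_fin powR_ge0.
- by rewrite in_itv/= leey andbT; apply: nneseries_ge0 => n _ _; rewrite lee_fin powR_ge0.
apply: lee_nneseries => [n _ _|n _]; first by rewrite lee_fin powR_ge0.
rewrite /= lee_fin ge0_ler_powR ?nnegrE//.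
rewrite /nf [X in X <= _]ger0_norm ?normc_ge0//.
rewrite ger0_norm ?addr_ge0 ?normc_ge0//.
exact: le_normcD.
Qed.

Lemma square_summableE x :
  square_summable x = (sqnorm x `^ 2^-1 < +oo)%E.
Proof.
apply/square_summableP/idP => [xfin|].
  by rewrite l2normE ?ltry//; apply/square_summableP.
case: (sqnorm x) => [r _|/=|_]; rewrite ?ltry ?ltNyr//.
by rewrite invr_eq0 pnatr_eq0.
Qed.

Lemma sqnormZ a x : sqnorm (a *: x)%R = ((Normc.normc a ^+ 2)%:E * sqnorm x)%E.
Proof.
rewrite /sqnorm -nneseriesZl; last by move=> n _; rewrite lee_fin sqr_ge0.
by apply: eq_eseriesr => n _; rewrite -EFinM -exprMn -Normc.normcM.
Qed.

Lemma square_summable_submod : submod_closed square_summable.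
Proof.
split.
  rewrite unfold_in; apply/square_summableP.
  by rewrite /sqnorm eseries0 ?ltry// => n _ _; rewrite Normc.normc0 expr0n.
move=> a x y; rewrite !unfold_in => xs ys.
have axs : square_summable (a *: x).
  apply/square_summableP; rewrite sqnormZ.
  have /fineK <- : sqnorm x \is a fin_num.
    by rewrite ge0_fin_numE ?sqnorm_ge0//; apply/square_summableP.
  by rewrite -EFinM ltry.
change (is_true (square_summable (a *: x + y))).
rewrite square_summableE (le_lt_trans (sqnorm_triangle _ _))//.
by rewrite !l2normE// -EFinD ltry.
Qed.

HB.instance Definition _ :=
  GRing.isSubmodClosed.Build _ _ square_summable square_summable_submod.

End l2_sequences.

Section ell2.
Variable R : realType.

(* ell2 R is l^2({2, 3, 4, ...}): the coordinate of index k : nat stands for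
   the index k.+2 of the sequence. *)
Record ell2 := Ell2 {
  ell2_seq :> nat -> R[i] ;
  _ : square_summable ell2_seq }.

HB.instance Definition _ := [isSub for ell2_seq].
HB.instance Definition _ := [Choice of ell2 by <:].
HB.instance Definition _ := [SubChoice_isSubLmodule of ell2 by <:].

Lemma ell2P (x : ell2) : square_summable x. Proof. by case: x. Qed.

Lemma ell2_ler_normD (x y : ell2) :
  (l2norm (x + y))%:C <= (l2norm x)%:C + (l2norm y)%:C.
Proof.
rewrite -rmorphD/= lecR -lee_fin EFinD -!l2normE ?ell2P//.
  exact: sqnorm_triangle.
exact: (ell2P (x + y)).
Qed.

Lemma ell2_normZ (a : R[i]) (x : ell2) :
  (l2norm (a *: x))%:C = `|a| * (l2norm x)%:C.
Proof.
rewrite /l2norm sqnormZ fineM//; last first.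
  by rewrite ge0_fin_numE ?sqnorm_ge0//; apply/square_summableP/ell2P.
by rewrite sqrtrM ?sqr_ge0// sqrtr_sqr ger0_norm ?normc_ge0// rmorphM.
Qed.

Lemma ell2_norm0_eq0 (x : ell2) : (l2norm x)%:C = 0 -> x = 0.
Proof.
move=> /(congr1 (@complex.Re R))/= /eqP; rewrite sqrtr_eq0 => le0.
have xfin : sqnorm x \is a fin_num.
  by rewrite ge0_fin_numE ?sqnorm_ge0//; apply/square_summableP/ell2P.
apply: val_inj; apply/funext => n /=; apply: Normc.eq0_normc.
have : ((Normc.normc (x n) ^+ 2)%:E <= 0%E)%E.
  apply: le_trans (_ : (sqnorm x <= 0)%E); last by rewrite -(fineK xfin) lee_fin.
  rewrite /sqnorm (@nneseriesD1 _ _ n)//; last by move=> k _; rewrite lee_fin sqr_ge0.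
  by rewrite leeDl//; apply: nneseries_ge0 => k _ _; rewrite lee_fin sqr_ge0.
by rewrite lee_fin exprn_even_le0//= => /eqP.
Qed.

HB.instance Definition _ := @Lmodule_isNormed.Build R[i] ell2
  (fun x => (l2norm x)%:C) ell2_ler_normD ell2_normZ ell2_norm0_eq0.

Lemma ell2_normE (x : ell2) : `|x| = (l2norm x)%:C. Proof. by []. Qed.

Lemma basis_subproof (k : nat) :
  square_summable (fun n => (n == k)%:R : R[i]).
Proof.
apply/square_summableP; rewrite /sqnorm (@nneseriesD1 _ _ k)//; last first.
  by move=> n _; rewrite lee_fin sqr_ge0.
rewrite eseries0 ?adde0 ?ltry// => n _ /= /negPf ->.
by rewrite Normc.normc0 expr0n.
Qed.

Definition basis (k : nat) : ell2 := Ell2 (basis_subproof k).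

Definition inner (x y : ell2) : R[i] :=
  limn (series (fun n => x n * (y n)^* : R[i]^o)).

End ell2.

Section operators.
Variable R : realType.
Implicit Types (T S P : ell2 R -> ell2 R) (z : R[i]).

Definition opnorm T : \bar R :=
  ereal_sup [set (l2norm (T x))%:E | x in [set x : ell2 R | `|x| <= 1]].

(* A : entries indexed by {2, 3, 4, ...}, whence the shift. *)
Definition is_operator_of (A : nat -> nat -> R) (T : {linear ell2 R -> ell2 R}) :=
  continuous T /\
  forall m n, inner (T (basis R n)) (basis R m) = (A m.+2 n.+2)%:C.

Definition is_adjoint T S := forall x y, inner (T x) y = inner x (S y).

Definition self_adjoint T := is_adjoint T T.

Definition positive_op T := forall x, 0 <= inner (T x) x.

Definition compact_op T :=
  compact (closure (T @` [set x : ell2 R | `|x| <= 1])).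

(* P is |T|, the positive square root of T^* T; its trace does not depend on
   the orthonormal basis, so the standard one is used. *)
Definition trace_class T :=
  exists P S : {linear ell2 R -> ell2 R},
    [/\ continuous P /\ continuous S, is_adjoint T S, positive_op P,
        P \o P =1 S \o T &
        (\sum_(0 <= n <oo) (complex.Re (inner (P (basis R n)) (basis R n)))%:E
          < +oo)%E].

Definition spanned (I : finType) (v : I -> ell2 R) : set (ell2 R) :=
  [set x | exists a : I -> R[i], x = \sum_i a i *: v i].

Definition fredholm T :=
  [/\ closed (range T),
      exists n (v : 'I_n -> ell2 R), T @^-1` [set 0] `<=` spanned v &
      exists n (v : 'I_n -> ell2 R),
        forall y, exists x, spanned v (y - T x)].

Definition ess_spectrum T : set R[i] :=
  [set z | ~ fredholm (fun x => T x - z *: x)].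

End operators.

Section helson.
Variable R : realType.
Implicit Types mu : set (measurableTypeR R) -> \bar R.

(* Only the restriction of mu to ]0, +oo[ matters. *)
Definition laplace mu (s : R) : \bar R :=
  (\int[mu]_(t in `]0%R, +oo[) (expR (- (s * t)))%:E)%E.

Definition helson mu (m n : nat) : R :=
  fine (laplace mu (ln (m * n)%:R)) / Num.sqrt (m * n)%:R.

Definition has_density mu (eta : R -> R) :=
  forall A : set (measurableTypeR R), measurable A -> A `<=` `]0%R, +oo[ ->
    mu A = (\int[lebesgue_measure]_(t in A) (eta t)%:E)%E.

Definition power_rate_at0 (eta : R -> R) (eta0 : R) :=
  exists (p D : R) (g : R -> R),
    [/\ 0 < p /\ 0 < D,
        measurable_fun (`]0, +oo[%classic : set R) g,
        forall y : R, 0 < y -> 0 < g y,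
        (\int[lebesgue_measure]_(y in `]0%R, +oo[)
            (y `^ p * g y * expR (- y))%:E < +oo)%E &
        forall x y : R, ln 2 <= x -> 0 < y ->
          `|eta (y / x) - eta0| <= D * (y / x) `^ p * g y].

End helson.

(* Main.v *)
From HB Require Import structures.
Require Import Defs.
From mathcomp Require Import all_boot all_order all_algebra.
From mathcomp Require Import all_classical all_reals all_analysis.
From mathcomp Require Import complex ring lra measurable_realfun.

(* Put kappa = |eta - eta(0+)|.  Then H_mu = eta(0+) H_lambda +- K, where K has
   the entries kappa^(ln (mn)) / sqrt (mn).  Since
     sum_(m,n) K_mn a_m a_n = int (sum_n a_n n^(-1/2 - t))^2 kappa(t) dt,
   K is positive.  Near t = 0 the weight kappa is small, so s kappa^(s) -> 0, and
   the entries of K are o(1) relative to those of H_lambda; as H_lambda is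
   bounded by pi (Schur test with weights 1 / sqrt (n ln n)), the tails of K are
   small in norm and K is compact.  Under the power rate kappa^(s) = O(s^(-1-p)),
   hence the trace sum_n kappa^(2 ln n) / n converges.

   Weyl's theorem is proved by hand.  A coercive perturbation of finite rank is
   Fredholm, which bounds the essential spectrum.  Conversely, the vectors
   (n ln n)^(-1/2) (ln n)^(i xi / 2), n < N, are approximate eigenvectors of
   H_lambda whose eigenvalues int_0^oo 2 cos (xi ln v) / (1 + v^2) dv fill
   (0, pi] as xi varies, and a gliding hump shows that a point with such a
   sequence is never Fredholm. *)

Set Implicit Arguments.
Unset Strict Implicit.
Unset Printing Implicit Defensive.

Import Order.TTheory GRing.Theory Num.Theory numFieldNormedType.Exports.

Local Open Scope classical_set_scope.
Local Open Scope ring_scope.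
Local Open Scope complex_scope.

(** * The Hilbert space l^2 *)

(** Both monotone cases are treated at once through a sign [sg] equal to 1 or -1: then
    [sg * (eta - eta0)] is the nonnegative weight kappa, and H_mu - eta(0+) H_lambda has the matrix
    sg K. Operators are accessible only through their entries, so [represents] couples a matrix with
    some norm bound. As a bounded operator is determined by its entries, the bound of an operator
    already chosen can be sharpened later; this matters because one H must be fixed before it is
    known which case holds. On the spectral side the natural variable is v = sqrt (ln n / ln m). In
    ln n the weighted kernel has an inverse square root singularity at 0; in v it becomes the
    bounded 2 / (1 + v^2), and the errors of its Riemann sums telescope. The Weyl vectors are not
    convergent: their squared norm grows like ln ln N while the residual stays bounded, and this gap
    is what yields approximate eigenvectors. The symbol only tends to 0, so the end point 0 of the
    spectrum is reached as a limit of Weyl points. *)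

Section ell2_norm.
Variable R : realType.
Implicit Types (x y : ell2 R) (u : nat -> R[i]).
Local Notation N x := (l2norm (ell2_seq x)).
Local Notation basis := Defs.basis.

Definition sqpart n u : R := \sum_(i < n) Normc.normc (u i) ^+ 2.

Lemma normc_sq (z : R[i]) :
  Normc.normc z ^+ 2 = complex.Re z ^+ 2 + complex.Im z ^+ 2.
Proof. by case: z => a b; rewrite /= sqr_sqrtr// addr_ge0 ?sqr_ge0. Qed.

Lemma sqpart_ge0 n u : 0 <= sqpart n u.
Proof. by apply: sumr_ge0 => i _; exact: sqr_ge0. Qed.

Lemma sqnorm_le u c : (forall n, sqpart n u <= c) -> (sqnorm u <= c%:E)%E.
Proof.
move=> h; apply: lime_le.
  by apply: is_cvg_nneseries => n _ _; rewrite lee_fin sqr_ge0.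
by apply: nearW => n; rewrite sumEFin lee_fin big_mkord h.
Qed.

Lemma l2norm_ge0 x : 0 <= N x.
Proof. exact: sqrtr_ge0. Qed.

Lemma sqnorm_l2norm x : sqnorm x = (N x ^+ 2)%:E.
Proof.
have xf : sqnorm x \is a fin_num.
  by rewrite ge0_fin_numE ?sqnorm_ge0//; apply/square_summableP/ell2P.
by rewrite /l2norm sqr_sqrtr ?fineK// fine_ge0// sqnorm_ge0.
Qed.

Lemma sqpart_le x n : sqpart n x <= N x ^+ 2.
Proof.
rewrite -lee_fin -sqnorm_l2norm /sqpart -sumEFin -(big_mkord xpredT
  (fun i => (Normc.normc (x i) ^+ 2)%:E)).
by apply: nneseries_lim_ge => i _ _; rewrite lee_fin sqr_ge0.
Qed.

Lemma l2norm_le x c : 0 <= c -> (forall n, sqpart n x <= c ^+ 2) -> N x <= c.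
Proof.
move=> c0 h; rewrite -(@ler_sqr _ (N x) c) ?nnegrE ?l2norm_ge0//.
by rewrite -lee_fin -sqnorm_l2norm; exact: sqnorm_le.
Qed.

Lemma sqpart_homo n m u : (n <= m)%N -> sqpart n u <= sqpart m u.
Proof.
move=> nm; rewrite /sqpart -!(big_mkord xpredT (fun i => Normc.normc (u i) ^+ 2)).
rewrite (@big_cat_nat _ _ _ n 0 m)//= lerDl.
by apply: sumr_ge0 => i _; exact: sqr_ge0.
Qed.

Lemma sqpart_near x (e : R) : 0 < e -> exists n, N x ^+ 2 - e <= sqpart n x.
Proof.
move=> e0; apply: contrapT => /forallNP h.
have : (sqnorm x <= (N x ^+ 2 - e)%:E)%E.
  by apply: sqnorm_le => n; have /negP := h n; rewrite -ltNge => /ltW.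
by rewrite sqnorm_l2norm lee_fin => ?; lra.
Qed.

Lemma ell2_ext x y : (forall n, x n = y n) -> x = y.
Proof. by move=> h; apply: val_inj; apply/funext. Qed.

Lemma ell2_add x y n : (x + y) n = x n + y n. Proof. by []. Qed.
Lemma ell2_opp x n : (- x) n = - x n. Proof. by []. Qed.
Lemma ell2_sub x y n : (x - y) n = x n - y n. Proof. by []. Qed.
Lemma ell2_scale a x n : (a *: x) n = a * x n. Proof. by []. Qed.
Lemma ell2_0 n : (0 : ell2 R) n = 0. Proof. by []. Qed.
Lemma ell2_sum (I : Type) (r : seq I) (P : pred I) (F : I -> ell2 R) n :
  (\sum_(i <- r | P i) F i) n = \sum_(i <- r | P i) F i n.
Proof. by elim/big_rec2: _ => // i a b _ <-. Qed.

Lemma l2normD x y : N (x + y) <= N x + N y.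
Proof. by rewrite -lecR rmorphD; exact: ell2_ler_normD. Qed.
Lemma l2normZ a x : N (a *: x) = Normc.normc a * N x.
Proof.
apply/eqP; rewrite -(@eqrXn2 _ 2)// ?mulr_ge0 ?normc_ge0 ?l2norm_ge0// exprMn.
have := sqnormZ a x; rewrite (sqnorm_l2norm (a *: x)) sqnorm_l2norm -EFinM.
by move=> [->].
Qed.
Lemma l2normN x : N (- x) = N x.
Proof. by rewrite -scaleN1r l2normZ normcN Normc.normc1 mul1r. Qed.
Lemma l2norm0 : N (0 : ell2 R) = 0.
Proof. by rewrite -(scale0r (0 : ell2 R)) l2normZ Normc.normc0 mul0r. Qed.
Lemma l2norm_sum (I : Type) (r : seq I) (P : pred I) (F : I -> ell2 R) :
  N (\sum_(i <- r | P i) F i) <= \sum_(i <- r | P i) N (F i).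
Proof.
elim/big_rec2: _ => [|i a b _ h]; first by rewrite l2norm0.
by apply: le_trans (l2normD _ _) _; rewrite lerD2l.
Qed.
Lemma l2norm_eq0 x : N x = 0 -> x = 0.
Proof. by move=> h; apply: ell2_norm0_eq0; rewrite h. Qed.

Lemma coord_le x n : Normc.normc (x n) <= N x.
Proof.
rewrite -(@ler_sqr _ _ (N x)) ?nnegrE ?l2norm_ge0 ?normc_ge0//.
apply: le_trans (sqpart_le x n.+1); rewrite /sqpart big_ord_recr/= lerDr.
exact: sqpart_ge0.
Qed.

Definition trunc M x : ell2 R := \sum_(i < M) x i *: basis R i.

Lemma basisE k n : basis R k n = (n == k)%:R. Proof. by []. Qed.

Lemma truncE M x n : trunc M x n = if (n < M)%N then x n else 0.
Proof.
rewrite ell2_sum; under eq_bigr do rewrite ell2_scale basisE.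
case: ltnP => nM.
  rewrite (bigD1 (Ordinal nM))//= big1 ?addr0 ?eqxx ?mulr1//.
  move=> i /negP h; case: eqP => [e|]; last by rewrite mulr0.
  by exfalso; apply: h; apply/eqP/val_inj.
rewrite big1// => i _; case: eqP => [e|]; last by rewrite mulr0.
by have := ltn_ord i; rewrite -e ltnNge nM.
Qed.

Lemma sqpart_trunc M x n : sqpart n (trunc M x) <= sqpart M x.
Proof.
have -> : sqpart n (trunc M x) = \sum_(i < n | (i < M)%N) Normc.normc (x i) ^+ 2.
  rewrite /sqpart [RHS]big_mkcond; apply: eq_bigr => i _; rewrite truncE.
  by case: ifP => // _; rewrite Normc.normc0 expr0n.
rewrite /sqpart; case: (leqP n M) => nM.
  rewrite (eq_bigl xpredT); first exact: sqpart_homo.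
  by move=> i /=; rewrite (leq_trans _ nM).
by rewrite -(big_ord_widen n (fun i => Normc.normc (x i) ^+ 2) (ltnW nM)).
Qed.

Lemma sqpart_sub_trunc M x n :
  sqpart n (x - trunc M x : ell2 R) <= N x ^+ 2 - sqpart M x.
Proof.
apply: (@le_trans _ _ (sqpart (maxn n M) x - sqpart M x)); last first.
  by rewrite lerD2r sqpart_le.
apply: le_trans (sqpart_homo _ (leq_maxl n M)) _.
rewrite lerBrDr /sqpart (big_ord_widen (maxn n M)
  (fun i => Normc.normc (x i) ^+ 2) (leq_maxr n M)) [X in _ + X]big_mkcond -big_split.
apply: ler_sum => i _; rewrite [in X in X <= _]ell2_sub truncE; case: ifP => _.
  by rewrite subrr Normc.normc0 expr0n /= add0r.
by rewrite subr0 /= addr0.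
Qed.

Lemma trunc_tail x (e : R) : 0 < e -> exists M, N (x - trunc M x) <= e.
Proof.
move=> e0; have [M hM] := sqpart_near x (exprn_gt0 2 e0).
exists M; apply: l2norm_le (ltW e0) _ => n.
by apply: le_trans (sqpart_sub_trunc _ _ _) _; lra.
Qed.

Lemma trunc_tail_homo x n M : (n <= M)%N -> N (x - trunc M x) <= N (x - trunc n x).
Proof.
move=> nM; apply: l2norm_le (l2norm_ge0 _) _ => k.
apply: le_trans (sqpart_le (x - trunc n x : ell2 R) k).
apply: ler_sum => i _; rewrite !ell2_sub !truncE.
case: (ltnP i n) => h; first by rewrite (leq_trans h nM).
case: ifP => _; last exact: lexx.
by rewrite subrr Normc.normc0 expr0n sqr_ge0.
Qed.

Lemma l2norm_trunc_le M x : N (trunc M x) <= N x.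
Proof.
apply: l2norm_le (l2norm_ge0 _) _ => n.
by apply: le_trans (sqpart_trunc _ _ _) (sqpart_le _ _).
Qed.

Lemma l2norm_trunc_sq M x : N (trunc M x) ^+ 2 = sqpart M x.
Proof.
apply/eqP; rewrite eq_le; apply/andP; split.
  rewrite -lee_fin -sqnorm_l2norm; apply: sqnorm_le => n; exact: sqpart_trunc.
apply: le_trans (sqpart_le _ M); apply: ler_sum => i _.
by rewrite truncE ltn_ord.
Qed.

Lemma trunc_linear M : linear (trunc M).
Proof.
move=> a x y; apply: ell2_ext => n; rewrite ell2_add ell2_scale !truncE.
by case: ifP; rewrite ?ell2_add ?ell2_scale ?mulr0 ?addr0.
Qed.
End ell2_norm.

(** * The inner product as a convergent series *)

Section inner_product.
Variable R : realType.
Implicit Types (x y : ell2 R) (u : nat -> R[i]).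
Local Notation N x := (l2norm (ell2_seq x)).
Local Notation basis := Defs.basis.
Local Notation Re := (@complex.Re R).
Local Notation Im := (@complex.Im R).

Lemma ReD (z w : R[i]) : Re (z + w) = Re z + Re w. Proof. by case: z w => ? ? []. Qed.
Lemma ImD (z w : R[i]) : Im (z + w) = Im z + Im w. Proof. by case: z w => ? ? []. Qed.
Lemma ReM (z w : R[i]) : Re (z * w) = Re z * Re w - Im z * Im w.
Proof. by case: z w => ? ? []. Qed.
Lemma ImM (z w : R[i]) : Im (z * w) = Re z * Im w + Im z * Re w.
Proof. by case: z w => ? ? []. Qed.
Lemma ReJ (z : R[i]) : Re (Num.conj z) = Re z. Proof. by case: z. Qed.
Lemma ImJ (z : R[i]) : Im (Num.conj z) = - Im z. Proof. by case: z. Qed.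
Lemma complex_ext (z w : R[i]) : Re z = Re w -> Im z = Im w -> z = w.
Proof. by case: z w => ? ? [? ?] /= -> ->. Qed.

Lemma normc_Re (z : R[i]) : `|Re z| <= Normc.normc z.
Proof.
rewrite -(@ler_sqr _ _ (Normc.normc z)) ?nnegrE ?normc_ge0// normc_sq.
by rewrite real_normK ?num_real// lerDl sqr_ge0.
Qed.
Lemma normc_Im (z : R[i]) : `|Im z| <= Normc.normc z.
Proof.
rewrite -(@ler_sqr _ _ (Normc.normc z)) ?nnegrE ?normc_ge0// normc_sq.
by rewrite real_normK ?num_real// lerDr sqr_ge0.
Qed.
Lemma normc_le_ReIm (z : R[i]) : Normc.normc z <= `|Re z| + `|Im z|.
Proof.
rewrite -(@ler_sqr _ (Normc.normc z)) ?nnegrE ?normc_ge0 ?addr_ge0// normc_sq.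
rewrite sqrrD !real_normK ?num_real// -addrA lerD2l lerDr.
by rewrite mulrn_wge0// mulr_ge0.
Qed.
Lemma normcJ (z : R[i]) : Normc.normc (Num.conj z) = Normc.normc z.
Proof. by case: z => a b /=; rewrite sqrrN. Qed.
Lemma normcE (z : R[i]) : `|z| = (Normc.normc z)%:C.
Proof. by []. Qed.
Lemma mul_conjc (z : R[i]) : z * Num.conj z = (Normc.normc z ^+ 2)%:C.
Proof.
apply: complex_ext; rewrite ?ReM ?ImM ReJ ImJ normc_sq /=; first by rewrite mulrN opprK !expr2.
by rewrite mulrN mulrC addrC subrr.
Qed.

Lemma cvg_complex u (l : R[i]) :
  Re (u n) @[n --> \oo] --> Re l -> Im (u n) @[n --> \oo] --> Im l ->
  (u n : R[i]^o) @[n --> \oo] --> (l : R[i]^o).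
Proof.
move=> /cvgrPdist_lt hR /cvgrPdist_lt hI; apply/cvgrPdist_lt => e e0.
have [e' e'0 ->] : exists2 e' : R, 0 < e' & e = e'%:C.
  exists (Re e); move: e0; rewrite ltcE /= => /andP[/eqP h h0] //.
  by apply: complex_ext.
have h2 : 0 < e' / 2 by rewrite divr_gt0.
near=> n; rewrite normcE ltcR.
apply: le_lt_trans (normc_le_ReIm _) _.
rewrite ReD ImD.
have -> : Re (- u n) = - Re (u n) by case: (u n).
have -> : Im (- u n) = - Im (u n) by case: (u n).
rewrite (splitr e') ltrD//; near: n; [exact: hR|exact: hI].
Unshelve. all: by end_near. Qed.

Definition inner_part n (x y : nat -> R[i]) : R[i] := \sum_(i < n) x i * Num.conj (y i).

Let Re_sum (I : Type) (r : seq I) (F : I -> R[i]) :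
  Re (\sum_(i <- r) F i) = \sum_(i <- r) Re (F i).
Proof. by elim/big_rec2: _ => // i a b _ <-; rewrite ReD. Qed.

Let Im_sum (I : Type) (r : seq I) (F : I -> R[i]) :
  Im (\sum_(i <- r) F i) = \sum_(i <- r) Im (F i).
Proof. by elim/big_rec2: _ => // i a b _ <-; rewrite ImD. Qed.

Lemma normc_mul_le (z w : R[i]) :
  Normc.normc (z * Num.conj w) <= Normc.normc z ^+ 2 + Normc.normc w ^+ 2.
Proof.
rewrite Normc.normcM normcJ.
have := sqr_ge0 (Normc.normc z - Normc.normc w); have := normc_ge0 z; have := normc_ge0 w.
by nra.
Qed.

Let cvg_part (f : nat -> R) x y :
  (forall n, `|f n| <= Normc.normc (x n * Num.conj (y n))) -> cvgn (series f).
Proof.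
move=> fle; apply: normed_cvg; apply: nondecreasing_is_cvgn.
  by apply: nondecreasing_series => n _ _ /=.
exists (N x ^+ 2 + N y ^+ 2) => _ [n _ <-]; rewrite /= /series /= big_mkord.
apply: le_trans (lerD (sqpart_le x n) (sqpart_le y n)).
rewrite /sqpart -big_split/=; apply: ler_sum => i _.
exact: le_trans (fle _) (normc_mul_le _ _).
Qed.

(** [inner] is a [limn], hence says nothing until the series is known to converge. The real and
    imaginary parts converge absolutely because |z w| <= |z|^2 + |w|^2; the basic identities are
    then proved on partial sums and passed to the limit by [inner_unique]. *)
Let inner_cvgReIm x y :
  (Re (inner_part n x y) @[n --> \oo] --> Re (inner x y)) /\
  (Im (inner_part n x y) @[n --> \oo] --> Im (inner x y)).
Proof.
have cR : cvgn (fun n => Re (inner_part n x y)).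
  have := @cvg_part (fun n => Re (x n * Num.conj (y n))) x y (fun n => normc_Re _).
  suff -> : (fun n => Re (inner_part n x y)) = series (fun n => Re (x n * Num.conj (y n))) by [].
  by apply/funext => n; rewrite /series/= big_mkord /inner_part Re_sum.
have cI : cvgn (fun n => Im (inner_part n x y)).
  have := @cvg_part (fun n => Im (x n * Num.conj (y n))) x y (fun n => normc_Im _).
  suff -> : (fun n => Im (inner_part n x y)) = series (fun n => Im (x n * Num.conj (y n))) by [].
  by apply/funext => n; rewrite /series/= big_mkord /inner_part Im_sum.
have -> : inner x y = (limn (fun n => Re (inner_part n x y))) +i*
                      (limn (fun n => Im (inner_part n x y))).
  apply: (@cvg_lim (R[i]^o) (@norm_hausdorff _ _) _ _ _ _
    (_ +i* _ : R[i]^o)).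
  have -> : series (fun n => x n * Num.conj (y n) : R[i]^o) = fun n => inner_part n x y.
    by apply/funext => n; rewrite /series/= big_mkord.
  by apply: cvg_complex.
by split.
Qed.

Lemma inner_cvgRe x y : Re (inner_part n x y) @[n --> \oo] --> Re (inner x y).
Proof. exact: (inner_cvgReIm x y).1. Qed.

Lemma inner_cvgIm x y : Im (inner_part n x y) @[n --> \oo] --> Im (inner x y).
Proof. exact: (inner_cvgReIm x y).2. Qed.

Lemma inner_unique x y (c : R[i]) :
  Re (inner_part n x y) @[n --> \oo] --> Re c ->
  Im (inner_part n x y) @[n --> \oo] --> Im c -> inner x y = c.
Proof.
move=> hR hI; apply: complex_ext.
  by rewrite -(cvg_lim _ hR)// -(cvg_lim _ (@inner_cvgRe x y)).
by rewrite -(cvg_lim _ hI)// -(cvg_lim _ (@inner_cvgIm x y)).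
Qed.

Lemma innerPl a x x' y : inner (a *: x + x') y = a * inner x y + inner x' y.
Proof.
have e n : inner_part n (a *: x + x' : ell2 R) y = a * inner_part n x y + inner_part n x' y.
  rewrite /inner_part mulr_sumr -big_split; apply: eq_bigr => i _.
  by rewrite ell2_add ell2_scale mulrDl mulrA.
apply: inner_unique.
  under eq_fun do rewrite e ReD ReM; rewrite ReD ReM.
  apply: cvgD; last exact: inner_cvgRe.
  by apply: cvgB; apply: cvgMr; [exact: inner_cvgRe|exact: inner_cvgIm].
under eq_fun do rewrite e ImD ImM; rewrite ImD ImM.
apply: cvgD; last exact: inner_cvgIm.
by apply: cvgD; apply: cvgMr; [exact: inner_cvgIm|exact: inner_cvgRe].
Qed.

Lemma inner_conj x y : Num.conj (inner x y) = inner y x.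
Proof.
have e n : inner_part n y x = Num.conj (inner_part n x y).
  rewrite /inner_part rmorph_sum; apply: eq_bigr => i _.
  by rewrite /= rmorphM /= conjCK mulrC.
apply/esym/inner_unique.
  by under eq_fun do rewrite e ReJ; rewrite ReJ; exact: inner_cvgRe.
by under eq_fun do rewrite e ImJ; rewrite ImJ; apply: cvgN; exact: inner_cvgIm.
Qed.

Lemma inner0l y : inner 0 y = 0.
Proof.
have := innerPl 1 0 0 y; rewrite scaler0 addr0 mul1r.
by move=> /(congr1 (fun z => z - inner 0 y)); rewrite subrr addrK.
Qed.
Lemma innerDl x x' y : inner (x + x') y = inner x y + inner x' y.
Proof. by have := innerPl 1 x x' y; rewrite scale1r mul1r. Qed.
Lemma innerZl a x y : inner (a *: x) y = a * inner x y.
Proof. by have := innerPl a x 0 y; rewrite !addr0 inner0l addr0. Qed.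
Lemma innerNl x y : inner (- x) y = - inner x y.
Proof. by rewrite -scaleN1r innerZl mulN1r. Qed.
Lemma innerBl x x' y : inner (x - x') y = inner x y - inner x' y.
Proof. by rewrite innerDl innerNl. Qed.
Lemma inner_suml (I : Type) (r : seq I) (P : pred I) (F : I -> ell2 R) y :
  inner (\sum_(i <- r | P i) F i) y = \sum_(i <- r | P i) inner (F i) y.
Proof.
by elim/big_rec2: _ => [|i a b _ <-]; [exact: inner0l|rewrite innerDl].
Qed.
Lemma innerDr x y y' : inner x (y + y') = inner x y + inner x y'.
Proof. by rewrite -inner_conj innerDl rmorphD/= !inner_conj. Qed.
Lemma innerZr a x y : inner x (a *: y) = Num.conj a * inner x y.
Proof. by rewrite -inner_conj innerZl rmorphM/= inner_conj. Qed.
Lemma innerNr x y : inner x (- y) = - inner x y.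
Proof. by rewrite -inner_conj innerNl rmorphN/= inner_conj. Qed.
Lemma innerBr x y y' : inner x (y - y') = inner x y - inner x y'.
Proof. by rewrite innerDr innerNr. Qed.

Lemma inner_basis x k : inner x (basis R k) = x k.
Proof.
have e n : (k < n)%N -> inner_part n x (basis R k) = x k.
  move=> kn; rewrite /inner_part (bigD1 (Ordinal kn))//= big1 ?addr0.
    by rewrite eqxx conjC1 mulr1.
  move=> i /negP h; case: eqP => [e|]; last by rewrite conjC0 mulr0.
  by exfalso; apply: h; apply/eqP/val_inj.
apply: inner_unique; (apply: cvg_near_cst; near=> n; rewrite e//; near: n; exact: nbhs_infty_gt).
Unshelve. all: by end_near. Qed.

Lemma inner_self x : inner x x = (N x ^+ 2)%:C.
Proof.
have e n : inner_part n x x = (sqpart n x)%:C.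
  rewrite /inner_part /sqpart rmorph_sum; apply: eq_bigr => i _.
  exact: mul_conjc.
apply: inner_unique; last by under eq_fun do rewrite e; exact: cvg_cst.
under eq_fun do rewrite e /=; apply/cvgrPdist_le => eps eps0.
have [n hn] := sqpart_near x eps0.
exists n => // m /= nm; rewrite ger0_norm; last by rewrite subr_ge0 sqpart_le.
by have := sqpart_homo x nm; lra.
Qed.

Lemma inner_CS x y : Normc.normc (inner x y) <= N x * N y.
Proof.
have [/l2norm_eq0 ->|y0] := eqVneq (N y) 0; last first.
  set c := inner x y.
  (* A multiple of the component of x orthogonal to y, chosen to avoid division: its squared norm is
     |y|^2 (|x|^2 |y|^2 - |c|^2). *)
  have := inner_self ((N y ^+ 2)%:C *: x - c *: y).
  rewrite innerBl !innerBr !innerZl !innerZr !inner_self -/c -(inner_conj x y) -/c.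
  move=> /(congr1 Re) e.
  have {e} : 0 <= N y ^+ 2 * ((N y * N x) ^+ 2 - Normc.normc c ^+ 2).
    move: e (sqr_ge0 (N ((N y ^+ 2)%:C *: x - c *: y))) => /= <-.
    congr (0 <= _); rewrite normc_sq; case: (c) => a b /=; ring.
  rewrite pmulr_rge0 ?exprn_even_gt0// subr_ge0 => h.
  by rewrite -(@ler_sqr _ _ (N x * N y)) ?nnegrE ?normc_ge0 ?mulr_ge0 ?l2norm_ge0// (mulrC (N x)).
by rewrite -inner_conj inner0l conjC0 Normc.normc0 l2norm0 mulr0.
Qed.
End inner_product.

(** * Operators given by real symmetric matrices *)

Section matrix_operators.
Variable R : realType.
Implicit Types (x y : ell2 R) (u : nat -> R[i]) (A : nat -> nat -> R).
Local Notation N x := (l2norm (ell2_seq x)).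
Local Notation basis := Defs.basis.
Local Notation Re := (@complex.Re R).
Local Notation Im := (@complex.Im R).

Lemma ell2_of_bound u c : (forall n, sqpart n u <= c) ->
  exists x : ell2 R, forall n, x n = u n.
Proof.
move=> h; have us : square_summable u.
  by apply/square_summableP; apply: le_lt_trans (sqnorm_le h) (ltry _).
by exists (Ell2 us).
Qed.

(** A Fatou-type statement for coordinatewise limits. The filter is arbitrary because both sequences
    and, in the compactness criterion, an ultrafilter are fed to it. *)
Lemma sqpart_lim (T : Type) (F : set_system T) {FF : ProperFilter F}
    (w : T -> nat -> R[i]) u n b :
  (forall i, Re (w t i) @[t --> F] --> Re (u i)) ->
  (forall i, Im (w t i) @[t --> F] --> Im (u i)) ->
  (\forall t \near F, sqpart n (w t) <= b) -> sqpart n u <= b.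
Proof.
move=> hR hI hb.
have c : sqpart n (w t) @[t --> F] --> sqpart n u.
  rewrite /sqpart; under eq_fun do under eq_bigr do rewrite normc_sq.
  under eq_bigr do rewrite normc_sq.
  elim: n {hb} => [|n ih].
    by rewrite big_ord0; under eq_fun do rewrite big_ord0; exact: cvg_cst.
  rewrite big_ord_recr/=.
  have -> : (fun t => \sum_(i < n.+1) (Re (w t i) ^+ 2 + Im (w t i) ^+ 2)) =
      (fun t => \sum_(i < n) (Re (w t i) ^+ 2 + Im (w t i) ^+ 2)) \+
      (fun t => Re (w t n) ^+ 2 + Im (w t n) ^+ 2).
    by apply/funext => t; rewrite big_ord_recr.
  apply: cvgD => //.
  by apply: cvgD; rewrite expr2; under eq_fun do rewrite expr2; apply: cvgM.
by apply: (closed_cvg (fun z => z <= b) _ hb _ c); exact: closed_le.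
Qed.

(** Completeness of l^2 with an explicit rate, as needed by the Richardson iteration and by the
    gliding hump. *)
Lemma geometric_complete (x_ : nat -> ell2 R) (c q : R) : 0 <= q < 1 ->
  (forall k, N (x_ k.+1 - x_ k) <= c * q ^+ k) ->
  exists x, forall k, N (x_ k - x) <= c * q ^+ k / (1 - q).
Proof.
move=> /andP[q0 q1] h.
have c0 : 0 <= c by have := h 0%N; rewrite expr0 mulr1; apply: le_trans; exact: l2norm_ge0.
have q1' : 0 < 1 - q by rewrite subr_gt0.
(* The factor 1 - q^j makes the geometric estimate inductive: the step from j to j + 1 is then an
   equality. *)
have d k j : N (x_ k - x_ (k + j)%N) <= c * q ^+ k / (1 - q) * (1 - q ^+ j).
  elim: j => [|j ih]; first by rewrite addn0 subrr l2norm0 expr0 subrr mulr0.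
  have -> : x_ k - x_ (k + j.+1)%N = (x_ k - x_ (k + j)%N) - (x_ (k + j.+1)%N - x_ (k + j)%N).
    by rewrite opprB addrA subrK.
  apply: le_trans (l2normD _ _) _; rewrite l2normN addnS.
  apply: le_trans (lerD ih (h _)) _; rewrite exprD exprS.
  rewrite -subr_ge0; set e := (X in 0 <= X).
  suff -> : e = 0 by [].
  by rewrite /e; field; rewrite gt_eqF.
have cv (p : R[i] -> R) : (forall z w, p (z - w) = p z - p w) ->
    (forall z, `|p z| <= Normc.normc z) -> forall i, cvgn (fun k => p (x_ k i)).
  move=> pB ple i.
  have : cvgn (series (fun k => p (x_ k.+1 i) - p (x_ k i))).
    apply: normed_cvg; apply: (@series_le_cvg _ _ (geometric c q)).
    - by move=> n /=.
    - by move=> n /=; rewrite mulr_ge0 ?exprn_ge0.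
    - move=> n /=; rewrite -pB -ell2_sub; apply: le_trans (ple _) _.
      exact: le_trans (coord_le _ _) (h _).
    - by apply: is_cvg_geometric_series; rewrite ger0_norm.
  have -> : series (fun k => p (x_ k.+1 i) - p (x_ k i)) = fun k => p (x_ k i) - p (x_ 0%N i).
    apply/funext => n; rewrite /series/=; elim: n => [|n ih]; first by rewrite big_geq// subrr.
    by rewrite big_nat_recr//= ih; ring.
  move=> hc; have -> : (fun k => p (x_ k i)) =
      (fun k => p (x_ k i) - p (x_ 0%N i)) \+ cst (p (x_ 0%N i)).
    by apply/funext => k /=; rewrite subrK.
  by apply: is_cvgD => //; exact: is_cvg_cst.
have cR : forall i, cvgn (fun k => Re (x_ k i)).
  by apply: cv => [[? ?] [? ?] //|]; exact: normc_Re.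
have cI : forall i, cvgn (fun k => Im (x_ k i)).
  by apply: cv => [[? ?] [? ?] //|]; exact: normc_Im.
pose u i : R[i] := limn (fun k => Re (x_ k i)) +i* limn (fun k => Im (x_ k i)).
have hu k n : sqpart n (fun i => x_ k i - u i) <= (c * q ^+ k / (1 - q)) ^+ 2.
  apply: (@sqpart_lim _ \oo _ (fun m i => x_ k i - x_ m i)).
  - move=> i; have -> : Re (x_ k i - u i) = Re (x_ k i) - Re (u i) by case: (x_ k i).
    under eq_fun.
      move=> m; have -> : Re (x_ k i - x_ m i) = Re (x_ k i) - Re (x_ m i).
        by case: (x_ k i) (x_ m i) => ? ? [].
      over.
    by apply: cvgB; [exact: cvg_cst|exact: cR].
  - move=> i; have -> : Im (x_ k i - u i) = Im (x_ k i) - Im (u i) by case: (x_ k i).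
    under eq_fun.
      move=> m; have -> : Im (x_ k i - x_ m i) = Im (x_ k i) - Im (x_ m i).
        by case: (x_ k i) (x_ m i) => ? ? [].
      over.
    by apply: cvgB; [exact: cvg_cst|exact: cI].
  - exists k => // m /= km; apply: le_trans (sqpart_le (x_ k - x_ m : ell2 R) n) _.
    have C0 : 0 <= c * q ^+ k / (1 - q) by rewrite divr_ge0 ?mulr_ge0 ?exprn_ge0 ?(ltW q1').
    rewrite lerXn2r ?nnegrE ?l2norm_ge0//.
    rewrite -(subnKC km); apply: le_trans (d _ _) _.
    by rewrite ler_piMr// gerBl exprn_ge0.
(* The coordinatewise limit u is not yet known to be square summable, but x_0 - u is, by [hu] at 0;
   the limit vector is recovered as x_0 - w. *)
have [w hw] := ell2_of_bound (hu 0%N).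
exists (x_ 0%N - w) => k; apply: l2norm_le; first by rewrite divr_ge0 ?mulr_ge0 ?exprn_ge0 ?(ltW q1').
move=> n; apply: le_trans (hu k n).
by apply: ler_sum => i _; rewrite !ell2_sub hw subKr.
Qed.

Definition mx_bound A (c : R) := forall n (a : nat -> R),
  \sum_(m < n) (\sum_(k < n) A m k * a k) ^+ 2 <= c ^+ 2 * \sum_(k < n) a k ^+ 2.

(** [c] is some admissible bound, not the norm; [represents_bound] exchanges it for a better one. *)
Definition represents A (c : R) (T : ell2 R -> ell2 R) :=
  [/\ 0 <= c, forall x, N (T x) <= c * N x &
      forall m n, T (basis R n) m = (A m n)%:C].

Lemma mx_bound_complex A c n u : mx_bound A c ->
  sqpart n (fun m => \sum_(k < n) u k * (A m k)%:C) <= c ^+ 2 * sqpart n u.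
Proof.
move=> hA; rewrite /sqpart.
under eq_bigr do rewrite normc_sq; under [in leRHS]eq_bigr do rewrite normc_sq.
rewrite !big_split/= mulrDr.
have := lerD (hA n (fun k => Re (u k))) (hA n (fun k => Im (u k))).
congr (_ + _ <= _); apply: eq_bigr => m _; congr (_ ^+ 2).
  elim/big_rec2: _ => // k a b _ ->; rewrite ReD ReM/= mulr0 subr0.
  by rewrite mulrC.
elim/big_rec2: _ => // k a b _ ->; rewrite ImD ImM/= mulr0 add0r.
by rewrite mulrC.
Qed.

(** The m-th coordinate of T x is the inner product of x with row m, so linearity comes from
    [inner], and the bound on finite sections passes to the limit. *)
Lemma matrix_operator_exists A c : 0 <= c -> (forall m n, A m n = A n m) ->
  mx_bound A c -> exists T : {linear ell2 R -> ell2 R}, represents A c T.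
Proof.
move=> c0 symA hA.
have /choice[row hrow] : forall m, exists r : ell2 R, forall n, r n = (A m n)%:C.
  move=> m; apply: (@ell2_of_bound _ (c ^+ 2)) => n.
  apply: le_trans (sqpart_homo _ (leq_maxl n m.+1)) _.
  have mn : (m < maxn n m.+1)%N by rewrite leq_maxr.
  (* Tested on the m-th unit vector, the bound controls column m, which is row m by symmetry. *)
  have := hA (maxn n m.+1) (fun k => (k == m)%:R).
  have -> : \sum_(k < maxn n m.+1) ((k : nat) == m)%:R ^+ 2 = 1 :> R.
    rewrite (bigD1 (Ordinal mn))//= eqxx expr1n big1 ?addr0//.
    move=> i /negP h; case: (@eqP _ (nat_of_ord i) m) => [e|]; last by rewrite expr0n.
    by exfalso; apply: h; apply/eqP/val_inj.
  rewrite mulr1.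
  apply: le_trans; apply: ler_sum => i _.
  rewrite (bigD1 (Ordinal mn))//= eqxx big1 ?addr0 ?mulr1; last first.
    move=> k /negP h; case: (@eqP _ (nat_of_ord k) m) => [e|]; last by rewrite mulr0.
    by exfalso; apply: h; apply/eqP/val_inj.
  by rewrite sqr_sqrtr ?addr_ge0 ?sqr_ge0// expr0n/= addr0 symA.
have hu x n : sqpart n (fun m => inner x (row m)) <= c ^+ 2 * N x ^+ 2.
  apply: (@sqpart_lim _ \oo _ (fun M m => inner_part M x (row m))).
  - by move=> i; exact: inner_cvgRe.
  - by move=> i; exact: inner_cvgIm.
  exists n => // M /= nM; apply: le_trans (sqpart_homo _ nM) _.
  apply: le_trans (_ : c ^+ 2 * sqpart M x <= _); last first.
    by rewrite ler_wpM2l ?sqr_ge0 ?sqpart_le.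
  apply: le_trans (mx_bound_complex M x hA).
  apply: ler_sum => i _; rewrite /inner_part.
  under eq_bigr do rewrite hrow.
  rewrite (_ : \sum_(i0 < M) _ = \sum_(k < M) x k * (A i k)%:C)//.
  by apply: eq_bigr => k _; congr (_ * _); apply: complex_ext; rewrite ?ReJ ?ImJ //= oppr0.
have /choice[f hf] x := ell2_of_bound (hu x).
have lf : linear f.
  by move=> a x y; apply: ell2_ext => n; rewrite ell2_add ell2_scale !hf innerPl.
pose T : {linear ell2 R -> ell2 R} := HB.pack f (GRing.isLinear.Build _ _ _ _ f lf).
exists T; split => // [x|m n].
  apply: l2norm_le => [|n]; first by rewrite mulr_ge0 ?l2norm_ge0.
  rewrite exprMn; apply: le_trans (hu x n).
  by apply: ler_sum => i _; rewrite hf.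
by rewrite /= hf -inner_conj inner_basis hrow; apply: complex_ext; rewrite ?ReJ ?ImJ //= oppr0.
Qed.

Lemma small_eq0 (z : R[i]) : (forall e : R, 0 < e -> Normc.normc z <= e) -> z = 0.
Proof.
move=> h; apply: Normc.eq0_normc; apply/eqP; rewrite eq_le normc_ge0 andbT.
by apply/ler_addgt0Pr => e e0; rewrite add0r; exact: h.
Qed.

(** Boundedness gives continuity and truncations are dense, so the values on the basis decide. This
    is how equalities of entries become equalities of operators. *)
Lemma bounded_functional_ext (f g : ell2 R -> R[i]) (c d : R) :
  (forall a x y, f (a *: x + y) = a * f x + f y) ->
  (forall a x y, g (a *: x + y) = a * g x + g y) ->
  (forall x, Normc.normc (f x) <= c * N x) ->
  (forall x, Normc.normc (g x) <= d * N x) ->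
  (forall n, f (basis R n) = g (basis R n)) -> f =1 g.
Proof.
move=> lf lg bf bg fg x.
pose h x := f x - g x.
have lh a y z : h (a *: y + z) = a * h y + h z.
  by rewrite /h lf lg mulrBr opprD addrACA.
have bh y : Normc.normc (h y) <= (`|c| + `|d|) * N y.
  rewrite mulrDl; apply: le_trans (le_normcD _ _) _; rewrite normcN.
  apply: lerD; [apply: le_trans (bf _) _|apply: le_trans (bg _) _];
    by rewrite ler_wpM2r ?l2norm_ge0// ler_norm.
have h0 : h 0 = 0.
  have := lh 1 0 0; rewrite scaler0 addr0 mul1r => /(congr1 (fun z => z - h 0)).
  by rewrite subrr addrK.
have ht M : h (trunc M x) = 0.
  rewrite /trunc; elim/big_rec: _ => // i y _ hy.
  by rewrite lh hy addr0 /h fg subrr mulr0.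
apply/eqP; rewrite -subr_eq0 -/(h x); apply/eqP/small_eq0 => e e0.
have cd : 0 < `|c| + `|d| + 1 by rewrite ltr_wpDl// addr_ge0.
have [M hM] := trunc_tail x (divr_gt0 e0 cd).
have -> : h x = h (x - trunc M x).
  by rewrite -[x - _]addrC -scaleN1r lh ht mulr0 add0r.
apply: le_trans (bh _) _; move: hM; rewrite ler_pdivlMr// => hM.
by have := l2norm_ge0 (x - trunc M x); nra.
Qed.

Section operator.
Variables (A : nat -> nat -> R) (c : R) (T : {linear ell2 R -> ell2 R}).
Hypothesis AT : represents A c T.

Lemma represents_ge0 : 0 <= c. Proof. by case: AT. Qed.
Lemma represents_le x : N (T x) <= c * N x. Proof. by case: AT. Qed.
Lemma represents_basis m n : T (basis R n) m = (A m n)%:C. Proof. by case: AT. Qed.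

Lemma represents_inner m n : inner (T (basis R n)) (basis R m) = (A m n)%:C.
Proof. by rewrite inner_basis represents_basis. Qed.

Lemma represents_unique d (T' : {linear ell2 R -> ell2 R}) :
  represents A d T' -> T =1 T'.
Proof.
move=> [d0 bT' AT'] x; apply: ell2_ext => m.
apply: (@bounded_functional_ext (fun x => T x m) (fun x => T' x m) c d).
- by move=> a y z; rewrite linearP.
- by move=> a y z; rewrite linearP.
- by move=> y; apply: le_trans (coord_le _ _) (represents_le y).
- by move=> y; apply: le_trans (coord_le _ _) (bT' y).
- by move=> n; rewrite AT' represents_basis.
Qed.

(** Some operator with the bound [d] has the same matrix, and uniqueness identifies it with T. *)
Lemma represents_bound d : 0 <= d -> (forall m n, A m n = A n m) ->
  mx_bound A d -> represents A d T.
Proof.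
move=> d0 symA hA; have [T' hT'] := matrix_operator_exists d0 symA hA.
split=> // [x|m n]; last exact: represents_basis.
by rewrite (represents_unique hT'); case: hT'.
Qed.

Lemma represents_continuous : continuous T.
Proof.
move=> x; apply/(@cvgrPdist_lt _ (ell2 R) _ _ (nbhs_filter x)) => e e0.
have [e' e'0 ->] : exists2 e' : R, 0 < e' & e = e'%:C.
  exists (Re e); move: e0; rewrite ltcE /= => /andP[/eqP h h0] //.
  by apply: complex_ext.
have c1 : 0 < c + 1 by rewrite ltr_wpDl// represents_ge0.
have d0 : 0 < (e' / (c + 1))%:C by rewrite ltcR divr_gt0.
near=> y; rewrite -linearB ell2_normE ltcR.
have : `|x - y| < (e' / (c + 1))%:C by near: y; exact: cvgr_dist_lt.
rewrite ell2_normE ltcR ltr_pdivlMr// => h.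
apply: le_lt_trans (represents_le _) _; apply: le_lt_trans h.
by rewrite mulrC ler_wpM2l ?l2norm_ge0// lerDl.
Unshelve. all: by end_near. Qed.

(** The extension from the basis is made one variable at a time: first in x with y a basis vector,
    then in y after conjugation. *)
Lemma represents_selfadjoint : (forall m n, A m n = A n m) -> self_adjoint T.
Proof.
move=> symA.
have bl x y : Normc.normc (inner (T x) y) <= c * N y * N x.
  apply: le_trans (inner_CS _ _) _; rewrite mulrAC.
  by rewrite ler_wpM2r ?l2norm_ge0// represents_le.
have br x y : Normc.normc (inner x (T y)) <= N (T y) * N x.
  by rewrite mulrC inner_CS.
have step m x : inner (T x) (basis R m) = inner x (T (basis R m)).
  apply: (@bounded_functional_ext (fun x => inner (T x) (basis R m))
    (fun x => inner x (T (basis R m))) _ _ _ _ (bl^~ _) (br^~ _)).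
  - by move=> a y z; rewrite linearP innerPl.
  - by move=> a y z; rewrite innerPl.
  - move=> n; rewrite represents_inner -inner_conj represents_inner symA.
    by apply: complex_ext; rewrite ?ReJ ?ImJ //= oppr0.
move=> x y; rewrite -(inner_conj y) -(inner_conj (T y)); congr (Num.conj _).
apply: (@bounded_functional_ext (fun y => inner y (T x)) (fun y => inner (T y) x)
   _ _ _ _ (br^~ _) (bl^~ _)).
- by move=> a z w; rewrite innerPl.
- by move=> a z w; rewrite linearP innerPl.
- by move=> n; rewrite -inner_conj step inner_conj.
Qed.

Definition mx_psd (B : nat -> nat -> R) := forall n (a : nat -> R),
  0 <= \sum_(m < n) \sum_(k < n) B m k * a m * a k.

(** Self-adjointness makes the form real at x. On a truncation its real part is the quadratic form
    at the real parts plus that at the imaginary parts, and a negative value at x would survive a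
    long truncation. *)
Lemma represents_positive : (forall m n, A m n = A n m) -> mx_psd A -> positive_op T.
Proof.
move=> symA psdA x; rewrite lecE /=; apply/andP; split.
  have /(congr1 Im) : inner (T x) x = Num.conj (inner (T x) x).
    by rewrite inner_conj -represents_selfadjoint.
  rewrite ImJ => h; apply/eqP; lra.
rewrite leNgt; apply/negP => neg.
have pos M : 0 <= Re (inner (T (trunc M x)) (trunc M x)).
  have -> : inner (T (trunc M x)) (trunc M x) =
      \sum_(m < M) \sum_(k < M) (A m k)%:C * Num.conj (x m) * x k.
    rewrite {1}/trunc linear_sum inner_suml.
    under eq_bigr do rewrite linearZ/= innerZl -inner_conj {1}/trunc inner_suml rmorph_sum.
    under eq_bigr => i _.
      rewrite mulr_sumr; under eq_bigr do rewrite innerZl rmorphM /= inner_conj represents_inner.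
      over.
    rewrite exchange_big; apply: eq_bigr => m _; apply: eq_bigr => k _ /=; ring.
  have e (I : finType) (F : I -> R[i]) : Re (\sum_i F i) = \sum_i Re (F i).
    by elim/big_rec2: _ => // i a b _ <-; rewrite ReD.
  rewrite e; under eq_bigr do rewrite e.
  have := addr_ge0 (psdA M (fun k => Re (x k))) (psdA M (fun k => Im (x k))).
  congr (0 <= _); rewrite -big_split; apply: eq_bigr => m _.
  rewrite -big_split; apply: eq_bigr => k _ /=.
  by rewrite !ReM !ImM ReJ ImJ /=; ring.
have cN : 0 < 2 * c * N x + 1 by rewrite ltr_wpDl// ?mulr_ge0 ?l2norm_ge0 ?represents_ge0.
have e0 : 0 < - Re (inner (T x) x) / 2 / (2 * c * N x + 1) by rewrite !divr_gt0 ?oppr_gt0.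
have [M hM] := trunc_tail x e0.
have D : inner (T x) x = inner (T (trunc M x)) (trunc M x) +
   (inner (T (trunc M x)) (x - trunc M x) + inner (T (x - trunc M x)) x).
  by rewrite linearB innerBl innerBr addrA addrC; ring.
have h1 : Normc.normc (inner (T (trunc M x)) (x - trunc M x)) <= c * N x * N (x - trunc M x).
  apply: le_trans (inner_CS _ _) _; rewrite ler_wpM2r ?l2norm_ge0//.
  apply: le_trans (represents_le _) _.
  by rewrite ler_wpM2l ?represents_ge0 ?l2norm_trunc_le.
have h2 : Normc.normc (inner (T (x - trunc M x)) x) <= c * N x * N (x - trunc M x).
  apply: le_trans (inner_CS _ _) _; rewrite mulrAC ler_wpM2r ?l2norm_ge0//.
  exact: represents_le.
have := pos M; move: (congr1 Re D); rewrite !ReD.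
have := le_trans (normc_Re _) h1; have := le_trans (normc_Re _) h2.
rewrite !ler_norml => /andP[k1 _] /andP[k2 _].
move: hM; rewrite ler_pdivlMr//.
have := l2norm_ge0 (x - trunc M x); move: k1 k2 neg.
set r := Re (inner (T x) x); set w := N (x - _); set p := Re _; set s := Re _; set t := Re _.
move=> k1 k2 neg w0 hM E P.
have : 2 * c * N x * w <= - r / 2 by move: hM; rewrite mulrDr mulr1; lra.
lra.
Qed.
End operator.
End matrix_operators.

(** * Compactness *)

Section operator_theory.
Variable R : realType.
Implicit Types (x y : ell2 R) (u : nat -> R[i]) (A : nat -> nat -> R).
Local Notation N x := (l2norm (ell2_seq x)).
Local Notation basis := Defs.basis.
Local Notation Re := (@complex.Re R).
Local Notation Im := (@complex.Im R).

Lemma ultra_bounded_cvg (T : Type) (F : set_system T) (f : T -> R) (c : R) :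
  UltraFilter F -> (\forall t \near F, `|f t| <= c) ->
  exists l : R, f t @[t --> F] --> l.
Proof.
move=> FU hc.
have FF : ProperFilter F by case: FU.
have : (f @ F) `[- c, c]%classic.
  by rewrite /fmap /=; apply: filterS hc => t; rewrite /= in_itv /= ler_norml.
move=> /(@segment_compact _ (- c) c (f @ F) _)[l [_ lF]].
exists l => B Bl; have [//|FnB] := in_ultra_setVsetC (f @^-1` B) FU.
by have [z [zB Bz]] := lF (~` B) B FnB Bl; have := zB Bz.
Qed.

Lemma ell2_eps (e : R[i]) : 0 < e -> exists2 e' : R, 0 < e' & e = e'%:C.
Proof.
move=> e0; exists (Re e); move: e0; rewrite ltcE /= => /andP[/eqP h h0] //.
by apply: complex_ext.
Qed.

Lemma ell2_closureP (P : set (ell2 R)) y : closure P y ->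
  forall e : R, 0 < e -> exists2 z, P z & N (y - z) < e.
Proof.
move=> Py e e0; have e0' : 0 < e%:C :> R[i] by rewrite ltcR.
have /Py[z [Pz zy]] := @nbhsx_ballx _ (ell2 R) y _ e0'.
by exists z => //; move: zy; rewrite -ball_normE /= ell2_normE ltcR.
Qed.

Lemma ell2_closed (P : set (ell2 R)) :
  (forall y, (forall e : R, 0 < e -> exists2 z, P z & N (y - z) < e) -> P y) ->
  closed P.
Proof. by move=> h y /ell2_closureP; exact: h. Qed.

Lemma sub_trunc_le M x : N (x - trunc M x) <= N x.
Proof.
have := trunc_tail_homo x (leq0n M); rewrite (_ : trunc 0 x = 0) ?subr0//.
by rewrite /trunc big_ord0.
Qed.

Definition uniform_tails (K : set (ell2 R)) :=
  forall e : R, 0 < e -> exists M, forall y, K y -> N (y - trunc M y) <= e.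

(** The classical criterion in l^2. Along an ultrafilter every coordinate converges, which replaces
    a diagonal extraction; the uniform tails turn coordinatewise convergence into norm
    convergence. *)
Lemma compact_of_tails (K : set (ell2 R)) (c : R) : closed K ->
  (forall y, K y -> N y <= c) -> uniform_tails K -> compact K.
Proof.
move=> cK bK tK; rewrite compact_ultra => F FU FK.
have FF : ProperFilter F by case: FU.
have /choice[a ha] : forall i, exists l : R, Re ((y : ell2 R) i) @[y --> F] --> l.
  move=> i; apply: (@ultra_bounded_cvg _ _ _ c) => //.
  apply: filterS FK => y /bK; apply: le_trans.
  exact: le_trans (normc_Re _) (coord_le _ _).
have /choice[b hb] : forall i, exists l : R, Im ((y : ell2 R) i) @[y --> F] --> l.
  move=> i; apply: (@ultra_bounded_cvg _ _ _ c) => //.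
  apply: filterS FK => y /bK; apply: le_trans.
  exact: le_trans (normc_Im _) (coord_le _ _).
have bu n : sqpart n (fun i => a i +i* b i) <= c ^+ 2.
  apply: (@sqpart_lim _ _ F _ (fun y i => (y : ell2 R) i)) => //.
  apply: filterS FK => y Ky; apply: le_trans (sqpart_le y n) _.
  by rewrite lerXn2r ?nnegrE ?l2norm_ge0 ?(le_trans (l2norm_ge0 _) (bK _ Ky))// bK.
have [x hx] := ell2_of_bound bu.
have xR i : Re ((y : ell2 R) i) @[y --> F] --> Re (x i) by rewrite hx; exact: ha.
have xI i : Im ((y : ell2 R) i) @[y --> F] --> Im (x i) by rewrite hx; exact: hb.
(* The limit x inherits the tail bound, although it is not yet known to lie in K. *)
have tx e : 0 < e -> exists2 M, N (x - trunc M x) <= e &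
    forall y, K y -> N (y - trunc M y) <= e.
  move=> e0; have [M hM] := tK _ e0; exists M => //.
  apply: l2norm_le => [|n]; first exact: ltW.
  apply: (@sqpart_lim _ _ F _ (fun y i => ((y : ell2 R) - trunc M y) i)).
  - move=> i; rewrite ell2_sub truncE; under eq_fun do rewrite ell2_sub truncE.
    case: ifP => _; last by under eq_fun do rewrite subr0; rewrite subr0; exact: xR.
    by under eq_fun do rewrite subrr; rewrite subrr; exact: cvg_cst.
  - move=> i; rewrite ell2_sub truncE; under eq_fun do rewrite ell2_sub truncE.
    case: ifP => _; last by under eq_fun do rewrite subr0; rewrite subr0; exact: xI.
    by under eq_fun do rewrite subrr; rewrite subrr; exact: cvg_cst.
  apply: filterS FK => y Ky; apply: le_trans (sqpart_le (y - trunc M y : ell2 R) n) _.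
  by rewrite lerXn2r ?nnegrE ?l2norm_ge0 ?(ltW e0)// hM.
have Fx : F --> x.
  apply/(@cvgrPdist_lt _ (ell2 R) _ F) => e /ell2_eps[e' e0 ->].
  have e4 : 0 < e' / 4 by rewrite divr_gt0.
  have [M txM tyM] := tx _ e4.
  (* Real and imaginary parts of M coordinates, each this small, add up to at most e' / 4; [M.+1]
     keeps the quotient meaningful when M = 0. *)
  have hR : \forall y \near F, forall i : 'I_M, `|Re (x i) - Re ((y : ell2 R) i)| < e' / 4 / M.+1%:R / 2.
    apply: filter_forall => i; move: (xR i) => /cvgrPdist_lt; apply; rewrite !divr_gt0//.
  have hI : \forall y \near F, forall i : 'I_M, `|Im (x i) - Im ((y : ell2 R) i)| < e' / 4 / M.+1%:R / 2.
    apply: filter_forall => i; move: (xI i) => /cvgrPdist_lt; apply; rewrite !divr_gt0//.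
  near=> y; rewrite ell2_normE ltcR.
  have kR : forall i : 'I_M, `|Re (x i) - Re (y i)| < e' / 4 / M.+1%:R / 2 by near: y.
  have kI : forall i : 'I_M, `|Im (x i) - Im (y i)| < e' / 4 / M.+1%:R / 2 by near: y.
  have -> : x - y = (x - trunc M x) + (trunc M (x - y) - (y - trunc M y)).
    apply: ell2_ext => n; rewrite !(ell2_add, ell2_opp, truncE).
    by case: ifP => _; ring.
  apply: le_lt_trans (l2normD _ _) _.
  apply: le_lt_trans (lerD txM (l2normD _ _)) _; rewrite l2normN.
  have Ky : K y by near: y.
  have := tyM _ Ky.
  have : N (trunc M (x - y)) <= e' / 4.
    apply: le_trans (l2norm_sum _ _ _) _.
    apply: le_trans (_ : \sum_(i < M) e' / 4 / M.+1%:R <= _); last first.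
      rewrite sumr_const card_ord -[_ *+ M]mulr_natr mulrAC ler_pdivrMr//.
      by rewrite ler_wpM2l ?(ltW e4)// ler_nat.
    apply: ler_sum => i _; rewrite l2normZ.
    have -> : N (basis R i) = 1.
      have := inner_self (basis R i); rewrite inner_basis basisE eqxx.
      move=> /(congr1 Re)/= /esym h; have := l2norm_ge0 (basis R i); nra.
    rewrite mulr1; apply: le_trans (normc_le_ReIm _) _.
    rewrite ell2_sub ReD ImD.
    have -> : Re (- y i) = - Re (y i) by case: (y i).
    have -> : Im (- y i) = - Im (y i) by case: (y i).
    by rewrite [leRHS]splitr lerD// ltW.
  lra.
exists x; split => //.
apply: cK => B xB; have KB : F (K `&` B) by apply: filterI FK _; exact: Fx.
by have [z [Kz Bz]] := @filter_ex _ F FF _ KB; exists z.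
Unshelve. all: by end_near. Qed.

(** Deleting the M x M corner changes the operator by finite rank, so [section_small] is norm
    approximation by finite corners. *)
Definition off_section M A m n : R := if (m < M)%N && (n < M)%N then 0 else A m n.

Definition section_small A := forall e : R, 0 < e -> exists M, mx_bound (off_section M A) e.

Section represented.
Variables (A : nat -> nat -> R) (c : R) (T : {linear ell2 R -> ell2 R}).
Hypotheses (AT : represents A c T) (symA : forall m n, A m n = A n m).

(** The deleted corner maps the first M coordinates to the first M coordinates. It is therefore
    invisible in the later output coordinates, and also on inputs that vanish on the first M. *)
Lemma off_section_operator M (e : R) : 0 <= e -> mx_bound (off_section M A) e ->
  exists E : {linear ell2 R -> ell2 R}, [/\ represents (off_section M A) e E,
    forall x m, (M <= m)%N -> T x m = E x m &
    forall x, T (x - trunc M x) = E (x - trunc M x)].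
Proof.
move=> e0 he; have [|E hE] := @matrix_operator_exists _ (off_section M A) e e0 _ he.
  by move=> m n; rewrite /off_section andbC symA.
exists E; split => // [x m Mm|x].
  apply: (@bounded_functional_ext _ (fun x => T x m) (fun x => E x m) c e).
  - by move=> a y z; rewrite linearP.
  - by move=> a y z; rewrite linearP.
  - by move=> y; apply: le_trans (coord_le _ _) (represents_le AT y).
  - by move=> y; apply: le_trans (coord_le _ _) (represents_le hE y).
  - move=> n; rewrite (represents_basis AT) (represents_basis hE) /off_section.
    by rewrite ltnNge Mm.
have lt := @trunc_linear R M.
have lin (S : {linear ell2 R -> ell2 R}) a y z :
    S (a *: y + z - trunc M (a *: y + z)) = a *: S (y - trunc M y) + S (z - trunc M z).
  by rewrite lt -linearP; congr (S _); rewrite scalerBr opprD addrACA.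
apply: ell2_ext => m.
apply: (@bounded_functional_ext _ (fun x => T (x - trunc M x) m)
  (fun x => E (x - trunc M x) m) c e).
- by move=> a y z; rewrite lin.
- by move=> a y z; rewrite lin.
- move=> y; apply: le_trans (coord_le _ _) _; apply: le_trans (represents_le AT _) _.
  by rewrite ler_wpM2l ?(represents_ge0 AT)// sub_trunc_le.
- move=> y; apply: le_trans (coord_le _ _) _; apply: le_trans (represents_le hE _) _.
  by rewrite ler_wpM2l// sub_trunc_le.
- move=> n; have -> : basis R n - trunc M (basis R n) = if (n < M)%N then 0 else basis R n.
    apply: ell2_ext => k; rewrite ell2_sub truncE !basisE.
    case: (ltnP n M) => nM; case: (ltnP k M) => kM; rewrite ?subrr ?subr0 ?basisE ?ell2_0//.
      by case: eqP => // kn; move: kM; rewrite kn leqNgt nM.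
    by case: eqP => // kn; move: kM; rewrite kn ltnNge nM.
  case: ifP => nM; first by rewrite !linear0.
  by rewrite (represents_basis AT) (represents_basis hE) /off_section nM andbF.
Qed.

Lemma section_small_tail (e : R) : section_small A -> 0 < e ->
  exists M, forall x, N (T x - trunc M (T x)) <= e * N x.
Proof.
move=> sA e0; have [M hM] := sA _ e0; exists M => x.
have [E [hE TE _]] := off_section_operator (ltW e0) hM.
apply: le_trans (represents_le hE x); apply: l2norm_le (l2norm_ge0 _) _ => n.
apply: le_trans (sqpart_le (E x) n); apply: ler_sum => i _.
rewrite ell2_sub truncE; case: ltnP => iM; last by rewrite subr0 TE.
by rewrite subrr Normc.normc0 expr0n sqr_ge0.
Qed.

(** Complete continuity in quantitative form: mass located far out is almost annihilated. *)
Lemma section_small_le (e : R) : section_small A -> 0 < e ->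
  exists M, forall x, N (T x) <= e * N x + c * N (trunc M x).
Proof.
move=> sA e0; have [M hM] := sA _ e0; exists M => x.
have [E [hE _ TE]] := off_section_operator (ltW e0) hM.
rewrite -{1}[x](subrK (trunc M x)) linearD TE.
apply: le_trans (l2normD _ _) _; apply: lerD (represents_le AT _).
apply: le_trans (represents_le hE _) _.
by rewrite ler_wpM2l ?sub_trunc_le// ltW.
Qed.

Lemma represents_compact : section_small A -> compact_op T.
Proof.
move=> sA; have c0 := represents_ge0 AT.
have TN x : `|x| <= 1 -> N (T x) <= c.
  rewrite ell2_normE lecR => h; apply: le_trans (represents_le AT _) _.
  by rewrite ler_piMr.
apply: (@compact_of_tails _ c); first exact: closed_closure.
  move=> y /ell2_closureP h; apply/ler_addgt0Pr => e e0.
  have [z [x /TN Tx <-]] := h _ e0.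
  rewrite -{2}[y](subrK (T x)) => ?; apply: le_trans (l2normD _ _) _; lra.
move=> e e0; have e2 : 0 < e / 2 by rewrite divr_gt0.
have [M hM] := section_small_tail sA e2; exists M => y /ell2_closureP h.
have [z [x x1 <-] yx] := h _ e2.
have -> : y - trunc M y = (T x - trunc M (T x)) + ((y - T x) - trunc M (y - T x)).
  apply: ell2_ext => n; rewrite !(ell2_add, ell2_opp, truncE).
  by case: ifP => _; ring.
apply: le_trans (l2normD _ _) _; rewrite (splitr e); apply: lerD.
  apply: le_trans (hM _) _; move: x1; rewrite /= ell2_normE lecR => x1.
  by rewrite ler_piMr ?(ltW e2).
exact: le_trans (sub_trunc_le _ _) (ltW yx).
Qed.
End represented.
End operator_theory.

(** * Fredholm operators and Weyl sequences *)

Section fredholm_theory.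
Variable R : realType.
Implicit Types (x y : ell2 R) (u : nat -> R[i]) (A : nat -> nat -> R).
Local Notation N x := (l2norm (ell2_seq x)).
Local Notation basis := Defs.basis.
Local Notation Re := (@complex.Re R).

Lemma geometric_small (q e : R) : 0 <= q < 1 -> 0 < e -> exists k, q ^+ k < e.
Proof.
move=> /andP[q0 q1] e0.
have /cvgrPdist_lt/(_ _ e0)[k _ /(_ k (leqnn k))] : q ^+ n @[n --> \oo] --> (0 : R).
  by apply: cvg_expr; rewrite ger0_norm.
by rewrite /= sub0r normrN ger0_norm ?exprn_ge0// => h; exists k.
Qed.

Lemma l2norm_sub_sq x y : N (x - y) ^+ 2 = N x ^+ 2 - 2 * Re (inner y x) + N y ^+ 2.
Proof.
have := inner_self (x - y); rewrite innerBl !innerBr !inner_self -(inner_conj y x).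
move=> /(congr1 Re) /= <-; case: (inner y x) => a b /=; ring.
Qed.

Lemma normc_real (t : R) : 0 <= t -> Normc.normc t%:C = t.
Proof. by move=> t0; rewrite /= expr0n addr0 sqrtr_sqr ger0_norm. Qed.

Lemma conjc_realE (t : R) : Num.conj (t%:C : R[i]) = t%:C.
Proof. by apply: complex_ext; rewrite ?ReJ ?ImJ //= oppr0. Qed.

(** The numbers obtained from the shifts t and -t differ by 2 t, so one of them has modulus at least
    t. *)
Lemma unit_shift_inner_ge x y (t : R) : 0 <= t -> N x = 1 ->
  exists s : R[i], Normc.normc s = t /\ t <= Normc.normc (inner x (y + s *: x)).
Proof.
move=> t0 x1; have tN := normc_real t0.
have e (s : R[i]) : inner x (y + s *: x) = inner x y + Num.conj s.
  by rewrite innerDr innerZr inner_self x1 expr1n mulr1.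
case: (lerP t (Normc.normc (inner x y + t%:C))) => h.
  by exists t%:C; rewrite e conjc_realE.
exists (- t%:C); rewrite normcN e rmorphN /= conjc_realE; split=> //.
rewrite leNgt; apply/negP => h'.
have : Normc.normc ((inner x y + t%:C) - (inner x y - t%:C)) < t + t.
  by apply: le_lt_trans (le_normcD _ _) _; rewrite normcN; exact: ltrD h h'.
have -> : (inner x y + t%:C) - (inner x y - t%:C) = (t + t)%:C.
  by rewrite rmorphD; ring.
by rewrite normc_real ?addr_ge0// ltxx.
Qed.

Section coercive.
Variables (T : {linear ell2 R -> ell2 R}) (c d : R) (theta : R[i]).
Hypotheses (c0 : 0 <= c) (T_le : forall x, N (T x) <= c * N x) (d_gt0 : 0 < d).
Hypotheses (theta1 : Normc.normc theta = 1)
  (T_ge : forall x, d * N x ^+ 2 <= Re (theta * inner (T x) x)).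

Lemma coercive_le x : d * N x <= N (T x).
Proof.
have [->|x0] := eqVneq (N x) 0; first by rewrite mulr0 l2norm_ge0.
have xp : 0 < N x by rewrite lt_def x0 l2norm_ge0.
have : d * N x ^+ 2 <= N (T x) * N x.
  apply: le_trans (T_ge x) _; apply: le_trans (ler_norm _) _.
  apply: le_trans (normc_Re _) _; rewrite Normc.normcM theta1 mul1r.
  exact: inner_CS.
by rewrite expr2 mulrA ler_pM2r.
Qed.

(* Richardson iteration: x - tau theta (T x - y) is a contraction for small tau. *)
Lemma coercive_surjective y : exists x, T x = y.
Proof.
(* One step multiplies the squared norm by at most 1 - 2 tau d + tau^2 c^2. With this tau the last
   term is at most tau d, leaving [q2] = 1 - tau d; c + d in place of c gives 0 <= q2 and a nonzero
   denominator even if c = 0. *)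
pose tau := d / (c + d) ^+ 2.
have cd : 0 < c + d by rewrite ltr_wpDl.
have tau0 : 0 < tau by rewrite divr_gt0 ?exprn_gt0.
pose q2 := 1 - d ^+ 2 / (c + d) ^+ 2.
have q2_ge0 : 0 <= q2.
  rewrite subr_ge0 ler_pdivrMr ?exprn_gt0// mul1r.
  by rewrite lerXn2r ?nnegrE ?(ltW d_gt0) ?(ltW cd)// lerDr.
have q2_lt1 : q2 < 1 by rewrite gtrBl divr_gt0 ?exprn_gt0.
pose q := Num.sqrt q2.
have q0 : 0 <= q by exact: sqrtr_ge0.
have q1 : q < 1 by rewrite -sqrtr1 ltr_sqrt.
have tauN : Normc.normc (tau%:C * theta) = tau.
  by rewrite Normc.normcM theta1 mulr1 normc_real// ltW.
have q_sq : q ^+ 2 = q2 by rewrite sqr_sqrtr.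
have step r : N (r - (tau%:C * theta) *: T r) <= q * N r.
  rewrite -(@ler_sqr _ _ (q * N r)) ?nnegrE ?mulr_ge0 ?l2norm_ge0//.
  rewrite exprMn q_sq l2norm_sub_sq innerZl l2normZ tauN.
  have -> : Re (tau%:C * theta * inner (T r) r) = tau * Re (theta * inner (T r) r).
    by rewrite -mulrA ReM /= mul0r subr0.
  have h1 := T_ge r.
  have h2 : N (T r) ^+ 2 <= c ^+ 2 * N r ^+ 2.
    by rewrite -exprMn lerXn2r ?nnegrE ?mulr_ge0 ?l2norm_ge0.
  have h3 := sqr_ge0 (N r).
  have e : tau ^+ 2 * (c + d) ^+ 2 = tau * d.
    by rewrite /tau; field; rewrite gt_eqF.
  have e2 : q2 = 1 - tau * d by rewrite /q2 /tau; field; rewrite gt_eqF.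
  rewrite e2 exprMn.
  have h4 : tau ^+ 2 * N (T r) ^+ 2 <= tau ^+ 2 * (c ^+ 2 * N r ^+ 2).
    by rewrite ler_wpM2l ?sqr_ge0.
  have h5 : tau * (d * N r ^+ 2) <= tau * Re (theta * inner (T r) r).
    by rewrite ler_wpM2l ?(ltW tau0).
  have h6 : tau ^+ 2 * c ^+ 2 <= tau * d.
    rewrite -e ler_wpM2l ?sqr_ge0// lerXn2r ?nnegrE ?(ltW cd)//.
    by rewrite lerDl ltW.
  have h7 := ler_wpM2r h3 h6.
  nra.
pose x_ := fix F n := if n is n'.+1 then F n' - (tau%:C * theta) *: (T (F n') - y) else 0.
have r_ k : N (T (x_ k) - y) <= N y * q ^+ k.
  elim: k => [|k ih]; first by rewrite /= linear0 sub0r l2normN expr0 mulr1.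
  rewrite /= linearB linearZ /= addrAC; apply: le_trans (step _) _.
  by rewrite exprS mulrCA ler_wpM2l.
have [||x hx] := @geometric_complete _ x_ (tau * N y) q _ _; first by rewrite q0.
  move=> k; have -> : x_ k.+1 - x_ k = - ((tau%:C * theta) *: (T (x_ k) - y)).
    by rewrite [x_ k.+1]/(x_ k - (tau%:C * theta) *: (T (x_ k) - y)) addrAC subrr sub0r.
  rewrite l2normN l2normZ tauN.
  by rewrite -mulrA ler_wpM2l ?(ltW tau0).
exists x; apply/eqP; rewrite -subr_eq0; apply/eqP/l2norm_eq0/eqP.
rewrite eq_le l2norm_ge0 andbT; apply/ler_addgt0Pr => e e0; rewrite add0r.
pose K := c * (tau * N y / (1 - q)) + N y.
have q1' : 0 < 1 - q by rewrite subr_gt0.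
have K0 : 0 <= K.
  exact: addr_ge0 (mulr_ge0 c0 (divr_ge0 (mulr_ge0 (ltW tau0) (l2norm_ge0 _))
    (ltW q1'))) (l2norm_ge0 _).
have K1 : 0 < K + 1 by rewrite ltr_wpDl.
have [|k hk] := @geometric_small q (e / (K + 1)) _ (divr_gt0 e0 K1); first by rewrite q0.
have -> : T x - y = (T (x_ k) - y) - T (x_ k - x).
  by rewrite linearB opprB [RHS]addrC subrKA.
apply: le_trans (l2normD _ _) _; rewrite l2normN.
apply: le_trans (lerD (r_ k) (T_le _)) _.
apply: le_trans (lerD (lexx _) (ler_wpM2l c0 (hx k))) _.
have -> : N y * q ^+ k + c * (tau * N y * q ^+ k / (1 - q)) = K * q ^+ k.
  by rewrite /K; field; rewrite gt_eqF.
move: hk; rewrite ltr_pdivlMr// => hk.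
have := exprn_ge0 k q0; nra.
Qed.
End coercive.

Lemma lipschitz_functional_closed (I : Type) (f : I -> ell2 R -> R[i]) (c : R) :
  (forall i x y, f i (x - y) = f i x - f i y) ->
  (forall i x, Normc.normc (f i x) <= c * N x) ->
  closed [set y | forall i, f i y = 0].
Proof.
move=> fB fc; apply: ell2_closed => y h i; apply: small_eq0 => e e0.
have c1 : 0 < `|c| + 1 by rewrite ltr_wpDl.
have [z fz yz] := h _ (divr_gt0 e0 c1).
have -> : f i y = f i (y - z) by rewrite fB fz subr0.
apply: le_trans (fc _ _) _; move: yz; rewrite ltr_pdivlMr// => yz.
have := ler_norm c; have := l2norm_ge0 (y - z); nra.
Qed.

(** With G the inverse of B, T is B (1 + F) where F has rank at most M. The kernel of T lies in the
    span of the [g i], and the [e i] complete the range to the whole space. *)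
Lemma fredholm_finite_rank (B T : {linear ell2 R -> ell2 R}) (b c d : R) M :
  0 < d -> (forall x, d * N x <= N (B x)) -> (forall y, exists x, B x = y) ->
  (forall x, N (B x) <= b * N x) -> (forall x, N (T x) <= c * N x) ->
  (forall x m, (M <= m)%N -> T x m = B x m) -> fredholm T.
Proof.
move=> d0 Bd /choice[G BG] Bb Tc TB.
have Binj x y : B x = B y -> x = y.
  move=> h; apply/eqP; rewrite -subr_eq0; apply/eqP/l2norm_eq0/eqP.
  rewrite eq_le l2norm_ge0 andbT -(pmulr_rle0 _ d0); apply: le_trans (Bd _) _.
  by rewrite linearB h subrr l2norm0.
have GP a x y : G (a *: x + y) = a *: G x + G y by apply: Binj; rewrite linearP !BG.
have GZ a x : G (a *: x) = a *: G x by apply: Binj; rewrite linearZ/= !BG.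
have GB x y : G (x - y) = G x - G y by apply: Binj; rewrite linearB !BG.
have Gd x : N (G x) <= d^-1 * N x by rewrite ler_pdivlMl//; have := Bd (G x); rewrite BG.
pose f (i : 'I_M) x : R[i] := (T x - B x) i.
pose e (i : 'I_M) := basis R i.
pose g (i : 'I_M) := G (e i).
have TE x : T x = B x + \sum_i f i x *: e i.
  apply: ell2_ext => m; rewrite ell2_add ell2_sum.
  under eq_bigr do rewrite ell2_scale basisE.
  case: (ltnP m M) => mM; last first.
    rewrite TB// big1 ?addr0// => i _; case: eqP => [h|]; last by rewrite mulr0.
    by have := ltn_ord i; rewrite -h ltnNge mM.
  rewrite (bigD1 (Ordinal mM))//= big1 ?addr0.
    by rewrite eqxx mulr1 /f [X in _ = _ + X]ell2_sub addrC subrK.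
  move=> i /negP h; case: (@eqP _ m i) => [mi|]; last by rewrite mulr0.
  by exfalso; apply: h; apply/eqP/val_inj.
have TG x : T x = B (x + \sum_i f i x *: g i).
  rewrite TE linearD linear_sum; congr (_ + _); apply: eq_bigr => i _.
  by rewrite linearZ/= BG.
have fP i a x y : f i (a *: x + y) = a * f i x + f i y.
  by rewrite /f !linearP !(ell2_add, ell2_opp, ell2_scale); ring.
have fB i x y : f i (x - y) = f i x - f i y.
  by rewrite addrC -scaleN1r fP mulN1r addrC.
have f0 i : f i 0 = 0 by rewrite -(subrr 0) fB subrr.
have f_sum i (a : 'I_M -> R[i]) : f i (\sum_j a j *: g j) = \sum_j a j * f i (g j).
  by elim/big_rec2: _ => [|j u v _ <-]; rewrite ?f0 ?fP.
have f_le i x : Normc.normc (f i x) <= (c + b) * N x.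
  apply: le_trans (coord_le _ _) _; apply: le_trans (l2normD _ _) _.
  by rewrite l2normN mulrDl lerD.
split.
(* y is in the range iff the row of the f_j (G y) lies in the row space of this finite matrix. A
   matrix C annihilating exactly that row space turns the range into the common kernel of the
   bounded functionals [phi k], which is closed. *)
- pose G1 : 'M[R[i]]_M := 1%:M + \matrix_(i < M, j < M) f j (g i).
  have [C hC] : exists C : 'M[R[i]]_M, forall r : 'rV_M, (r <= G1)%MS = (r *m C == 0).
    by exists (cokermx G1) => r; rewrite submxE.
  have G1E (r : 'rV_M) j : (r *m G1) 0 j = r 0 j + \sum_i r 0 i * f j (g i).
    rewrite mulmxDr mulmx1 mxE [in X in _ + X]mxE; congr (_ + _).
    by apply: eq_bigr => i _; rewrite [X in _ * X]mxE.
  pose b_ y : 'rV[R[i]]_M := \row_j f j (G y).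
  have b_E y j : b_ y 0 j = f j (G y) by rewrite mxE.
  pose phi (k : 'I_M) y : R[i] := \sum_j f j (G y) * C j k.
  have phiE y k : (b_ y *m C) 0 k = phi k y.
    by rewrite mxE; apply: eq_bigr => j _; rewrite b_E.
  have -> : range T = [set y | forall k, phi k y = 0].
    rewrite eqEsubset; split => [_ [x _ <-] k /=|y hy /=].
      have E : b_ (T x) = (\row_i f i x) *m G1.
        apply/rowP => j; rewrite G1E b_E mxE.
        have -> : G (T x) = x + \sum_i f i x *: g i by apply: Binj; rewrite BG TG.
        rewrite -[x]scale1r fP mul1r f_sum scale1r; congr (_ + _).
        by apply: eq_bigr => i _; rewrite mxE.
      by rewrite -phiE (_ : b_ (T x) *m C = 0) ?mxE//; apply/eqP; rewrite -hC E submxMl.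
    have : (b_ y <= G1)%MS by rewrite hC; apply/eqP/rowP => k; rewrite phiE mxE; exact: hy.
    move=> /submxP[D hD].
    exists (G y - \sum_i D 0 i *: g i) => //; rewrite TG.
    suff fD j : f j (G y - \sum_i D 0 i *: g i) = D 0 j.
      under [X in _ + X]eq_bigr do rewrite fD.
      by rewrite subrK BG.
    by rewrite fB f_sum -b_E hD G1E addrK.
  pose K := \sum_(k < M) \sum_(j < M) (c + b) * d^-1 * Normc.normc (C j k).
  apply: (@lipschitz_functional_closed _ phi K) => [k x y|k x].
    rewrite /phi -sumrB; apply: eq_bigr => j _; by rewrite GB fB mulrBl.
  have cb : 0 <= (c + b) * N x.
    by apply: le_trans (_ : 0 <= N (T x) + N (B x)) _; rewrite ?addr_ge0 ?l2norm_ge0// mulrDl lerD.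
  have t j k' : Normc.normc (f j (G x) * C j k') <= (c + b) * d^-1 * Normc.normc (C j k') * N x.
    rewrite Normc.normcM mulrAC ler_wpM2r ?normc_ge0//.
    (* The signs of b and c are not given; a negative sum forces x = 0. *)
    have [cb0|cb0] := leP 0 (c + b).
      by apply: le_trans (f_le _ _) _; rewrite -mulrA ler_wpM2l.
    have x0 : N x = 0.
      by apply/eqP; rewrite eq_le l2norm_ge0 andbT; rewrite nmulr_rge0 in cb.
    rewrite (l2norm_eq0 x0) l2norm0 mulr0.
    have -> : G 0 = 0 by apply: Binj; rewrite BG linear0.
    by rewrite f0 Normc.normc0.
  have n_sum (I : Type) (r : seq I) (F : I -> R[i]) :
      Normc.normc (\sum_(i <- r) F i) <= \sum_(i <- r) Normc.normc (F i).
    elim/big_rec2: _ => [|i u v _ h]; first by rewrite Normc.normc0.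
    by apply: le_trans (le_normcD _ _) _; rewrite lerD2l.
  apply: le_trans (n_sum _ _ _) _; rewrite /K mulr_suml.
  rewrite [leRHS](bigD1 k)//= ler_wpDr//.
    apply: sumr_ge0 => i _; rewrite mulr_suml; apply: sumr_ge0 => j _.
    exact: le_trans (normc_ge0 _) (t _ _).
  by rewrite mulr_suml; apply: ler_sum => j _; exact: t.
- exists M, g => x /= Tx0; exists (fun i => - f i x).
  have : B (x + \sum_i f i x *: g i) = B 0 by rewrite -TG Tx0 linear0.
  move=> /Binj/eqP; rewrite addr_eq0 => /eqP {1}->; rewrite -sumrN.
  by apply: eq_bigr => i _; rewrite scaleNr.
- exists M, e => y; exists (G y), (fun i => - f i (G y)).
  rewrite TE BG opprD addrA subrr sub0r -sumrN.
  by apply: eq_bigr => i _; rewrite scaleNr.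
Qed.

(** A singular Weyl sequence without sequences: unit vectors with small residual and almost no mass
    on the first M coordinates for arbitrary M, which encodes weak convergence to 0. *)
Definition weyl_point (T : ell2 R -> ell2 R) (z : R[i]) :=
  forall (e : R) M, 0 < e ->
  exists x, [/\ N x = 1, N (T x - z *: x) <= e & N (trunc M x) <= e].

(* A gliding hump: y = sum of +- 3^-k x_k cannot be of the form S w plus a
   combination of the v_i, since <x_k, S w> and <x_k, v_i> are O(4^-k). *)
Lemma weyl_point_not_fredholm (T : {linear ell2 R -> ell2 R}) (z : R[i]) :
  self_adjoint (fun x => T x - z *: x) -> weyl_point T z ->
  ~ fredholm (fun x => T x - z *: x).
Proof.
set S := (fun x => T x - z *: x) => Sadj W [_ _ [n [v hv]]].
have small (e : R) : 0 < e -> exists x, [/\ N x = 1, N (S x) <= e &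
    forall i, Normc.normc (inner x (v i)) <= e].
  move=> e0; pose K := \sum_i N (v i).
  have K0 : 0 <= K by apply: sumr_ge0 => i _; exact: l2norm_ge0.
  have K1 : 0 < K + 1 by rewrite ltr_wpDl.
  have e2 : 0 < e / 2 by rewrite divr_gt0.
  have /choice[m hm] : forall i, exists M, N (v i - trunc M (v i)) <= e / 2.
    by move=> i; exact: trunc_tail.
  pose M := \max_i m i.
  (* The tails of all v_i beyond M cost e / 2. The heads cost the mass of x on the first M
     coordinates times the norm of v_i, which is at most K; hence the second entry of the
     minimum. *)
  have d0 : 0 < Num.min e (e / 2 / (K + 1)) by rewrite lt_min e0 divr_gt0.
  have [x [x1 Sx tx]] := W _ M d0; exists x; split=> //.
    by apply: le_trans Sx _; rewrite ge_min lexx.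
  move=> i; rewrite -{1}[v i](subrK (trunc M (v i))) innerDr.
  apply: le_trans (le_normcD _ _) _; rewrite [leRHS]splitr; apply: lerD.
    apply: le_trans (inner_CS _ _) _; rewrite x1 mul1r.
    apply: le_trans (hm i); apply: trunc_tail_homo; exact: leq_bigmax.
  have -> : inner x (trunc M (v i)) = inner (trunc M x) (v i).
    rewrite -inner_conj {1}/trunc {1}/trunc !inner_suml rmorph_sum.
    apply: eq_bigr => k _; rewrite /= !innerZl rmorphM /= inner_conj inner_basis.
    by rewrite -(inner_conj (v i)) inner_basis mulrC.
  apply: le_trans (inner_CS _ _) _.
  have vK : N (v i) <= K.
    by rewrite /K (bigD1 i)//= lerDl; apply: sumr_ge0 => j _; exact: l2norm_ge0.
  have : N (trunc M x) <= e / 2 / (K + 1) by apply: le_trans tx _; rewrite ge_min lexx orbT.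
  rewrite ler_pdivlMr//; have := l2norm_ge0 (trunc M x); have := l2norm_ge0 (v i); nra.
have /choice[x_ hx] : forall k, exists x, [/\ N x = 1, N (S x) <= (4^-1) ^+ k &
    forall i, Normc.normc (inner x (v i)) <= (4^-1) ^+ k].
  by move=> k; apply: small; rewrite exprn_gt0.
have /choice[s hs] : forall p : ell2 R * nat, exists s : R[i],
    Normc.normc s = 3^-1 ^+ p.2 /\
    3^-1 ^+ p.2 <= Normc.normc (inner (x_ p.2) (p.1 + s *: x_ p.2)).
  move=> [y k]; apply: unit_shift_inner_ge; first by rewrite exprn_ge0.
  by have [] := hx k.
pose y_ := fix F k := if k is k'.+1 then F k' + s (F k', k') *: x_ k' else 0.
have [|k|y hy] := @geometric_complete _ y_ 1 3^-1; first by lra.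
  rewrite /= addrAC subrr add0r l2normZ mul1r (hs (y_ k, k)).1.
  by have [-> _ _] := hx k; rewrite mulr1.
(* The later humps sum to at most 3^-(k+1) / (1 - 1/3) = 3^-k / 2, half of what the k-th hump
   secured. This fixes the ratio 1/3. *)
have low k : 3^-1 ^+ k / 2 <= Normc.normc (inner (x_ k) y).
  have h1 := (hs (y_ k, k)).2; rewrite /= -/(y_ k.+1) in h1.
  have h2 : Normc.normc (inner (x_ k) (y_ k.+1 - y)) <= 3^-1 ^+ k / 2.
    apply: le_trans (inner_CS _ _) _; have [-> _ _] := hx k; rewrite mul1r.
    apply: le_trans (hy k.+1) _; rewrite exprS mul1r.
    have p3 : 0 <= 3^-1 ^+ k :> R by rewrite exprn_ge0.
    have -> : 3^-1 * 3^-1 ^+ k / (1 - 3^-1) = 3^-1 ^+ k / 2 :> R by field.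
    exact: lexx.
  have h3 : Normc.normc (inner (x_ k) (y_ k.+1)) <=
      Normc.normc (inner (x_ k) (y_ k.+1 - y)) + Normc.normc (inner (x_ k) y).
    by apply: le_trans (le_normcD _ _); rewrite -innerDr subrK.
  move: h1 h2 h3; set p := Normc.normc _; set q := Normc.normc _; set r := Normc.normc _; lra.
have [w [a ha]] := hv y.
pose K := N w + \sum_i Normc.normc (a i).
have K0 : 0 <= K by rewrite addr_ge0 ?l2norm_ge0// sumr_ge0// => i _; exact: normc_ge0.
have up k : Normc.normc (inner (x_ k) y) <= K * 4^-1 ^+ k.
  have [x1 Sx vx] := hx k.
  have -> : y = S w + \sum_i a i *: v i by rewrite -ha addrC subrK.
  rewrite innerDr; apply: le_trans (le_normcD _ _) _; rewrite mulrDl; apply: lerD.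
    rewrite -Sadj; apply: le_trans (inner_CS _ _) _.
    by rewrite mulrC ler_wpM2l ?l2norm_ge0.
  rewrite -inner_conj normcJ inner_suml mulr_suml.
  elim/big_rec2: _ => [|i p q _ h]; first by rewrite Normc.normc0.
  apply: le_trans (le_normcD _ _) _; apply: lerD => //.
  by rewrite innerZl Normc.normcM ler_wpM2l ?normc_ge0// -inner_conj normcJ.
have K1 : 0 < 2 * (K + 1) by rewrite mulr_gt0// ltr_wpDl.
have [||k hk] := @geometric_small (3 / 4) ((2 * (K + 1))^-1); first by lra.
  by rewrite invr_gt0.
have := le_trans (low k) (up k); rewrite leNgt => /negP; apply.
have p3 : 0 < 3^-1 ^+ k :> R by rewrite exprn_gt0.
have -> : 4^-1 ^+ k = (3 / 4) ^+ k * 3^-1 ^+ k :> R.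
  by rewrite -exprMn; congr (_ ^+ k); field.
move: hk; rewrite -[ltRHS]mul1r ltr_pdivlMr// => hk.
have : (3 / 4) ^+ k * (2 * (K + 1)) * 3^-1 ^+ k < 1 * 3^-1 ^+ k by rewrite ltr_pM2r.
have : 0 <= (3 / 4) ^+ k * 3^-1 ^+ k :> R by rewrite mulr_ge0 ?exprn_ge0.
nra.
Qed.
End fredholm_theory.

(** * Stability of the essential spectrum under compact perturbations *)

Section essential_spectrum.
Variable R : realType.
Implicit Types (x y : ell2 R) (A B : nat -> nat -> R).
Local Notation N x := (l2norm (ell2_seq x)).
Local Notation Re := (@complex.Re R).
Local Notation Im := (@complex.Im R).

Lemma linear_exists (f : ell2 R -> ell2 R) : linear f ->
  exists T : {linear ell2 R -> ell2 R}, f = T.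
Proof.
move=> lf.
by exists (HB.pack_for {linear ell2 R -> ell2 R} f (GRing.isLinear.Build _ _ _ _ f lf)).
Qed.

Lemma represents_comb A B a b (c : R) (S T : {linear ell2 R -> ell2 R}) :
  represents A a S -> represents B b T ->
  represents (fun m n => A m n - c * B m n) (a + `|c| * b) (fun x => S x - c%:C *: T x).
Proof.
move=> [a0 Sa SA] [b0 Tb TB]; split.
- by rewrite addr_ge0 ?mulr_ge0.
- move=> x; apply: le_trans (l2normD _ _) _; rewrite l2normN l2normZ mulrDl.
  apply: lerD => //; rewrite -mulrA.
  have -> : Normc.normc c%:C = `|c| by rewrite /= expr0n addr0 sqrtr_sqr.
  by rewrite ler_wpM2l.
- by move=> m n; rewrite ell2_sub ell2_scale SA TB rmorphB rmorphM.
Qed.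

(** An approximate eigenvector for a nearby w serves for z. It supplies the end point 0, a limit of
    positive values of the symbol. *)
Lemma weyl_point_closed (T : ell2 R -> ell2 R) (z : R[i]) :
  (forall e : R, 0 < e -> exists2 w, Normc.normc (z - w) <= e & weyl_point T w) ->
  weyl_point T z.
Proof.
move=> h e M e0; have e2 : 0 < e / 2 by rewrite divr_gt0.
have [w zw W] := h _ e2; have [x [x1 Tx tx]] := W _ M e2.
exists x; split=> //; last by lra.
have -> : T x - z *: x = (T x - w *: x) - (z - w) *: x.
  by rewrite scalerBl opprB addrA subrK.
apply: le_trans (l2normD _ _) _; rewrite l2normN l2normZ x1 mulr1; lra.
Qed.

Section perturbation.
Variables (A B : nat -> nat -> R) (c a b : R) (H L : {linear ell2 R -> ell2 R}).
Hypotheses (HA : represents A a H) (LB : represents B b L) (c_ge0 : 0 <= c).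
Hypotheses (symA : forall m n, A m n = A n m) (symB : forall m n, B m n = B n m).
Hypothesis small : section_small (fun m n => A m n - c * B m n).

Let symAB m n : A m n - c * B m n = A n m - c * B n m.
Proof. by rewrite symA symB. Qed.

(** H - c L almost annihilates vectors with little mass on the first coordinates, and the residual
    of L is merely scaled by c. *)
Lemma weyl_point_perturbation m : weyl_point L m -> weyl_point H (c%:C * m).
Proof.
move=> W e M e0.
have [K hK] : exists K : {linear ell2 R -> ell2 R}, (fun x => H x - c%:C *: L x) = K.
  apply: linear_exists => s x y; apply: ell2_ext => n.
  rewrite !linearP !(ell2_add, ell2_opp, ell2_scale); ring.
have rK := represents_comb c HA LB; rewrite hK in rK.
have e4 : 0 < e / 4 by rewrite divr_gt0.
have [M1 hM1] := section_small_le rK symAB small e4.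
set k := a + _ in rK hM1; have k0 : 0 <= k := represents_ge0 rK.
have kc : 0 < k + c + 1 by rewrite ltr_wpDl// addr_ge0.
(* The divisor makes c times the residual of L and k times the head of x cost at most e / 4
   together. *)
have d0 : 0 < Num.min e (e / 4 / (k + c + 1)) by rewrite lt_min e0 divr_gt0.
have [x [x1 Lx tx]] := W _ (maxn M M1) d0.
have tle M' : (M' <= maxn M M1)%N -> N (trunc M' x) <= N (trunc (maxn M M1) x).
  move=> hM'; rewrite -(@ler_sqr _ (N (trunc _ x)) (N (trunc _ x))) ?nnegrE ?l2norm_ge0//.
  by rewrite !l2norm_trunc_sq sqpart_homo.
exists x; split=> //; last first.
  apply: le_trans (tle _ (leq_maxl _ _)) _; apply: le_trans tx _.
  by rewrite ge_min lexx.
have -> : H x - (c%:C * m) *: x = c%:C *: (L x - m *: x) + K x.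
  by rewrite -hK; apply: ell2_ext => n; rewrite !(ell2_add, ell2_opp, ell2_scale); ring.
apply: le_trans (l2normD _ _) _; rewrite l2normZ normc_real//.
have {tx}tx : N (trunc M1 x) <= e / 4 / (k + c + 1).
  apply: le_trans (tle _ (leq_maxr _ _)) _; apply: le_trans tx _.
  by rewrite ge_min lexx orbT.
have {Lx}Lx : N (L x - m *: x) <= e / 4 / (k + c + 1).
  by apply: le_trans Lx _; rewrite ge_min lexx orbT.
have := hM1 x; rewrite x1 mulr1 => Kx.
have h2 := ler_wpM2l c_ge0 Lx; have h3 := ler_wpM2l k0 tx.
have h4 : (k + c) * (e / 4 / (k + c + 1)) <= e / 4.
  rewrite mulrCA ler_piMr ?(ltW e4)// ler_pdivrMr// mul1r; lra.
move: h4; rewrite mulrDl; lra.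
Qed.

Hypothesis L_pos : positive_op L.

(** The numerical range of c L lies in the segment, so a rotation [th] separates it from z with a
    margin d. Retaining from H - c L only the part E off a large corner, of norm at most d / 2,
    leaves a coercive operator F that differs from H - z in the first M output coordinates only. *)
Lemma fredholm_off_segment (z : R[i]) : ~ (0 <= z <= (c * b)%:C) ->
  fredholm (fun x => H x - z *: x).
Proof.
move=> zout.
have b0 := represents_ge0 LB.
(* Here s and n stand for the form of L at x and for the squared norm of x. The rotation is i times
   the sign of Im z off the real axis, 1 to the left of 0 and -1 to the right of c b. *)
have [th [d [th1 d0 hth]]] : exists (th : R[i]) (d : R), [/\ Normc.normc th = 1, 0 < d &
    forall s n : R, 0 <= s -> s <= b * n -> d * n <= Re (th * ((c * s)%:C - z * n%:C))].
  case: z zout => p q zout; have [q0|q0] := eqVneq q 0; last first.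
    exists (0 +i* Num.sg q), `|q|; split => //=.
    - by rewrite expr0n add0r sqrtr_sqr normr_sg q0.
    - by rewrite normr_gt0.
    - by move=> s n _ _ /=; rewrite normrEsg le_eqVlt; apply/orP; left; apply/eqP; ring.
  move: zout; rewrite q0 => zout.
  have [p0|p0] := ltP p 0.
    exists 1, (- p); split=> //; rewrite ?Normc.normc1 ?oppr_gt0//.
    move=> s n s0 _ /=; rewrite !(mul1r, mul0r, mulr0, subr0).
    by have := mulr_ge0 c_ge0 s0; lra.
  have pb : c * b < p.
    rewrite ltNge; apply/negP => h; apply: zout.
    by rewrite !lecE /= eqxx p0 h.
  exists (-1), (p - c * b); split; rewrite ?normcN ?Normc.normc1 ?subr_gt0//.
  move=> s n s0 sb /=.
  have := ler_wpM2l c_ge0 sb; rewrite !(mulN1r, mul0r, mulr0, subr0, oppr0); lra.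
have [K hK] : exists K : {linear ell2 R -> ell2 R}, (fun x => H x - c%:C *: L x) = K.
  apply: linear_exists => s x y; apply: ell2_ext => n.
  rewrite !linearP !(ell2_add, ell2_opp, ell2_scale); ring.
have rK := represents_comb c HA LB; rewrite hK in rK.
have d2 : 0 < d / 2 by rewrite divr_gt0.
have [M hM] := small d2.
have [E [rE KE _]] := off_section_operator rK symAB (ltW d2) hM.
have [F hF] : exists F : {linear ell2 R -> ell2 R},
    (fun x => (c%:C *: L x + E x) - z *: x) = F.
  apply: linear_exists => s x y; apply: ell2_ext => n.
  rewrite !linearP !(ell2_add, ell2_opp, ell2_scale); ring.
have [G hG] : exists G : {linear ell2 R -> ell2 R}, (fun x => H x - z *: x) = G.
  apply: linear_exists => s x y; apply: ell2_ext => n.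
  rewrite !linearP !(ell2_add, ell2_opp, ell2_scale); ring.
have Fle x : N (F x) <= (c * b + d / 2 + Normc.normc z) * N x.
  rewrite -hF; apply: le_trans (l2normD _ _) _; rewrite l2normN l2normZ mulrDl lerD2r.
  apply: le_trans (l2normD _ _) _; rewrite l2normZ normc_real// mulrDl.
  apply: lerD; last exact: represents_le rE x.
  by rewrite -[leRHS]mulrA ler_wpM2l// (represents_le LB).
have Fge x : d / 2 * N x ^+ 2 <= Re (th * inner (F x) x).
  have /andP[/eqP i0 r0] : (Im (inner (L x) x) == 0) && (0 <= Re (inner (L x) x)).
    by have := L_pos x; rewrite lecE.
  have Lb : Re (inner (L x) x) <= b * N x ^+ 2.
    apply: le_trans (ler_norm _) _; apply: le_trans (normc_Re _) _.
    apply: le_trans (inner_CS _ _) _.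
    by rewrite expr2 mulrA ler_wpM2r ?l2norm_ge0// (represents_le LB).
  have := hth _ _ r0 Lb.
  have -> : inner (F x) x = ((c * Re (inner (L x) x))%:C - z * (N x ^+ 2)%:C) + inner (E x) x.
    rewrite -hF innerBl innerDl !innerZl inner_self.
    have -> : (c * Re (inner (L x) x))%:C = c%:C * (Re (inner (L x) x))%:C by rewrite -rmorphM.
    have -> : (Re (inner (L x) x))%:C = inner (L x) x by apply: complex_ext; rewrite /= ?i0.
    ring.
  move=> h1; rewrite mulrDr ReD.
  have : `|Re (th * inner (E x) x)| <= d / 2 * N x ^+ 2.
    apply: le_trans (normc_Re _) _; rewrite Normc.normcM th1 mul1r.
    apply: le_trans (inner_CS _ _) _.
    by rewrite expr2 mulrA ler_wpM2r ?l2norm_ge0// (represents_le rE).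
  rewrite ler_norml => /andP[h2 _]; lra.
have c0 : 0 <= c * b + d / 2 + Normc.normc z.
  exact: addr_ge0 (addr_ge0 (mulr_ge0 c_ge0 b0) (ltW d2)) (normc_ge0 _).
rewrite hG; apply: (@fredholm_finite_rank _ F G _ (a + Normc.normc z) (d / 2) M d2 _ _ Fle).
- exact: coercive_le th1 Fge.
- exact: coercive_surjective c0 Fle d2 th1 Fge.
- move=> x; rewrite -hG; apply: le_trans (l2normD _ _) _.
  by rewrite l2normN l2normZ mulrDl lerD2r (represents_le HA).
- move=> x m Mm; rewrite -hG -hF.
  have -> : H x = c%:C *: L x + K x by rewrite -hK addrC subrK.
  by rewrite !(ell2_add, ell2_opp) KE.
Qed.

Lemma ess_spectrum_perturbation :
  (forall t : R, 0 <= t <= b -> weyl_point L t%:C) ->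
  ess_spectrum H = [set z | 0 <= z <= (c * b)%:C].
Proof.
move=> W; rewrite eqEsubset; split => z /=.
  move=> h; apply: contrapT => /fredholm_off_segment; exact: h.
move=> hz.
have [t [t0 tb zt]] : exists t : R, [/\ 0 <= t, t <= b & z = c%:C * t%:C].
  move: hz; case: z => p q; rewrite !lecE /= => /andP[/andP[/eqP -> p0] /andP[_ pb]].
  have [c0|c0] := eqVneq c 0.
    exists 0; split=> //; first exact: represents_ge0 LB.
    rewrite c0 mul0r in pb; apply: complex_ext; rewrite /= ?mulr0 ?mul0r ?subr0 ?addr0//.
    by apply/eqP; rewrite eq_le p0 pb.
  have cp : 0 < c by rewrite lt_def c0.
  exists (p / c); split; first by rewrite divr_ge0.
    by rewrite ler_pdivrMr// mulrC.
  by apply: complex_ext; rewrite /= ?mulr0 ?mul0r ?subr0 ?addr0// mulrCA divff ?mulr1.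
have Hadj := represents_selfadjoint HA symA.
apply: weyl_point_not_fredholm; last first.
  by rewrite zt; apply: weyl_point_perturbation; apply: W; rewrite t0.
move=> x y; rewrite innerBl innerBr innerZl innerZr Hadj; congr (_ - _ * _).
by rewrite zt -rmorphM conjc_realE.
Qed.
End perturbation.
End essential_spectrum.

(** * The Schur test for the kernel of H_lambda *)

Section schur_test.
Variable R : realType.

Lemma finite_cauchy_schwarz n (u v : nat -> R) :
  (\sum_(i < n) u i * v i) ^+ 2 <= (\sum_(i < n) u i ^+ 2) * (\sum_(i < n) v i ^+ 2).
Proof.
set P := \sum_(i < n) u i ^+ 2; set Q := \sum_(i < n) v i ^+ 2.
set S := \sum_(i < n) u i * v i.
have Q0 : 0 <= Q by apply: sumr_ge0 => i _; exact: sqr_ge0.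
have [Qz|Qn] := eqVneq Q 0.
  suff -> : S = 0 by rewrite expr0n Qz mulr0.
  apply: big1 => i _.
  have : v i ^+ 2 = 0.
    by move/eqP: Qz; rewrite psumr_eq0 => [/allP/(_ i (mem_index_enum _))/eqP//|j _]; exact: sqr_ge0.
  by move=> /eqP; rewrite sqrf_eq0 => /eqP ->; rewrite mulr0.
have Qp : 0 < Q by rewrite lt_def Qn.
have : 0 <= \sum_(i < n) (Q * u i - S * v i) ^+ 2 by apply: sumr_ge0 => i _; exact: sqr_ge0.
have -> : \sum_(i < n) (Q * u i - S * v i) ^+ 2 = Q * (P * Q - S ^+ 2).
  transitivity (\sum_(i < n) (Q ^+ 2 * u i ^+ 2 - 2 * Q * S * (u i * v i) + S ^+ 2 * v i ^+ 2)).
    by apply: eq_bigr => i _; ring.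
  by rewrite big_split/= sumrB -!mulr_sumr -/P -/Q -/S; ring.
by rewrite pmulr_rge0// subr_ge0.
Qed.

(** Cauchy-Schwarz after the splitting K |a| = sqrt (K p) sqrt (K / p) |a|. Symmetry of K lets the
    single row condition serve for the columns as well. *)
Lemma schur_test (A K : nat -> nat -> R) (p : nat -> R) (c : R) :
  (forall m n, `|A m n| <= K m n) -> (forall m n, K m n = K n m) ->
  (forall n, 0 < p n) -> (forall m k, \sum_(n < k) K m n * p n <= c * p m) ->
  mx_bound A c.
Proof.
move=> AK symK p0 Kp n a.
have K0 m k : 0 <= K m k by apply: le_trans (AK m k).
have c0 : 0 <= c.
  (* The empty sum already gives 0 <= c p_0. *)
  have := Kp 0%N 0%N; rewrite big_ord0 => h; rewrite -(pmulr_lge0 _ (p0 0%N)) //.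
have row (m : 'I_n) : (\sum_(k < n) A m k * a k) ^+ 2 <=
    c * p m * \sum_(k < n) K m k * (a k ^+ 2 / p k).
  apply: le_trans (_ : (\sum_(k < n) K m k * `|a k|) ^+ 2 <= _).
    rewrite -[leLHS]real_normK ?num_real// lerXn2r ?nnegrE//.
      by apply: sumr_ge0 => k _; rewrite mulr_ge0.
    apply: le_trans (ler_norm_sum _ _ _) _; apply: ler_sum => k _.
    by rewrite normrM ler_wpM2r.
  have -> : \sum_(k < n) K m k * `|a k| =
      \sum_(k < n) Num.sqrt (K m k * p k) * (Num.sqrt (K m k / p k) * `|a k|).
    apply: eq_bigr => k _; rewrite mulrA -sqrtrM ?mulr_ge0 ?(ltW (p0 _))//.
    rewrite mulrACA divff ?gt_eqF// mulr1 -expr2 sqrtr_sqr (ger0_norm (K0 _ _))//.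
  apply: le_trans (finite_cauchy_schwarz _ (fun k => Num.sqrt (K m k * p k))
    (fun k => Num.sqrt (K m k / p k) * `|a k|)) _.
  apply: ler_pM.
  - by apply: sumr_ge0 => k _; exact: sqr_ge0.
  - by apply: sumr_ge0 => k _; exact: sqr_ge0.
  - apply: le_trans (Kp m n); apply: ler_sum => k _.
    by rewrite sqr_sqrtr// mulr_ge0 ?(ltW (p0 _)).
  - apply: ler_sum => k _.
    rewrite exprMn sqr_sqrtr ?divr_ge0 ?(ltW (p0 _))// real_normK ?num_real//.
    by rewrite le_eqVlt; apply/orP; left; apply/eqP; rewrite mulrAC mulrA.
apply: le_trans (_ : \sum_(m < n) c * p m * \sum_(k < n) K m k * (a k ^+ 2 / p k) <= _).
  by apply: ler_sum => m _; exact: row.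
under eq_bigr do rewrite mulr_sumr.
rewrite exchange_big mulr_sumr; apply: ler_sum => k _ /=.
apply: le_trans (_ : c * (a k ^+ 2 / p k) * (c * p k) <= _); last first.
  rewrite le_eqVlt; apply/orP; left; apply/eqP.
  have := p0 k; move: (p k) => q q0; field; by rewrite gt_eqF.
apply: le_trans (ler_wpM2l _ (Kp k n)); last first.
  by rewrite mulr_ge0// divr_ge0 ?sqr_ge0 ?(ltW (p0 _)).
rewrite mulr_sumr; apply: ler_sum => m _; rewrite symK.
by rewrite le_eqVlt; apply/orP; left; apply/eqP; ring.
Qed.
End schur_test.

(** * Comparison of logarithmic sums with integrals *)

Section log_sums.
Variable R : realType.

Definition ln_index n : R := ln n.+2%:R.
Local Notation L := ln_index.

Lemma ln_index_gt0 n : 0 < L n.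
Proof. by apply: ln_gt0; rewrite ltr1n. Qed.

Lemma ln_index_homo n m : (n <= m)%N -> L n <= L m.
Proof. by move=> nm; rewrite ler_ln ?posrE ?ltr0n// ler_nat. Qed.

Lemma lnS_ge n : n.+2%:R^-1 <= ln n.+2%:R - ln n.+1%:R :> R.
Proof.
rewrite -ln_div ?posrE ?ltr0n// -[leRHS]opprK -lnV ?posrE ?divr_gt0 ?ltr0n//.
rewrite lerNr invf_div.
have -> : n.+1%:R / n.+2%:R = 1 + - n.+2%:R^-1 :> R.
  have h : n.+2%:R != 0 :> R by rewrite pnatr_eq0.
  by apply: (mulIf h); rewrite divfK// mulrBl mulVf// mul1r -[X in X - 1]natr1 addrK.
by apply: le_ln1Dx; rewrite ltrN2 invf_lt1 ?ltr1n// ltr0n.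
Qed.

Lemma ln_index_step_le n : L n.+1 - L n <= n.+2%:R^-1.
Proof.
rewrite /L -ln_div ?posrE ?ltr0n//.
have -> : n.+3%:R / n.+2%:R = 1 + n.+2%:R^-1 :> R.
  have h : n.+2%:R != 0 :> R by rewrite pnatr_eq0.
  by apply: (mulIf h); rewrite divfK// mulrDl mulVf// mul1r natr1.
by apply: le_ln1Dx; apply: lt_trans (_ : 0 < _); rewrite ?ltrN10 ?invr_gt0 ?ltr0n.
Qed.

Lemma ln_index_step_ge n : n.+3%:R^-1 <= L n.+1 - L n.
Proof. exact: lnS_ge. Qed.

Lemma atan_step (x y : R) : x <= y -> 0 <= x -> (y - x) / (1 + y ^+ 2) <= atan y - atan x.
Proof.
move=> xy x0.
have [|c] := @MVT_segment R atan (fun x => (1 + x ^+ 2)^-1) x y xy.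
  by apply: continuous_subspaceT => z; exact: continuous_atan.
rewrite in_itv /= => /andP[xc cy] ->; rewrite mulrC ler_wpM2r ?subr_ge0//.
have c2 : 0 <= c ^+ 2 by exact: sqr_ge0.
have y2 : 0 <= y ^+ 2 by exact: sqr_ge0.
rewrite lef_pV2 ?posrE ?ltr_wpDr// lerD2l lerXn2r ?nnegrE//.
- exact: le_trans xc.
- exact: le_trans xy.
Qed.

(* The summand is at most the increment of (2 / sqrt a) atan (sqrt (ln t / a)). *)
Lemma sum_hilbert_le (a : R) k : 0 < a ->
  \sum_(n < k) (n.+2%:R * Num.sqrt (L n) * (a + L n))^-1 <= pi / Num.sqrt a.
Proof.
(* Taken at n + 1, [G] compares the term of index n + 2 with its increment over (n + 1, n + 2).
   Since ln 1 = 0, G starts at 0, and atan < pi / 2 yields exactly pi / sqrt a. *)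
move=> a0; pose G n : R := 2 / Num.sqrt a * atan (Num.sqrt (ln n.+1%:R / a)).
have sa0 : 0 < Num.sqrt a by rewrite sqrtr_gt0.
have sa2 : Num.sqrt a ^+ 2 = a by rewrite sqr_sqrtr ?ltW.
apply: le_trans (_ : G k - G 0%N <= _).
  elim: k => [|k ih]; first by rewrite big_ord0 subrr.
  rewrite big_ord_recr/=.
  suff : (k.+2%:R * Num.sqrt (L k) * (a + L k))^-1 <= G k.+1 - G k.
    by move=> h; apply: le_trans (lerD ih h) _; rewrite [leLHS]addrC subrKA.
  rewrite /G -mulrBr.
  set X := Num.sqrt (ln k.+1%:R / a); set Y := Num.sqrt (ln k.+2%:R / a).
  have lk : 0 <= ln k.+1%:R :> R by rewrite ln_ge0// ler1n.
  have lk2 := ln_index_gt0 k.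
  have X2 : X ^+ 2 * a = ln k.+1%:R by rewrite sqr_sqrtr ?divr_ge0 ?(ltW a0)// divfK// gt_eqF.
  have Y2 : Y ^+ 2 * a = L k by rewrite sqr_sqrtr ?divr_ge0 ?(ltW a0) ?(ltW lk2)// divfK// gt_eqF.
  have X0 : 0 <= X by exact: sqrtr_ge0.
  have Y0 : 0 < Y by rewrite sqrtr_gt0 divr_gt0.
  have XY : X <= Y.
    by rewrite ler_sqrt ?divr_ge0 ?(ltW a0) ?(ltW lk2)// ler_pM2r ?invr_gt0// ler_ln ?posrE ?ltr0n// ler_nat.
  have sL : Num.sqrt (L k) = Num.sqrt a * Y by rewrite -sqrtrM ?(ltW a0)// mulrCA divff ?mulr1// gt_eqF.
  have Y1 : 0 < 1 + Y ^+ 2 by rewrite ltr_wpDr ?sqr_ge0.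
  have := atan_step XY X0; rewrite ler_pdivrMr//; set D := _ - atan X => hD.
  have := lnS_ge k; rewrite -/(L k) sL -X2 -Y2; set w := _^-1 => hw.
  rewrite (_ : a + Y ^+ 2 * a = a * (1 + Y ^+ 2)); last by ring.
  have -> : (k.+2%:R * (Num.sqrt a * Y) * (a * (1 + Y ^+ 2)))^-1 =
      w / (Num.sqrt a * Y * (a * (1 + Y ^+ 2))) by rewrite -!mulrA invfM.
  rewrite ler_pdivrMr ?mulr_gt0//.
  have -> : 2 / Num.sqrt a * D * (Num.sqrt a * Y * (a * (1 + Y ^+ 2))) =
      a * (2 * Y * (D * (1 + Y ^+ 2))) by field; rewrite gt_eqF.
  apply: le_trans hw _; rewrite -mulrBl mulrC ler_wpM2l ?(ltW a0)//.
  (* Y^2 - X^2 = (Y + X) (Y - X) with X <= Y. *)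
  apply: le_trans (_ : 2 * Y * (Y - X) <= _).
    by nra.
  by rewrite ler_wpM2l// mulr_ge0 ?(ltW Y0).
rewrite /G ln1 mul0r sqrtr0 atan0 mulr0 subr0.
rewrite mulrAC ler_wpM2r ?invr_ge0 ?(ltW sa0)//.
have := @atan_ltpi2 R (Num.sqrt (ln k.+1%:R / a)); lra.
Qed.

Definition hilbert_kernel m n : R := ((L m + L n) * Num.sqrt (m.+2 * n.+2)%:R)^-1.

Lemma hilbert_kernel_bound (A : nat -> nat -> R) (S : R) : 0 <= S ->
  (forall m n, `|A m n| <= S * hilbert_kernel m n) -> mx_bound A (pi * S).
Proof.
move=> S0 hA; pose p n : R := (Num.sqrt (n.+2%:R * L n))^-1.
apply: (@schur_test _ _ (fun m n => S * hilbert_kernel m n) p) => //.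
- by move=> m n; rewrite /hilbert_kernel addrC mulnC.
- by move=> n; rewrite invr_gt0 sqrtr_gt0 mulr_gt0 ?ln_index_gt0.
move=> m k.
have m0 : 0 < Num.sqrt m.+2%:R :> R by rewrite sqrtr_gt0 ltr0n.
have -> : \sum_(n < k) S * hilbert_kernel m n * p n = S / Num.sqrt m.+2%:R *
    \sum_(n < k) (n.+2%:R * Num.sqrt (L n) * (L m + L n))^-1.
  rewrite mulr_sumr; apply: eq_bigr => n _.
  rewrite /hilbert_kernel /p natrM !sqrtrM ?ler0n//.
  have h1 : 0 < Num.sqrt n.+2%:R :> R by rewrite sqrtr_gt0 ltr0n.
  have h2 : 0 < Num.sqrt (L n) by rewrite sqrtr_gt0 ln_index_gt0.
  have h3 : 0 < L m + L n by rewrite addr_gt0 ?ln_index_gt0.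
  have e : n.+2%:R = Num.sqrt n.+2%:R ^+ 2 :> R by rewrite sqr_sqrtr ?ler0n.
  rewrite [X in _ = _ * (X * _ * _)^-1]e; field.
  by rewrite !gt_eqF.
apply: le_trans (ler_wpM2l _ (sum_hilbert_le k (ln_index_gt0 m))) _.
  by rewrite divr_ge0// ltW.
rewrite /p sqrtrM ?ler0n// le_eqVlt; apply/orP; left; apply/eqP.
have h2 : 0 < Num.sqrt (L m) by rewrite sqrtr_gt0 ln_index_gt0.
by field; rewrite !gt_eqF.
Qed.

(** Telescoping: 1 / (n (ln n)^2) is at most 1 / ln (n - 1) - 1 / ln n, because ln n - ln (n - 1) >=
    1 / n. *)
Lemma sum_inv_sq_log_le N k :
  \sum_(N.+1 <= m < k) (m.+2%:R * L m ^+ 2)^-1 <= (L N)^-1.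
Proof.
have [kN|Nk] := leqP k N.+1; first by rewrite big_geq// invr_ge0 ltW// ln_index_gt0.
rewrite -(subnKC Nk); move: (k - N.+2)%N => j.
apply: le_trans (_ : (L N)^-1 - (L (N + j).+1)^-1 <= _); last first.
  by rewrite gerBl invr_ge0 ltW// ln_index_gt0.
have step i : (i.+3%:R * L i.+1 ^+ 2)^-1 <= (L i)^-1 - (L i.+1)^-1.
  have u0 := ln_index_gt0 i; have v0 := ln_index_gt0 i.+1; have uv := ln_index_homo (leqnSn i).
  have := ln_index_step_ge i; set w := _^-1; move: u0 v0 uv.
  set u := L i; set v := L i.+1 => u0 v0 uv wuv.
  have -> : (i.+3%:R * v ^+ 2)^-1 = w / v ^+ 2 by rewrite invfM.
  rewrite ler_pdivrMr ?exprn_gt0//.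
  have -> : (u^-1 - v^-1) * v ^+ 2 = (v - u) * (v / u) by field; rewrite !gt_eqF.
  by apply: le_trans wuv _; rewrite ler_peMr ?subr_ge0// ler_pdivlMr// mul1r.
elim: j => [|j ih]; first by rewrite !addn0 big_nat1.
rewrite addnS big_nat_recr/=; last by rewrite ltnS ltnW// ltnS leq_addr.
by apply: le_trans (lerD ih (step _)) _; rewrite addnS subrKA.
Qed.
End log_sums.

(** * Oscillatory integrals *)

Section real_derivatives.
Variable R : realType.
Implicit Types (f g : R -> R) (x y v a b c : R).

Lemma der_cst (c x : R) : is_derive x 1 (fun _ : R => c) 0.
Proof. exact: is_derive_cst. Qed.
Lemma der_id (x : R) : is_derive x 1 (fun y : R => y) 1.
Proof. exact: is_derive_id. Qed.
Lemma der_add f g (x a b : R) : is_derive x 1 f a -> is_derive x 1 g b ->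
  is_derive x 1 (fun y => f y + g y) (a + b).
Proof. by move=> fa gb; exact: is_deriveD. Qed.
Lemma der_sub f g (x a b : R) : is_derive x 1 f a -> is_derive x 1 g b ->
  is_derive x 1 (fun y => f y - g y) (a - b).
Proof. by move=> fa gb; exact: is_deriveB. Qed.
Lemma der_mul f g (x a b : R) : is_derive x 1 f a -> is_derive x 1 g b ->
  is_derive x 1 (fun y => f y * g y) (a * g x + f x * b).
Proof.
move=> fa gb; have h := is_deriveM fa gb; apply: is_derive_eq.
by rewrite /GRing.scale /=; ring.
Qed.
Lemma der_inv f (x a : R) : f x != 0 -> is_derive x 1 f a ->
  is_derive x 1 (fun y => (f y)^-1) (- a / f x ^+ 2).
Proof.
move=> f0 fa; have h := is_deriveV f0 fa; apply: is_derive_eq.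
by rewrite /GRing.scale /= mulNr mulrC mulNr.
Qed.
Lemma der_comp f g (x a b : R) : is_derive (g x) 1 f a -> is_derive x 1 g b ->
  is_derive x 1 (fun y => f (g y)) (a * b).
Proof. by move=> fa gb; exact: is_derive1_comp. Qed.

Lemma derive_pos_continuous f (df : R -> R) (a b : R) : 0 < a ->
  (forall x : R, 0 < x -> is_derive x 1 f (df x)) -> {within `[a, b], continuous f}.
Proof.
move=> a0 fd; apply: derivable_within_continuous => x.
by rewrite in_itv /= => /andP[ax _]; have [] := fd x (lt_le_trans a0 ax).
Qed.

(** Both g + f and g - f are nondecreasing on [a, b]. The interval stays away from 0 because ln v
    occurs in the functions to which this is applied. *)
Lemma derive_le f g (df dg : R -> R) (a b : R) : 0 < a -> a <= b ->
  (forall x : R, 0 < x -> is_derive x 1 f (df x)) ->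
  (forall x : R, 0 < x -> is_derive x 1 g (dg x)) ->
  (forall x : R, a <= x <= b -> `|df x| <= dg x) ->
  `|f b - f a| <= g b - g a.
Proof.
move=> a0 ab fd gd h.
have pos x : x \in `]a, b[ -> 0 < x by rewrite in_itv /= => /andP[ax _]; exact: lt_trans ax.
rewrite ler_norml; apply/andP; split.
  have hd x : 0 < x -> is_derive x 1 (fun y => g y + f y) (dg x + df x).
    by move=> x0; apply: der_add; [exact: gd|exact: fd].
  have [||c cab] := @MVT_segment _ (fun y => g y + f y) (fun x => dg x + df x) a b ab.
  - by move=> x /pos; exact: hd.
  - exact: derive_pos_continuous hd.
  move: (h c); rewrite in_itv /= in cab; move=> /(_ cab); rewrite ler_norml => /andP[h1 h2] e.
  suff : 0 <= (g b + f b) - (g a + f a) by lra.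
  by rewrite e mulr_ge0 ?subr_ge0//; lra.
have hd x : 0 < x -> is_derive x 1 (fun y => g y - f y) (dg x - df x).
  by move=> x0; apply: der_sub; [exact: gd|exact: fd].
have [||c cab] := @MVT_segment _ (fun y => g y - f y) (fun x => dg x - df x) a b ab.
- by move=> x /pos; exact: hd.
- exact: derive_pos_continuous hd.
move: (h c); rewrite in_itv /= in cab; move=> /(_ cab); rewrite ler_norml => /andP[h1 h2] e.
suff : 0 <= (g b - f b) - (g a - f a) by lra.
by rewrite e mulr_ge0 ?subr_ge0//; lra.
Qed.

Lemma is_derive_cos' (x : R) : is_derive x 1 cos (- sin x).
Proof. exact: is_derive_cos. Qed.
End real_derivatives.

Section oscillatory.
Variable R : realType.
Local Notation mu := (@lebesgue_measure R).
Implicit Types (x y v a b c d xi : R).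

(** With x = v^2 the weighted kernel x^(-1/2) dx / (1 + x) becomes 2 dv / (1 + v^2), bounded at 0.
    Here t is cos or sin and xi is the frequency in ln v. *)
Definition osc (t : R -> R) (xi v : R) : R := 2 * t (xi * ln v) / (1 + v ^+ 2).
Definition oscint (t : R -> R) (xi v : R) : R := (\int[mu]_(x in `[0, v]) osc t xi x)%R.

Lemma oneDsq_gt0 (v : R) : 0 < 1 + v ^+ 2.
Proof. by rewrite ltr_wpDr ?sqr_ge0. Qed.

Section wave.
Variables (t dt : R -> R) (xi : R).
Hypotheses (t_der : forall x : R, is_derive x 1 t (dt x)) (t1 : forall x : R, `|t x| <= 1)
  (dt1 : forall x : R, `|dt x| <= 1).

Lemma osc_le2 v : `|osc t xi v| <= 2.
Proof.
rewrite normrM normfV (gtr0_norm (oneDsq_gt0 v)) ler_pdivrMr ?oneDsq_gt0//.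
rewrite normrM ger0_norm//; have := t1 (xi * ln v); have := sqr_ge0 v; nra.
Qed.

Lemma osc_der v : 0 < v -> is_derive v 1 (osc t xi)
  (2 * (dt (xi * ln v) * (xi / v)) / (1 + v ^+ 2) -
   2 * t (xi * ln v) * (2 * v) / (1 + v ^+ 2) ^+ 2).
Proof.
move=> v0.
have dl : is_derive v 1 (fun y => t (xi * ln y)) (dt (xi * ln v) * (xi / v)).
  apply: der_comp (t_der _) _.
  have := der_mul (der_cst xi v) (is_derive1_ln v0).
  by rewrite mul0r add0r.
have d2 : is_derive v 1 (fun y => 2 * t (xi * ln y)) (2 * (dt (xi * ln v) * (xi / v))).
  by have := der_mul (der_cst 2 v) dl; rewrite mul0r add0r.
have dq : is_derive v 1 (fun y : R => 1 + y ^+ 2) (2 * v).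
  have := der_add (der_cst 1 v) (der_mul (der_id v) (der_id v)).
  by rewrite add0r mul1r mulr1 -mulr2n mulr_natl.
have := der_mul d2 (@der_inv _ (fun y => 1 + y ^+ 2) v _ (lt0r_neq0 (oneDsq_gt0 v)) dq).
rewrite /osc => h; apply: is_derive_eq.
have := oneDsq_gt0 v; move: (1 + v ^+ 2) => q q0; field.
by rewrite !gt_eqF.
Qed.

Lemma osc_der_le v : 0 < v ->
  `|2 * (dt (xi * ln v) * (xi / v)) / (1 + v ^+ 2) -
   2 * t (xi * ln v) * (2 * v) / (1 + v ^+ 2) ^+ 2| <= (2 * `|xi| + 1) / v.
Proof.
move=> v0; have q0 := oneDsq_gt0 v.
apply: le_trans (ler_normB _ _) _; rewrite [leRHS]mulrDl; apply: lerD.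
  rewrite normrM normfV (gtr0_norm q0) ler_pdivrMr// !normrM normfV (gtr0_norm v0).
  rewrite (ger0_norm (ler0n _ 2)).
  have xv : 0 <= `|xi| / v by rewrite divr_ge0 ?(ltW v0).
  rewrite -mulrA; have := dt1 (xi * ln v); have := sqr_ge0 v; move: xv.
  set p := `|xi| / v; set q := `|dt _|; have : 0 <= q by exact: normr_ge0.
  move=> q1 p0 v2 q2; apply: le_trans (_ : 2 * (1 * p) <= _); first by rewrite ler_wpM2l// ler_wpM2r.
  nra.
rewrite normrM normfV (gtr0_norm (exprn_gt0 2 q0)) ler_pdivrMr ?exprn_gt0//.
rewrite !normrM (ger0_norm (ler0n _ 2)) (gtr0_norm v0) mul1r.
rewrite mulrC (mulrC v^-1) ler_pdivlMr//; have := t1 (xi * ln v).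
have : 0 <= `|t (xi * ln v)| by []; move: (`|t _|) => q q1 q2.
have v2 : 0 <= v ^+ 2 by exact: sqr_ge0.
apply: le_trans (_ : 4 * v ^+ 2 <= _); first by rewrite expr2; nra.
by have := sqr_ge0 (1 - v ^+ 2); nra.
Qed.

Lemma osc_measurable : measurable_fun setT (osc t xi).
Proof.
have mt : measurable_fun setT t.
  apply: continuous_measurable_fun => x; apply/differentiable_continuous/derivable1_diffP.
  by have [] := t_der x.
apply: measurable_funM.
  apply: measurable_funM; first exact: measurable_cst.
  apply: measurableT_comp => //.
  by apply: measurable_funM; [exact: measurable_cst|exact: measurable_ln].
apply: continuous_measurable_fun => x; apply: cvgV; first exact: lt0r_neq0 (oneDsq_gt0 x).
by apply: cvgD; [exact: cvg_cst|exact: exprn_continuous].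
Qed.

Lemma mu_itv_fin v : (mu `[0%R, v]%classic < +oo)%E.
Proof. by rewrite lebesgue_measure_itv; case: ifP => _; rewrite ?ltry// -EFinD ltry. Qed.

Lemma osc_integrable v : mu.-integrable `[0, v] (EFin \o osc t xi).
Proof.
apply: measurable_bounded_integrable => //.
- exact: mu_itv_fin.
- exact: measurable_funTS osc_measurable.
exists 2; split=> // x x2 y _; exact: le_trans (osc_le2 _) (ltW x2).
Qed.

Lemma oscint_le v : 0 <= v -> `|oscint t xi v| <= 2 * v.
Proof.
move=> v0; apply: le_trans (le_normr_Rintegral _ (osc_integrable v)) _ => //.
have mv : fine (mu `[0, v]%classic) = v.
  by rewrite lebesgue_measure_itv /= lte_fin; case: ltP => [_|v0'] /=; rewrite ?subr0//; apply/eqP; rewrite eq_le v0 v0'.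
apply: le_trans (_ : (\int[mu]_(x in `[0, v]) 2)%R <= _).
  apply: le_Rintegral => //.
  - have := integrable_norm (osc_integrable v); exact.
  - apply: measurable_bounded_integrable => //; first exact: mu_itv_fin.
    by exists 2; split=> // x x2 y _; rewrite /= ger0_norm// ltW.
  - by move=> x _; exact: osc_le2.
by rewrite Rintegral_cst//; move: mv => /= ->.
Qed.

Lemma oscint_der v : 0 < v -> is_derive v 1 (oscint t xi) (osc t xi v).
Proof.
move=> v0.
have cf : {for v, continuous (osc t xi)}.
  apply/differentiable_continuous/derivable1_diffP; by have [] := osc_der v0.
have v1 : v < v + 1 by rewrite ltrDl.
have [d e] := continuous_FTC1_closed v1 (osc_integrable (v + 1)) v0 cf.
exact: (@DeriveDef _ _ _ v 1 (oscint t xi) _ d (etrans (esym (derive1E _ _)) e)).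
Qed.

(** A left rectangle rule whose weight d may exceed the width b - a: the excess is paid with |osc|
    <= 2, the rule itself with the derivative bound, which is worst at a. *)
Lemma oscint_step a b d : 0 < a -> a <= b -> b - a <= d ->
  `|d * osc t xi a - (oscint t xi b - oscint t xi a)| <=
  2 * (d - (b - a)) + (2 * `|xi| + 1) / a * (b - a) ^+ 2.
Proof.
move=> a0 ab dab.
have [||c cab ->] := @MVT_segment _ (oscint t xi) (osc t xi) a b ab.
- by move=> x; rewrite in_itv /= => /andP[ax _]; apply: oscint_der; exact: lt_trans ax.
- exact: derive_pos_continuous oscint_der.
move: cab; rewrite in_itv /= => /andP[ac cb].
have -> : d * osc t xi a - osc t xi c * (b - a) =
  (d - (b - a)) * osc t xi a - (osc t xi c - osc t xi a) * (b - a) by ring.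
apply: le_trans (ler_normB _ _) _.
rewrite [X in X + _]normrM [X in _ + X]normrM; apply: lerD.
  rewrite ger0_norm ?subr_ge0// mulrC.
  by apply: ler_wpM2r; rewrite ?subr_ge0// osc_le2.
rewrite (ger0_norm (_ : 0 <= b - a)) ?subr_ge0// expr2 mulrA ler_wpM2r ?subr_ge0//.
have k0 : 0 <= 2 * `|xi| + 1 by rewrite addr_ge0// mulr_ge0.
have := @derive_le _ (osc t xi) (fun x => (2 * `|xi| + 1) / a * x) _ (fun=> (2 * `|xi| + 1) / a)
  a c a0 ac osc_der.
move=> h; apply: le_trans (h _ _) _.
- by move=> x x0; have := der_mul (der_cst ((2 * `|xi| + 1) / a) x) (der_id x); rewrite mul0r add0r mulr1.
- move=> x /andP[ax xc]; have x0 := lt_le_trans a0 ax.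
  apply: le_trans (osc_der_le x0) _; rewrite ler_wpM2l// lef_pV2 ?posrE//.
rewrite -mulrBr ler_wpM2l ?divr_ge0 ?(ltW a0)//; lra.
Qed.
End wave.

Lemma cos_le1' (x : R) : `|cos x| <= 1.
Proof. by rewrite ler_norml cos_geN1 cos_le1. Qed.
Lemma sin_le1' (x : R) : `|sin x| <= 1.
Proof. by rewrite ler_norml sin_geN1 sin_le1. Qed.
Lemma Nsin_le1 (x : R) : `|- sin x| <= 1. Proof. by rewrite normrN sin_le1'. Qed.

Definition cosint := oscint cos.
Definition sinint := oscint sin.

Let cosd := (is_derive_cos' (R := R)).
Let sind (x : R) : is_derive x 1 sin (cos x). Proof. exact: is_derive_sin. Qed.

Lemma cosint_der xi v : 0 < v -> is_derive v 1 (cosint xi) (osc cos xi v).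
Proof. move=> v0; have := @oscint_der cos (fun x => - sin x) xi cosd cos_le1'. by apply. Qed.
Lemma sinint_der xi v : 0 < v -> is_derive v 1 (sinint xi) (osc sin xi v).
Proof. move=> v0; have := @oscint_der sin cos xi sind sin_le1'. by apply. Qed.

Lemma osc_inv (t : R -> R) xi v : 0 < v ->
  osc t xi v^-1 * (- v ^- 2) = - (2 * t (- (xi * ln v)) / (1 + v ^+ 2)).
Proof.
move=> v0; rewrite /osc lnV ?posrE// (mulrN xi) exprVn.
have q := oneDsq_gt0 v; by field; rewrite !gt_eqF//=.
Qed.

Lemma inv_der (v : R) : 0 < v -> is_derive v 1 (fun y : R => y^-1) (- v ^- 2).
Proof. by move=> v0; have := der_inv (lt0r_neq0 v0) (der_id v); rewrite mulNr mul1r. Qed.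

Lemma zero_der_constant (f df : R -> R) a b : 0 < a -> 0 < b ->
  (forall x : R, 0 < x -> is_derive x 1 f (df x)) -> (forall x : R, 0 < x -> df x = 0) -> f a = f b.
Proof.
move=> a0 b0 fd f0; wlog ab : a b a0 b0 / a <= b.
  by move=> h; have [|/ltW] := leP a b => ab; [exact: h|apply/esym/h].
have := derive_le a0 ab fd (fun x _ => der_cst 0 x) _.
rewrite subrr normr_le0 subr_eq0 => h; apply/esym/eqP/h => x /andP[ax _].
by rewrite f0 ?normr0// (lt_le_trans a0).
Qed.

(** As sin is odd, v |-> 1 / v preserves the form osc sin dv, so both sides have the same derivative
    and agree at 1. The sine integral over (0, +oo) thus vanishes, and the integral up to a large v
    is as small as that up to 1 / v. *)
Lemma sinint_inv xi v : 0 < v -> sinint xi v^-1 = sinint xi v.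
Proof.
move=> v0; apply/eqP; rewrite -subr_eq0.
have := @zero_der_constant (fun y => sinint xi y^-1 - sinint xi y)
  (fun y => osc sin xi y^-1 * (- y ^- 2) - osc sin xi y) v 1 v0 ltr01.
rewrite invr1 subrr => h; apply/eqP/h => x x0.
  apply: der_sub; last exact: sinint_der.
  by apply: der_comp (inv_der x0); apply: sinint_der; rewrite invr_gt0.
by rewrite osc_inv// sinN mulrN mulNr opprK /osc subrr.
Qed.

(* The integral of [osc cos xi] over (0, +oo): v |-> 1 / v exchanges (0, 1) and
   (1, +oo). *)
Definition symbol xi : R := 2 * cosint xi 1.

Lemma cosint_inv xi v : 0 < v -> cosint xi v^-1 + cosint xi v = symbol xi.
Proof.
move=> v0.
have := @zero_der_constant (fun y => cosint xi y^-1 + cosint xi y)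
  (fun y => osc cos xi y^-1 * (- y ^- 2) + osc cos xi y) v 1 v0 ltr01.
rewrite invr1 -mulr2n -mulr_natl -/(symbol xi) => h; apply: h.
- move=> x x0.
  apply: der_add; last exact: cosint_der.
  by apply: der_comp (inv_der x0); apply: cosint_der; rewrite invr_gt0.
- by move=> x x0; rewrite osc_inv// cosN /osc addNr.
Qed.

Lemma symbol0 : symbol 0 = pi.
Proof.
have e : cosint 0 1 = 2 * atan 1.
  rewrite /cosint /oscint -integral0_oneDsqr// -RintegralZl//.
    by apply: eq_Rintegral => x _; rewrite /osc mul0r cos0 mulr1.
  have := osc_integrable 0 cosd cos_le1' 1.
  move=> /(integrableZl _ 2^-1) h; apply: eq_integrable (h _) => //= x _.
  by rewrite /osc mul0r cos0 mulr1 -EFinM mulrA mulVf// mul1r.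
by rewrite /symbol e atan1; field.
Qed.

(** Lets a tend to 0, where the functions are O(a) while the derivative estimates hold only on (0,
    1]. *)
Lemma small_at0 (f : R -> R) (K C : R) : 0 <= C ->
  (forall a : R, 0 < a -> a <= 1 -> `|f 1 - f a| <= K) ->
  (forall a : R, 0 < a -> a <= 1 -> `|f a| <= C * a) -> `|f 1| <= K.
Proof.
move=> C0 h1 h2; apply/ler_addgt0Pr => e e0.
have C1 : 0 < C + 1 by rewrite ltr_wpDl.
pose a := Num.min 1 (e / (C + 1)).
have a0 : 0 < a by rewrite lt_min ltr01 divr_gt0.
have a1 : a <= 1 by rewrite ge_min lexx.
have ae : a * (C + 1) <= e by rewrite -ler_pdivlMr// ge_min lexx orbT.
have -> : f 1 = (f 1 - f a) + f a by rewrite subrK.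
apply: le_trans (ler_normD _ _) _; apply: lerD (h1 _ a0 a1) _.
by apply: le_trans (h2 _ a0 a1) _; nra.
Qed.

(** One integration by parts on (0, 1]. [G] is the boundary term, which vanishes at 1 because ln 1 =
    0, and the remaining integrand is at most 2 / xi. *)
Lemma symbol_decay xi : 0 < xi -> `|symbol xi| <= 4 / xi.
Proof.
move=> xi0; rewrite /symbol normrM ger0_norm//.
have xin : xi != 0 by rewrite gt_eqF.
suff : `|cosint xi 1| <= 2 / xi by move=> h; have := ler_wpM2l (ler0n R 2) h; rewrite mulrA -natrM.
pose G v := sin (xi * ln v) * (2 * v / (xi * (1 + v ^+ 2))).
pose f v := cosint xi v - G v.
have f1 : f 1 = cosint xi 1 by rewrite /f /G ln1 mulr0 sin0 mul0r subr0.
rewrite -f1; apply: (@small_at0 f _ (2 + 2 / xi)); first by rewrite addr_ge0// divr_ge0// ltW.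
  move=> a a0 a1.
  pose dG v := cos (xi * ln v) * (xi / v) * (2 * v / (xi * (1 + v ^+ 2))) +
     sin (xi * ln v) * (2 / xi * (1 - v ^+ 2) / (1 + v ^+ 2) ^+ 2).
  have fd x : 0 < x -> is_derive x 1 f (osc cos xi x - dG x).
    move=> x0; apply: der_sub; first exact: cosint_der.
    apply: der_mul.
      apply: der_comp (sind _) _.
      by have := der_mul (der_cst xi x) (is_derive1_ln x0); rewrite mul0r add0r.
    have dq : is_derive x 1 (fun y : R => xi * (1 + y ^+ 2)) (xi * (2 * x)).
      have := der_mul (der_cst xi x) (der_add (der_cst 1 x) (der_mul (der_id x) (der_id x))).
      by rewrite mul0r !add0r mul1r mulr1 -mulr2n -[x *+ 2]mulr_natl.
    have d2 : is_derive x 1 (fun y : R => 2 * y) 2.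
      by have := der_mul (der_cst 2 x) (der_id x); rewrite mul0r add0r mulr1.
    have qn : xi * (1 + x ^+ 2) != 0 by rewrite mulf_neq0// gt_eqF// oneDsq_gt0.
    have h := der_mul d2 (@der_inv _ (fun y => xi * (1 + y ^+ 2)) x _ qn dq).
    apply: is_derive_eq; have := oneDsq_gt0 x => q0.
    by field; rewrite xin gt_eqF.
  have := @derive_le _ f (fun x => 2 / xi * x) _ (fun=> 2 / xi) a 1 a0 a1 fd.
  move=> h; apply: le_trans (h _ _) _.
  - by move=> x _; have := der_mul (der_cst (2 / xi) x) (der_id x); rewrite mul0r add0r mulr1.
  - move=> x /andP[ax x1]; have x0 := lt_le_trans a0 ax.
    have q0 := oneDsq_gt0 x.
    have -> : osc cos xi x - dG x = - (2 / xi * (sin (xi * ln x) * ((1 - x ^+ 2) / (1 + x ^+ 2) ^+ 2))).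
      by rewrite /osc /dG; field; rewrite xin !gt_eqF.
    rewrite normrN normrM (ger0_norm (_ : 0 <= 2 / xi)) ?divr_ge0 ?(ltW xi0)//.
    rewrite ler_piMr ?divr_ge0 ?(ltW xi0)// normrM mulr_ile1// ?sin_le1'//.
    rewrite normrM normfV (gtr0_norm (exprn_gt0 2 q0)) ler_pdivrMr ?exprn_gt0// mul1r.
    have x2 : x ^+ 2 <= 1 by rewrite expr_le1// ltW.
    by rewrite ger0_norm ?subr_ge0//; have := sqr_ge0 x; nra.
  - by rewrite mulr1 gerBl mulr_ge0 ?divr_ge0 ?ltW.
move=> a a0 a1; apply: le_trans (ler_normB _ _) _; rewrite [leRHS]mulrDl; apply: lerD.
  exact: oscint_le cosd cos_le1' _ (ltW a0).
rewrite /G normrM; apply: le_trans (_ : 1 * `|2 * a / (xi * (1 + a ^+ 2))| <= _).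
  by rewrite ler_wpM2r// sin_le1'.
rewrite mul1r ger0_norm; last by rewrite divr_ge0 ?mulr_ge0 ?(ltW a0) ?(ltW xi0) ?(ltW (oneDsq_gt0 _)).
rewrite ler_pdivrMr ?mulr_gt0 ?oneDsq_gt0//.
have -> : 2 / xi * a * (xi * (1 + a ^+ 2)) = 2 * a * (1 + a ^+ 2) by field.
by rewrite ler_peMr ?mulr_ge0 ?(ltW a0)// lerDl sqr_ge0.
Qed.

Lemma cos_lipschitz (x y : R) : `|cos x - cos y| <= `|x - y|.
Proof.
wlog xy : x y / y <= x.
  by move=> h; have [|/ltW] := leP y x => yx; [exact: h|rewrite distrC (distrC x); exact: h].
have [|c _ ->] := @MVT_segment R cos (fun x => - sin x) y x xy.
  by apply: continuous_subspaceT => z; exact: continuous_cos.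
by rewrite normrM ler_piMl// Nsin_le1.
Qed.

(** As cos is 1-Lipschitz and |ln v| <= 2 / sqrt v on (0, 1], the difference of integrands is at
    most 4 |xi - xi'| / sqrt v, the derivative of 8 |xi - xi'| sqrt v. *)
Lemma symbol_lipschitz xi xi' : `|symbol xi - symbol xi'| <= 16 * `|xi - xi'|.
Proof.
rewrite /symbol -mulrBr normrM ger0_norm//.
suff : `|cosint xi 1 - cosint xi' 1| <= 8 * `|xi - xi'|.
  by move=> h; have := ler_wpM2l (ler0n R 2) h; rewrite mulrA -natrM.
pose f v := cosint xi v - cosint xi' v.
apply: (@small_at0 f _ 4) => // a a0 a1; last first.
  apply: le_trans (ler_normB _ _) _.
  have := oscint_le xi cosd cos_le1' (ltW a0); have := oscint_le xi' cosd cos_le1' (ltW a0).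
  rewrite -/(cosint xi a) -/(cosint xi' a); lra.
have fd x : 0 < x -> is_derive x 1 f (osc cos xi x - osc cos xi' x).
  by move=> x0; apply: der_sub; exact: cosint_der.
have gd x : 0 < x -> is_derive x 1 (fun y => 8 * `|xi - xi'| * Num.sqrt y)
    (8 * `|xi - xi'| * (2 * Num.sqrt x)^-1).
  by move=> x0; have := der_mul (der_cst (8 * `|xi - xi'|) x) (is_derive1_sqrt x0); rewrite mul0r add0r.
apply: le_trans (derive_le a0 a1 fd gd _) _; last first.
  by rewrite sqrtr1 mulr1 gerBl mulr_ge0 ?sqrtr_ge0// mulr_ge0.
move=> x /andP[ax x1]; have x0 := lt_le_trans a0 ax.
have s0 : 0 < Num.sqrt x by rewrite sqrtr_gt0.
rewrite /osc -mulrBl -mulrBr !normrM normfV (gtr0_norm (oneDsq_gt0 x)) ger0_norm//.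
apply: le_trans (_ : 2 * `|cos (xi * ln x) - cos (xi' * ln x)| <= _).
  by rewrite ler_piMr ?mulr_ge0// invf_le1 ?oneDsq_gt0// lerDl sqr_ge0.
apply: le_trans (ler_wpM2l (ler0n R 2) (cos_lipschitz _ _)) _.
rewrite -mulrBl normrM.
have lnx : `|ln x| <= 2 / Num.sqrt x.
  rewrite ler0_norm ?ln_le0//.
  have e : x = Num.sqrt x ^+ 2 by rewrite sqr_sqrtr ?ltW.
  have -> : ln x = 2 * ln (Num.sqrt x) by rewrite {1}e lnXn// mulr_natl.
  rewrite -mulrN -lnV ?posrE// ler_wpM2l//.
  by apply/ltW/ln_sublinear; rewrite invr_gt0.
have := ler_wpM2l (normr_ge0 (xi - xi')) lnx; set p := `|xi - xi'|; set q := `|ln x|.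
have -> : 8 * p * (2 * Num.sqrt x)^-1 = 2 * (p * (2 / Num.sqrt x)) by field; rewrite gt_eqF.
lra.
Qed.

(** Intermediate values between pi, taken at 0, and the point b = 4 / t, where the decay bound
    equals t. *)
Lemma symbol_onto t : 0 < t -> t <= pi -> exists xi, symbol xi = t.
Proof.
move=> t0 tpi; pose b := 4 / t.
have b0 : 0 < b by rewrite divr_gt0.
have [||c _ <-] := @IVT R symbol 0 b t (ltW b0); last by exists c.
  apply: continuous_subspaceT => x; apply/cvgrPdist_lt => e e0.
  have e16 : 0 < e / 16 by rewrite divr_gt0.
  near=> y; apply: le_lt_trans (symbol_lipschitz _ _) _.
  have : `|x - y| < e / 16 by near: y; exact: cvgr_dist_lt.
  lra.
have sb : symbol b <= t.
  apply: le_trans (ler_norm _) _; apply: le_trans (symbol_decay b0) _.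
  by rewrite /b invf_div mulrCA divff ?mulr1.
by rewrite symbol0 ge_min sb orbT le_max tpi.
Unshelve. all: by end_near. Qed.
End oscillatory.

(** * Weyl vectors for H_lambda *)

Section weyl_vectors.
Variable R : realType.
Local Notation N x := (l2norm (ell2_seq x)).
Local Notation basis := Defs.basis.
Local Notation Re := (@complex.Re R).
Local Notation Im := (@complex.Im R).
Local Notation L := (ln_index R).

Definition rho n : R := Num.sqrt (L n).

Lemma rho_gt0 n : 0 < rho n. Proof. by rewrite sqrtr_gt0 ln_index_gt0. Qed.
Lemma rho_sq n : rho n ^+ 2 = L n. Proof. by rewrite sqr_sqrtr// ltW// ln_index_gt0. Qed.
Lemma rho_homo n m : (n <= m)%N -> rho n <= rho m.
Proof. by move=> nm; rewrite ler_sqrt ?ln_index_homo// ltW// ln_index_gt0. Qed.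

(** The derivative of sqrt (ln x) at x = n + 2. The true step of [rho] lies between two consecutive
    values of it. *)
Definition rho_mesh n : R := (2 * n.+2%:R * rho n)^-1.

Lemma rho_mesh_gt0 n : 0 < rho_mesh n.
Proof. by rewrite invr_gt0 !mulr_gt0 ?rho_gt0// ltr0n. Qed.

Lemma rho_step_le n : rho n.+1 - rho n <= rho_mesh n.
Proof.
have := ln_index_step_le R n; rewrite -!rho_sq /rho_mesh.
have r0 := rho_gt0 n; have r1 := rho_homo (leqnSn n).
rewrite -(mulrC n.+2%:R) -mulrA invfM; set w := n.+2%:R^-1; move: r0 r1.
set r := rho n; set s := rho n.+1 => r0 rs h.
rewrite ler_pdivlMr ?mulr_gt0//; apply: le_trans h; nra.
Qed.

Lemma rho_step_ge n : rho_mesh n.+1 <= rho n.+1 - rho n.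
Proof.
have := ln_index_step_ge R n; rewrite -!rho_sq /rho_mesh.
have r0 := rho_gt0 n; have r1 := rho_homo (leqnSn n).
rewrite -(mulrC n.+3%:R) -mulrA invfM; set w := n.+3%:R^-1; move: r0 r1.
set r := rho n; set s := rho n.+1 => r0 rs h.
have s0 := lt_le_trans r0 rs.
rewrite ler_pdivrMr ?mulr_gt0//; apply: le_trans h _; nra.
Qed.

Section riemann_sum.
Variables (t dt : R -> R) (xi : R).
Hypotheses (t_der : forall x : R, is_derive x 1 t (dt x))
  (t1 : forall x : R, `|t x| <= 1) (dt1 : forall x : R, `|dt x| <= 1).

(* A Riemann sum for the oscillatory integral up to rho k / s. *)
Definition osc_sum (s : R) k : R := \sum_(n < k) rho_mesh n / s * osc t xi (rho n / s).

(** A telescoping majorant: the k-th rectangle errs by at most ([mesh_error k] - [mesh_error k.+1])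
    / s. The first term absorbs the excess of weight over width, the second the rule itself through
    1 / (k + 1) - 1 / (k + 2). *)
Definition mesh_error n : R :=
  2 * rho_mesh n + (2 * `|xi| + 1) / (4 * rho 0 ^+ 3) * n.+1%:R^-1.

Lemma mesh_error_ge0 n : 0 <= mesh_error n.
Proof.
rewrite addr_ge0// mulr_ge0 ?(ltW (rho_mesh_gt0 _))// ?invr_ge0 ?ler0n//.
by rewrite divr_ge0 ?addr_ge0 ?mulr_ge0 ?exprn_ge0 ?(ltW (rho_gt0 _)).
Qed.

Lemma osc_sum_error (s : R) k : 0 < s ->
  `|osc_sum s k - (oscint t xi (rho k / s) - oscint t xi (rho 0 / s))| <= mesh_error 0 / s.
Proof.
move=> s0.
suff h : `|osc_sum s k - (oscint t xi (rho k / s) - oscint t xi (rho 0 / s))| <=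
    (mesh_error 0 - mesh_error k) / s.
  apply: le_trans h _; rewrite ler_wpM2r ?invr_ge0 ?(ltW s0)//.
  by rewrite gerBl mesh_error_ge0.
elim: k => [|k ih]; first by rewrite /osc_sum big_ord0 !subrr normr0 mul0r.
rewrite /osc_sum big_ord_recr/= -/(osc_sum s k).
set S := osc_sum s k in ih *; set F := oscint t xi in ih *.
have split_step (u d f1 f f0 : R) :
  u + d - (f1 - f0) = (u - (f - f0)) + (d - (f1 - f)) by ring.
rewrite (split_step _ _ _ (F (rho k / s))).
apply: le_trans (ler_normD _ _) _.
have r0 := rho_gt0 k; have rk := rho_homo (leqnSn k); have rk0 := rho_homo (leq0n k).
have r00 := rho_gt0 0.
have step := @oscint_step _ t dt xi t_der t1 dt1 (rho k / s) (rho k.+1 / s) (rho_mesh k / s) _ _ _.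
apply: le_trans (lerD ih (step _ _ _)) _.
- by rewrite divr_gt0.
- by rewrite ler_pM2r ?invr_gt0.
- by rewrite -mulrBl ler_pM2r ?invr_gt0// rho_step_le.
have -> : (mesh_error 0 - mesh_error k.+1) / s =
  (mesh_error 0 - mesh_error k) / s + (mesh_error k - mesh_error k.+1) / s by ring.
rewrite lerD2l.
set q := rho k.+1 - rho k.
have -> : 2 * (rho_mesh k / s - (rho k.+1 / s - rho k / s)) +
   (2 * `|xi| + 1) / (rho k / s) * (rho k.+1 / s - rho k / s) ^+ 2 =
   (2 * (rho_mesh k - q) + (2 * `|xi| + 1) * (q ^+ 2 / rho k)) / s.
  by rewrite /q; field; rewrite !gt_eqF.
rewrite ler_pM2r ?invr_gt0// /mesh_error.
have q0 : 0 <= q by rewrite subr_ge0.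
have qd : q <= rho_mesh k by exact: rho_step_le.
have qd' : rho_mesh k.+1 <= q by exact: rho_step_ge.
have K0 : 0 <= 2 * `|xi| + 1 by rewrite addr_ge0// mulr_ge0.
(* The left side is at most 1 / (4 (k + 2)^2 rho_0^3), and (k + 2)^2 >= (k + 1) (k + 2). *)
have : q ^+ 2 / rho k <= (4 * rho 0 ^+ 3)^-1 * (k.+1%:R^-1 - k.+2%:R^-1).
  apply: le_trans (_ : rho_mesh k ^+ 2 / rho 0 <= _).
    apply: ler_pM; rewrite ?sqr_ge0 ?invr_ge0 ?(ltW r0)//.
      by rewrite lerXn2r ?nnegrE// (le_trans q0).
    by rewrite lef_pV2 ?posrE.
  have -> : k.+1%:R^-1 - k.+2%:R^-1 = (k.+1%:R * k.+2%:R)^-1 :> R.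
    rewrite -[k.+2%:R]natr1; field.
    have k1 : 0 < 1 + k%:R :> R by rewrite ltr_wpDr.
    by rewrite !gt_eqF// addr_gt0.
  rewrite /rho_mesh exprVn -!invfM lef_pV2 ?posrE ?mulr_gt0 ?exprn_gt0 ?ltr0n//.
  rewrite !exprMn.
  apply: le_trans (_ : 4 * k.+2%:R ^+ 2 * rho 0 ^+ 2 * rho 0 <= _); last first.
    rewrite (_ : 2 ^+ 2 = 4 :> R); last by rewrite expr2 -natrM.
    rewrite ler_pM2r// ler_pM2l ?mulr_gt0 ?exprn_gt0 ?ltr0n//.
    by rewrite lerXn2r ?nnegrE ?(ltW r00) ?(ltW r0).
  have -> : 4 * k.+2%:R ^+ 2 * rho 0 ^+ 2 * rho 0 = 4 * rho 0 ^+ 3 * (k.+2%:R * k.+2%:R) by ring.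
  by rewrite ler_pM2l ?mulr_gt0 ?exprn_gt0// ler_pM2r ?ltr0n// ler_nat.
move=> /(ler_wpM2l K0).
move: (2 * `|xi| + 1) (4 * rho 0 ^+ 3)^-1 k.+1%:R^-1 k.+2%:R^-1 => K P i1 i2 hA.
have -> : 2 * rho_mesh k + K * P * i1 - (2 * rho_mesh k.+1 + K * P * i2) =
    2 * (rho_mesh k - rho_mesh k.+1) + K * (P * (i1 - i2)) by ring.
by apply: lerD hA; rewrite ler_wpM2l// lerD2l lerN2.
Qed.
End riemann_sum.

Variable xi : R.

Let cosd (x : R) : is_derive x 1 cos (- sin x). Proof. exact: is_derive_cos. Qed.
Let sind (x : R) : is_derive x 1 sin (cos x). Proof. exact: is_derive_sin. Qed.

Definition osc_const : R := mesh_error xi 0 + 2 * rho 0.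

Lemma osc_const_ge0 : 0 <= osc_const.
Proof. by rewrite addr_ge0 ?mesh_error_ge0// mulr_ge0// ltW// rho_gt0. Qed.

(** To be used with s = [rho m]. The first bound serves m < k: the integral beyond rho k / s equals
    the one up to s / rho k, hence is small. The second serves m >= k, where the whole range of
    integration is short. *)
Lemma cos_sum_near s k : 0 < s ->
  `|osc_sum cos xi s k - symbol xi| <= osc_const / s + 2 * (s / rho k) /\
  `|osc_sum cos xi s k| <= osc_const / s + 2 * (rho k / s).
Proof.
move=> s0; have h := osc_sum_error xi cosd (@cos_le1' R) (@Nsin_le1 R) k s0.
have v0 : 0 < rho k / s by rewrite divr_gt0 ?rho_gt0.
have w0 : 0 < rho 0 / s by rewrite divr_gt0 ?rho_gt0.
have h0 := oscint_le xi cosd (@cos_le1' R) (ltW w0).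
have hk := oscint_le xi cosd (@cos_le1' R) (ltW v0).
have vi0 : 0 < (rho k / s)^-1 by rewrite invr_gt0.
have hi := oscint_le xi cosd (@cos_le1' R) (ltW vi0).
have e := cosint_inv xi v0; rewrite /cosint in e; rewrite invf_div in hi e.
rewrite /osc_const mulrDl -mulrA.
move: h h0 hk hi e; set S := osc_sum _ _ _ _; set F0 := oscint _ _ (rho 0 / s).
set Fk := oscint _ _ (rho k / s); set Fi := oscint _ _ (s / rho k) => h h0 hk hi <-.
split.
  have -> : S - (Fi + Fk) = (S - (Fk - F0)) - F0 - Fi by ring.
  apply: le_trans (ler_normB _ _) _; apply: lerD hi.
  by apply: le_trans (ler_normB _ _) _; exact: lerD.
have -> : S = (S - (Fk - F0)) - F0 + Fk by ring.
apply: le_trans (ler_normD _ _) _; apply: lerD hk.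
by apply: le_trans (ler_normB _ _) _; exact: lerD.
Qed.

Lemma sin_sum_near s k : 0 < s ->
  `|osc_sum sin xi s k| <= osc_const / s + 2 * (s / rho k) /\
  `|osc_sum sin xi s k| <= osc_const / s + 2 * (rho k / s).
Proof.
move=> s0; have h := osc_sum_error xi sind (@sin_le1' R) (@cos_le1' R) k s0.
have v0 : 0 < rho k / s by rewrite divr_gt0 ?rho_gt0.
have w0 : 0 < rho 0 / s by rewrite divr_gt0 ?rho_gt0.
have h0 := oscint_le xi sind (@sin_le1' R) (ltW w0).
have hk := oscint_le xi sind (@sin_le1' R) (ltW v0).
have vi0 : 0 < (rho k / s)^-1 by rewrite invr_gt0.
have hi := oscint_le xi sind (@sin_le1' R) (ltW vi0).
have e := sinint_inv xi v0; rewrite /sinint in e; rewrite e invf_div in hi.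
rewrite /osc_const mulrDl -mulrA.
move: h h0 hk hi; set S := osc_sum _ _ _ _; set F0 := oscint _ _ (rho 0 / s).
set Fk := oscint _ _ (rho k / s) => h h0 hk hi.
have -> : S = (S - (Fk - F0)) - F0 + Fk by ring.
split; apply: le_trans (ler_normD _ _) _.
  by apply: lerD hi; apply: le_trans (ler_normB _ _) _; exact: lerD.
by apply: lerD hk; apply: le_trans (ler_normB _ _) _; exact: lerD.
Qed.

Definition cis (a : R) : R[i] := cos a +i* sin a.

Lemma cisD a b : cis (a + b) = cis a * cis b.
Proof.
apply: complex_ext; rewrite /cis /= ?cosD ?sinD //.
by rewrite addrC (mulrC (sin a)).
Qed.

Lemma normc_cis a : Normc.normc (cis a) = 1.
Proof. by rewrite /cis /= cos2Dsin2 sqrtr1. Qed.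

Definition phase n : R := xi * ln (rho n).
Definition amp n : R := (Num.sqrt n.+2%:R * rho n)^-1.
(* cis (phase n) = (ln (n + 2))^(i xi / 2) and amp n = ((n + 2) ln (n + 2))^(-1/2). *)
Definition weyl_coef n : R[i] := (amp n)%:C * cis (phase n).
Definition weyl_vec k : ell2 R := \sum_(n < k) weyl_coef n *: basis R n.

Lemma amp_gt0 n : 0 < amp n.
Proof. by rewrite invr_gt0 mulr_gt0 ?rho_gt0// sqrtr_gt0 ltr0n. Qed.

Lemma amp_sq n : amp n ^+ 2 = (n.+2%:R * L n)^-1.
Proof. by rewrite exprVn exprMn rho_sq sqr_sqrtr ?ler0n. Qed.

Lemma normc_weyl_coef n : Normc.normc (weyl_coef n) ^+ 2 = (n.+2%:R * L n)^-1.
Proof. by rewrite Normc.normcM normc_cis mulr1 normc_real ?amp_sq// ltW// amp_gt0. Qed.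

Lemma weyl_vecE k n : weyl_vec k n = if (n < k)%N then weyl_coef n else 0.
Proof.
rewrite ell2_sum; under eq_bigr do rewrite ell2_scale basisE.
case: ltnP => nk.
  rewrite (bigD1 (Ordinal nk))//= big1 ?addr0 ?eqxx ?mulr1//.
  move=> i /negP h; case: eqP => [e|]; last by rewrite mulr0.
  by exfalso; apply: h; apply/eqP/val_inj.
rewrite big1// => i _; case: eqP => [e|]; last by rewrite mulr0.
by have := ltn_ord i; rewrite -e ltnNge nk.
Qed.

Variables (c : R) (T : {linear ell2 R -> ell2 R}).
Hypothesis T_hilbert : represents (hilbert_kernel R) c T.

(** An exact identity: [amp n] times the entry (m, n) is [amp m] times the n-th rectangle in v = rho
    n / rho m without its oscillating factor, and the phases subtract to xi ln v. *)
Lemma weyl_image k m : T (weyl_vec k) m =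
  weyl_coef m * (osc_sum cos xi (rho m) k +i* osc_sum sin xi (rho m) k).
Proof.
have s0 := rho_gt0 m.
rewrite /weyl_vec linear_sum ell2_sum.
have -> : osc_sum cos xi (rho m) k +i* osc_sum sin xi (rho m) k =
    \sum_(n < k) (rho_mesh n / rho m * (2 / (1 + (rho n / rho m) ^+ 2)))%:C *
      cis (phase n - phase m).
  have ph n : xi * ln (rho n / rho m) = phase n - phase m.
    by rewrite ln_div ?posrE ?rho_gt0// mulrBr.
  apply: complex_ext => /=.
    have Re_sum (I : finType) (F : I -> R[i]) : Re (\sum_i F i) = \sum_i Re (F i).
      by elim/big_rec2: _ => // i u v _ <-; rewrite ReD.
    rewrite Re_sum; apply: eq_bigr => n _; rewrite /osc ph ReM /= mul0r subr0.
    by ring.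
  have Im_sum (I : finType) (F : I -> R[i]) : Im (\sum_i F i) = \sum_i Im (F i).
    by elim/big_rec2: _ => // i u v _ <-; rewrite ImD.
  rewrite Im_sum; apply: eq_bigr => n _; rewrite /osc ph ImM /= mul0r addr0.
  by ring.
rewrite mulr_sumr; apply: eq_bigr => n _.
rewrite linearZ ell2_scale (represents_basis T_hilbert) /weyl_coef.
have -> : cis (phase n) = cis (phase m) * cis (phase n - phase m).
  by rewrite -cisD addrC subrK.
have e : amp n * hilbert_kernel R m n =
    amp m * (rho_mesh n / rho m * (2 / (1 + (rho n / rho m) ^+ 2))).
  have r0 := rho_gt0 n.
  have a0 : 0 < Num.sqrt m.+2%:R :> R by rewrite sqrtr_gt0 ltr0n.
  have b0 : 0 < Num.sqrt n.+2%:R :> R by rewrite sqrtr_gt0 ltr0n.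
  rewrite /amp /hilbert_kernel /rho_mesh natrM sqrtrM ?ler0n// -!rho_sq.
  have -> : n.+2%:R = Num.sqrt n.+2%:R ^+ 2 :> R by rewrite sqr_sqrtr ?ler0n.
  rewrite sqrtr_sqr (ger0_norm (ltW b0)).
  have q0 : 0 < rho m ^+ 2 + rho n ^+ 2 by rewrite addr_gt0 ?exprn_gt0.
  by field; rewrite !gt_eqF.
have eC : (amp n)%:C * (hilbert_kernel R m n)%:C = ((amp m)%:C *
    (rho_mesh n / rho m * (2 / (1 + (rho n / rho m) ^+ 2)))%:C) :> R[i].
  by rewrite -!rmorphM e.
by rewrite mulrAC eC; ring.
Qed.

Definition weyl_error k m : R :=
  2 * (osc_const / rho m) + 4 * (if (m < k)%N then rho m / rho k else rho k / rho m).

Lemma weyl_residual k m :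
  Normc.normc ((T (weyl_vec k) - (symbol xi)%:C *: weyl_vec k) m) ^+ 2 <=
  (m.+2%:R * L m)^-1 * weyl_error k m ^+ 2.
Proof.
have s0 := rho_gt0 m.
rewrite ell2_sub ell2_scale weyl_image weyl_vecE -normc_weyl_coef -exprMn.
set S := osc_sum cos _ _ _; set S' := osc_sum sin _ _ _.
have E0 : 0 <= weyl_error k m.
  rewrite addr_ge0 ?mulr_ge0 ?invr_ge0 ?osc_const_ge0 ?(ltW s0)//.
  by case: ifP => _; rewrite divr_ge0 ?(ltW (rho_gt0 _)).
rewrite lerXn2r ?nnegrE ?normc_ge0 ?mulr_ge0 ?normc_ge0//.
have -> : weyl_coef m * (S +i* S') - (symbol xi)%:C * (if (m < k)%N then weyl_coef m else 0) =
  weyl_coef m * ((S - (if (m < k)%N then symbol xi else 0)) +i* S').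
  case: ifP => _; last by rewrite mulr0 subr0 subr0.
  rewrite (mulrC _%:C) -mulrBr; congr (_ * _).
  by apply: complex_ext; rewrite /= ?subr0.
rewrite Normc.normcM ler_wpM2l ?normc_ge0//.
apply: le_trans (normc_le_ReIm _) _; rewrite /weyl_error /=.
have [h1 h2] := cos_sum_near k s0; have [h3 h4] := sin_sum_near k s0.
by move: h1 h2 h3 h4; rewrite -/S -/S'; case: ifP => _; rewrite ?subr0; lra.
Qed.

(** From (2 p + 4 q)^2 <= 8 p^2 + 32 q^2. The first bracket bounds the sum of 1 / (n (ln n)^2). In
    the second, the terms m < k and the terms m > k contribute at most 1 each, and m = k at most 1 /
    ln 2. *)
Definition residual_const : R :=
  8 * osc_const ^+ 2 * ((2 * L 0 ^+ 2)^-1 + (L 0)^-1) + 32 * (2 + (L 0)^-1).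

Lemma sum_harmonic_le k : \sum_(m < k) m.+2%:R^-1 <= L k.
Proof.
apply: le_trans (_ : ln k.+1%:R <= _); last by rewrite ler_ln ?posrE ?ltr0n// ler_nat.
elim: k => [|k ih]; first by rewrite big_ord0 ln1.
rewrite big_ord_recr /=; apply: le_trans (lerD ih (lnS_ge R k)) _.
by rewrite addrC subrK.
Qed.

Lemma weyl_residual_le k :
  N (T (weyl_vec k) - (symbol xi)%:C *: weyl_vec k) ^+ 2 <= residual_const.
Proof.
rewrite -lee_fin -sqnorm_l2norm; apply: sqnorm_le => n.
apply: le_trans (sqpart_homo _ (leq_maxl n k.+1)) _; set K := maxn n k.+1.
have kK : (k < K)%N by rewrite leq_maxr.
pose E m : R := if (m < k)%N then rho m / rho k else rho k / rho m.
apply: le_trans (_ : \sum_(m < K) (8 * osc_const ^+ 2 * (m.+2%:R * L m ^+ 2)^-1 +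
    32 * ((m.+2%:R * L m)^-1 * E m ^+ 2)) <= _).
  apply: ler_sum => m _; apply: le_trans (weyl_residual k m) _.
  rewrite /weyl_error -/(E m).
  have -> : 8 * osc_const ^+ 2 * (m.+2%:R * L m ^+ 2)^-1 =
      8 * ((m.+2%:R * L m)^-1 * (osc_const / rho m) ^+ 2).
    rewrite exprMn exprVn rho_sq; have := ln_index_gt0 R m => l0.
    by field; rewrite gt_eqF//= -[1 + 1 + _]/(_) ?pnatr_eq0.
  have w0 : 0 <= (m.+2%:R * L m)^-1 :> R by rewrite invr_ge0 mulr_ge0 ?(ltW (ln_index_gt0 R m)).
  rewrite (_ : 8 * _ + 32 * _ = (m.+2%:R * L m)^-1 * (8 * (osc_const / rho m) ^+ 2 + 32 * E m ^+ 2)); last by ring.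
  rewrite ler_wpM2l//; move: (osc_const / rho m) (E m) => p q.
  have := sqr_ge0 (2 * p - 4 * q); nra.
rewrite big_split /= -!mulr_sumr /residual_const; apply: lerD.
  rewrite (ler_wpM2l (mulr_ge0 (ler0n _ 8) (sqr_ge0 _)))//.
  rewrite -(big_mkord xpredT (fun m => (m.+2%:R * L m ^+ 2)^-1)).
  by rewrite (@big_cat_nat _ _ _ 1 0)//= ?big_nat1 ?(leq_trans _ kK)// lerD2l sum_inv_sq_log_le.
rewrite ler_wpM2l//.
rewrite -(big_mkord xpredT (fun m => (m.+2%:R * L m)^-1 * E m ^+ 2)).
rewrite (@big_cat_nat _ _ _ k 0)//= ?(ltnW kK)// (@big_ltn _ _ _ k)//.
have Lk := ln_index_gt0 R k.
rewrite (_ : 2 + (L 0)^-1 = 1 + ((L 0)^-1 + 1)); last by ring.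
apply: lerD.
  rewrite big_mkord.
  apply: le_trans (_ : \sum_(m < k) m.+2%:R^-1 / L k <= _).
    apply: ler_sum => m _; rewrite /E ltn_ord exprMn exprVn !rho_sq.
    have lm := ln_index_gt0 R m; rewrite le_eqVlt; apply/orP; left; apply/eqP.
    by rewrite invfM -mulrA; congr (_ * _); rewrite mulrA mulVf ?mul1r// gt_eqF.
  by rewrite -mulr_suml ler_pdivrMr// mul1r sum_harmonic_le.
apply: lerD.
  rewrite /E ltnn divff ?gt_eqF ?rho_gt0// expr1n mulr1.
  rewrite lef_pV2 ?posrE ?mulr_gt0 ?ln_index_gt0 ?ltr0n//.
  apply: le_trans (ln_index_homo R (leq0n k)) _.
  by rewrite ler_peMl ?(ltW Lk)// ler1n.
apply: le_trans (_ : L k * \sum_(k.+1 <= m < K) (m.+2%:R * L m ^+ 2)^-1 <= _).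
  rewrite mulr_sumr; apply: ler_sum_nat => m /andP[km _].
  rewrite /E ltnNge (ltnW km) /= exprMn exprVn !rho_sq.
  have lm := ln_index_gt0 R m; rewrite le_eqVlt; apply/orP; left; apply/eqP.
  by rewrite expr2 !invfM; ring.
by rewrite -ler_pdivlMl// mulr1 sum_inv_sq_log_le.
Qed.

(** Each 1 / (n ln n) dominates the next increment of ln ln n. *)
Lemma weyl_norm_sq k : ln (L k) - ln (L 0) <= N (weyl_vec k) ^+ 2.
Proof.
apply: le_trans (sqpart_le _ k).
have -> : sqpart k (weyl_vec k) = \sum_(n < k) (n.+2%:R * L n)^-1.
  by apply: eq_bigr => n _; rewrite weyl_vecE ltn_ord normc_weyl_coef.
elim: k => [|k ih]; first by rewrite subrr big_ord0.
rewrite big_ord_recr /=.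
have -> : ln (L k.+1) - ln (L 0) = (ln (L k) - ln (L 0)) + (ln (L k.+1) - ln (L k)) by ring.
apply: lerD ih _.
have l0 := ln_index_gt0 R k; have l1 := ln_index_gt0 R k.+1.
rewrite -ln_div ?posrE//.
have -> : L k.+1 / L k = 1 + (L k.+1 - L k) / L k by field; rewrite gt_eqF.
apply: le_trans (le_ln1Dx _) _.
  apply: lt_le_trans (_ : 0 <= _); first by rewrite ltrN10.
  by rewrite divr_ge0 ?(ltW l0)// subr_ge0 ln_index_homo.
by rewrite invfM ler_pM2r ?invr_gt0// ln_index_step_le.
Qed.

Lemma weyl_norm_unbounded (A : R) : exists k, A <= N (weyl_vec k) ^+ 2.
Proof.
pose B := expR (expR (A + ln (L 0))).
exists (Num.truncn B); apply: le_trans (weyl_norm_sq _).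
rewrite lerBrDr -[leLHS]expRK ler_ln ?posrE ?expR_gt0 ?ln_index_gt0//.
rewrite -[leLHS]expRK /L ler_ln ?posrE ?expR_gt0 ?ltr0n//.
by apply/ltW; apply: lt_le_trans (truncnS_gt _) _; rewrite ler_nat.
Qed.

Lemma symbol_weyl_point : weyl_point T (symbol xi)%:C.
Proof.
move=> e M e0.
pose W := \sum_(n < M) (n.+2%:R * L n)^-1 : R.
have W0 : 0 <= W.
  by apply: sumr_ge0 => n _; rewrite invr_ge0 mulr_ge0 ?(ltW (ln_index_gt0 R n)).
have B0 : 0 <= residual_const by apply: le_trans (weyl_residual_le 0); exact: sqr_ge0.
(* After normalisation the squared residual is at most [residual_const] / r^2 and the squared head
   at most W / r^2, where W does not depend on k. *)
have [k hk] := weyl_norm_unbounded ((residual_const + W + 1) / e ^+ 2).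
set x := weyl_vec k in hk; set r := N x in hk.
have e2 : 0 < e ^+ 2 by rewrite exprn_gt0.
have r2 : 0 < r ^+ 2 by apply: lt_le_trans hk; rewrite divr_gt0// ltr_wpDl// addr_ge0.
have r0 : 0 < r by rewrite lt_def l2norm_ge0 andbT -sqrf_eq0 gt_eqF.
rewrite ler_pdivrMr// -exprMn in hk.
have re0 : 0 <= r * e by rewrite mulr_ge0 ?(ltW r0) ?(ltW e0).
have ri : Normc.normc (r^-1)%:C = r^-1 by rewrite normc_real// invr_ge0 ltW.
exists ((r^-1)%:C *: x); split.
- by rewrite l2normZ ri mulVf// gt_eqF.
- have -> : T ((r^-1)%:C *: x) - (symbol xi)%:C *: ((r^-1)%:C *: x) =
      (r^-1)%:C *: (T x - (symbol xi)%:C *: x).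
    by rewrite linearZ scalerBr !scalerA (mulrC (symbol xi)%:C).
  rewrite l2normZ ri ler_pdivrMl//.
  rewrite -(@ler_sqr _ (N _)) ?nnegrE ?l2norm_ge0//.
  by apply: le_trans (weyl_residual_le k) _; apply: le_trans hk; lra.
have -> : trunc M ((r^-1)%:C *: x) = (r^-1)%:C *: trunc M x.
  by apply: ell2_ext => n; rewrite ell2_scale !truncE; case: ifP => _; rewrite ?ell2_scale ?mulr0.
rewrite l2normZ ri ler_pdivrMl// -(@ler_sqr _ (N _)) ?nnegrE ?l2norm_ge0//.
rewrite l2norm_trunc_sq; apply: le_trans (_ : W <= _); last by apply: le_trans hk; lra.
apply: ler_sum => n _; rewrite weyl_vecE; case: ifP => _; first by rewrite normc_weyl_coef.
by rewrite Normc.normc0 expr0n invr_ge0 mulr_ge0 ?(ltW (ln_index_gt0 R n)).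
Qed.
End weyl_vectors.

Lemma hilbert_weyl_point (R : realType) (c t : R) (T : {linear ell2 R -> ell2 R}) :
  represents (hilbert_kernel R) c T -> 0 <= t <= pi -> weyl_point T t%:C.
Proof.
move=> hT /andP[t0 tpi].
have pos s : 0 < s -> s <= pi -> weyl_point T s%:C.
  by move=> s0 sp; have [xi <-] := symbol_onto s0 sp; exact: symbol_weyl_point hT.
have [tz|tn] := eqVneq t 0; last by apply: pos => //; rewrite lt_def tn.
apply: weyl_point_closed => e e0; exists (Num.min e pi)%:C; last first.
  by apply: pos; rewrite ?lt_min ?e0 ?pi_gt0// ge_min lexx orbT.
by rewrite tz sub0r normcN normc_real ?ge_min ?lexx// le_min (ltW e0) pi_ge0.
Qed.

(** * Laplace transforms of densities *)

Section density.
Context d (T : measurableType d) (R : realType).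
Variables (mu nu : {measure set T -> \bar R}) (D : set T) (w : T -> R).
Hypotheses (mD : measurable D) (mw : measurable_fun D w).
Hypothesis w0 : forall x, D x -> 0 <= w x.
Hypothesis nu_w : forall A : set T, measurable A -> A `<=` D ->
  nu A = (\int[mu]_(x in A) (w x)%:E)%E.

Import HBNNSimple.
Local Open Scope ereal_scope.

(** Indicators are the hypothesis, simple functions follow by linearity, and monotone convergence
    along one approximating sequence concludes on both sides. All is relative to D because the
    density is prescribed only there. *)
Lemma integral_density (f : T -> \bar R) :
  (forall x, D x -> 0 <= f x) -> measurable_fun D f ->
  \int[nu]_(x in D) f x = \int[mu]_(x in D) (f x * (w x)%:E).
Proof.
move=> f0 mf; set g := EFin \o w.
have mg : measurable_fun D g by exact/measurable_EFinP.
have g0 x : D x -> 0 <= g x by move=> Dx; rewrite lee_fin w0.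
pose h := nnsfun_approx mD mf.
have -> : \int[nu]_(x in D) f x =
    lim (\int[nu]_(x in D) (EFin \o h n) x @[n --> \oo]).
  have fE x : D x -> f x = lim ((EFin \o h n) x @[n --> \oo]).
    by move=> Ex; apply/esym/cvg_lim => //; exact: cvg_nnsfun_approx.
  under eq_integral => x /[!inE] /fE -> //.
  apply: monotone_convergence => //.
  - move=> n; apply/measurable_EFinP.
    by apply: (measurable_funS measurableT) => //; exact/measurable_funP.
  - by move=> n x Ex //=; rewrite lee_fin.
  - by move=> x Ex a b ab; rewrite lee_fin; exact/lefP/nd_nnsfun_approx.
have -> : \int[mu]_(x in D) (f x * (w x)%:E) =
    lim (\int[mu]_(x in D) ((EFin \o h n) \* g) x @[n --> \oo]).
  have fg x : D x -> f x * (w x)%:E = lim (((EFin \o h n) \* g) x @[n --> \oo]).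
    by move=> Ex; apply/esym/cvg_lim => //; apply: cvgeZr => //;
      exact: cvg_nnsfun_approx.
  under eq_integral => x /[!inE] /fg -> //.
  apply: monotone_convergence => [//| | |].
  - move=> n; apply/emeasurable_funM => //; apply/measurable_funTS.
    exact/measurable_EFinP.
  - by move=> n x Ex /=; rewrite mule_ge0 ?lee_fin ?w0.
  - by move=> x Ex a b ab/=; rewrite lee_wpmul2r ?lee_fin ?w0//;
      exact/lefP/nd_nnsfun_approx.
suff suf n : \int[mu]_(x in D) ((EFin \o h n) x * g x) =
    \int[nu]_(x in D) (EFin \o h n) x.
  by congr (limn _); apply/funext => n; rewrite -suf.
transitivity (\int[nu]_(x in D)
   (\sum_(y \in range (h n)) (y * \1_(h n @^-1` [set y]) x)%:E)); last first.
  by apply: eq_integral => t tE; rewrite /= fimfunE -fsumEFin.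
have indich m r : measurable_fun D (fun x => (r * \1_(h m @^-1` [set r]) x)%:E).
  by apply: (measurable_comp measurableT) => //; exact: measurable_funM.
rewrite ge0_integral_fsum//; last by move=> m y Ey; exact: nnfun_muleindic_ge0.
transitivity (\int[mu]_(x in D) (\sum_(y \in range (h n))
    (y * \1_(h n @^-1` [set y]) x)%:E * g x)).
  under [RHS]eq_integral => x xE.
    rewrite -ge0_mule_fsuml => [|y]; last exact: nnfun_muleindic_ge0.
    rewrite fsumEFin // -(fimfunE _ x); over.
  by [].
rewrite ge0_integral_fsum//; last 2 first.
  - by move=> y; apply: emeasurable_funM.
  - by move=> m y Ey; rewrite mule_ge0 ?g0// nnfun_muleindic_ge0.
apply: eq_fsbigr => r rhn.
under [RHS]eq_integral do rewrite EFinM.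
rewrite integralZl_indic_nnsfun => //.
under eq_integral do rewrite EFinM -muleA.
have mI : measurable_fun D (fun x => (\1_(h n @^-1` [set r]) x)%:E : \bar R).
  by apply: (measurable_comp measurableT).
rewrite ge0_integralZl//.
- under eq_integral do rewrite muleC.
  rewrite (eq_integral (g \_ (h n @^-1` [set r]))); last first.
    by move=> x xE; rewrite epatch_indic.
  rewrite -integral_mkcondr integral_indic// -nu_w//.
    by rewrite setIC.
- exact: emeasurable_funM.
- by move=> t Et; rewrite mule_ge0 ?lee_fin ?w0.
- by move: rhn; rewrite inE => -[t _ <-]; rewrite lee_fin.
Qed.

End density.

Section laplace_density.
Variable R : realType.
Let J : set (measurableTypeR R) := `]0%R, +oo[%classic.
Let leb := (@lebesgue_measure R).

Let mJ : measurable J. Proof. exact: measurable_itv. Qed.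
Let JP (t : R) : J t <-> 0 < t.
Proof. by rewrite /J /= in_itv/= andbT. Qed.

Lemma Rintegral_sum n (f : nat -> R -> R) :
  (forall i, leb.-integrable J (EFin \o f i)) ->
  leb.-integrable J (EFin \o (fun t => \sum_(i < n) f i t)) /\
  \int[leb]_(t in J) (\sum_(i < n) f i t) = \sum_(i < n) \int[leb]_(t in J) f i t.
Proof.
move=> hf; elim: n => [|n [ih1 ih2]].
  rewrite big_ord0 (_ : (fun t => _) = (fun=> 0)); last by apply/funext => t; rewrite big_ord0.
  by split; [exact: integrable0|rewrite /Rintegral integral0].
rewrite (_ : (fun t => _) = (fun t => \sum_(i < n) f i t + f n t)); last first.
  by apply/funext => t; rewrite big_ord_recr.
split.
  by apply: eq_integrable (integrableD mJ ih1 (hf n)) => // t _ /=; rewrite EFinD.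
by rewrite RintegralD// ih2 big_ord_recr.
Qed.

Definition laplace_density (k : R -> R) (s : R) : R :=
  \int[leb]_(t in J) (expR (- (s * t)) * k t).

Lemma measurable_expRM (s : R) (D : set (measurableTypeR R)) :
  measurable_fun D (fun t : R => expR (- (s * t)) : R).
Proof.
apply: measurable_funTS; apply: continuous_measurable_fun => t.
apply: continuous_comp; last exact: continuous_expR.
by apply: continuousN; apply: continuousM => //; exact: cvg_cst.
Qed.

(** The exponential distribution of rate s has total mass 1. *)
Lemma laplace_density_cst (c s : R) : 0 < s ->
  leb.-integrable J (EFin \o (fun t => expR (- (s * t)) * c)) /\
  laplace_density (fun=> c) s = c / s.
Proof.
move=> s0.
have h : (\int[leb]_(t in J) (expR (- (s * t)))%:E = (s^-1)%:E)%E.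
  rewrite integral_itv_obnd_cbnd; last first.
    by apply/measurable_EFinP; exact: measurable_expRM.
  have := integral_exponential_pdf s0.
  have -> : (fun x => (exponential_pdf s x)%:E) =
      (fun x : R => (s * expR (- s * x))%:E) \_ `[0%R, +oo[.
    by apply/funext => x; rewrite /exponential_pdf/= !patchE; case: ifP.
  rewrite -integral_mkcond => h.
  have : (s%:E * \int[leb]_(t in `[0%R, +oo[) (expR (- (s * t)))%:E = 1)%E.
    rewrite -ge0_integralZl//=.
    - by rewrite -h; apply: eq_integral => x _; rewrite EFinM mulNr.
    - by apply/measurable_EFinP; exact: measurable_expRM.
    - by rewrite lee_fin ltW.
  move=> {}h.
  have : ((s^-1)%:E * (s%:E * \int[leb]_(t in `[0%R, +oo[) (expR (- (s * t)))%:E) = (s^-1)%:E)%E.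
    by rewrite h mule1.
  by rewrite muleA -EFinM mulVf ?gt_eqF// mul1e.
have hi : leb.-integrable J (EFin \o (fun t => expR (- (s * t)))).
  apply/integrableP; split; first by apply/measurable_EFinP; exact: measurable_expRM.
  under eq_integral do rewrite /= ger0_norm ?expR_ge0//.
  by rewrite h ltry.
split.
  by apply: eq_integrable (integrableZr mJ c hi) => // t _ /=; rewrite EFinM.
by rewrite /laplace_density RintegralZr// /Rintegral h mulrC.
Qed.

Section kernel.
Variables (k : R -> R) (s0 : R).
Hypotheses (mk : measurable_fun J k) (k0 : forall t, 0 < t -> 0 <= k t).
Hypothesis s0_gt0 : 0 < s0.
Hypothesis kint : leb.-integrable J (EFin \o (fun t => expR (- (s0 * t)) * k t)).

Lemma laplace_density_integrable s : s0 <= s ->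
  leb.-integrable J (EFin \o (fun t => expR (- (s * t)) * k t)).
Proof.
move=> s0s; apply: le_integrable kint => //.
  by apply/measurable_EFinP; apply: measurable_funM => //; exact: measurable_expRM.
move=> t /JP t0 /=; rewrite lee_fin !ger0_norm ?mulr_ge0 ?expR_ge0 ?k0//.
by rewrite ler_wpM2r ?k0// ler_expR lerN2 ler_wpM2r// ltW.
Qed.

Lemma laplace_density_ge0 s : 0 <= laplace_density k s.
Proof. by apply: Rintegral_ge0 => t /JP t0; rewrite mulr_ge0 ?expR_ge0 ?k0. Qed.

Lemma laplace_density_homo s s' : s0 <= s -> s <= s' ->
  laplace_density k s' <= laplace_density k s.
Proof.
move=> hs hs'; apply: le_Rintegral => //.
- exact/laplace_density_integrable/(le_trans hs).
- exact: laplace_density_integrable.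
by move=> t /JP t0; rewrite ler_wpM2r ?k0// ler_expR lerN2 ler_wpM2r// ltW.
Qed.

(** Beyond d the integrand is compared with the one at s0, gaining exp (- (s - s0) d). Near 0 the
    rate r is left free: it will be s itself when k is bounded by a constant, and s / 2 when k is
    bounded by a power. *)
Lemma laplace_density_split (c r d s : R) : 0 <= c -> 0 < r -> s0 <= s -> 0 < d ->
  (forall t, 0 < t -> t < d -> expR (- (s * t)) * k t <= expR (- (r * t)) * c) ->
  laplace_density k s <= c / r + expR (- ((s - s0) * d)) * laplace_density k s0.
Proof.
move=> c0 r0 hs d0 hk; have [ic <-] := laplace_density_cst c r0.
have i2 : leb.-integrable J
    (EFin \o (fun t => expR (- ((s - s0) * d)) * (expR (- (s0 * t)) * k t))).
  by apply: eq_integrable (integrableZl mJ _ kint) => // t _ /=; rewrite EFinM.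
rewrite /laplace_density -RintegralZl// -RintegralD//.
apply: le_Rintegral => //.
- exact: laplace_density_integrable.
- by apply: eq_integrable (integrableD mJ ic i2) => // t _ /=; rewrite EFinD.
move=> t /JP t0; have [td|dt] := ltP t d.
  by apply: le_trans (hk _ t0 td) _; rewrite lerDl !mulr_ge0 ?expR_ge0 ?k0.
apply: ler_wpDl; first by rewrite mulr_ge0 ?expR_ge0.
rewrite mulrA ler_wpM2r ?k0// -expRD ler_expR.
rewrite -subr_ge0 (_ : _ - _ = (s - s0) * (t - d)); last by ring.
by rewrite mulr_ge0 ?subr_ge0.
Qed.

Lemma expRN_le_sq (x : R) : 0 < x -> expR (- x) <= 2 / x ^+ 2.
Proof.
move=> x0; have := @expR_ge1Dxn R x 1 (ltW x0); rewrite (_ : 2`! = 2)%N// => h.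
rewrite expRN -[leRHS]invrK lef_pV2 ?posrE ?expR_gt0 ?invr_gt0 ?divr_gt0 ?exprn_gt0//.
by rewrite invf_div; apply: le_trans h; rewrite lerDr.
Qed.

Lemma laplace_density_tail d s : 0 < d -> s0 < s ->
  expR (- ((s - s0) * d)) * laplace_density k s0 <=
  2 * laplace_density k s0 / d ^+ 2 / (s - s0) ^+ 2.
Proof.
move=> d0 hs; have h : 0 < s - s0 by rewrite subr_gt0.
have := expRN_le_sq (mulr_gt0 h d0); rewrite exprMn => h2.
apply: le_trans (ler_wpM2r (laplace_density_ge0 s0) h2) _.
rewrite le_eqVlt; apply/orP; left; apply/eqP; field.
by rewrite !gt_eqF.
Qed.

(* Splitting at [d], where [k <= e / 2] on [(0, d)], the remaining part of
   the transform decays exponentially. *)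
Lemma laplace_density_vanish : k t @[t --> 0^'+] --> (0 : R) ->
  forall e, 0 < e -> exists X : R, forall s, X <= s -> s * laplace_density k s <= e.
Proof.
move=> kc e e0; have e2 : 0 < e / 2 by rewrite divr_gt0.
have [d d0 hd] : exists2 d, 0 < d & forall t, 0 < t -> t < d -> k t <= e / 2.
  have /cvgrPdist_le/(_ _ e2) := kc; rewrite near_withinE => -[d /= d0 hd].
  exists d => // t t0 td; have := hd t; rewrite /= !sub0r !normrN.
  by rewrite (ger0_norm (ltW t0)) (ger0_norm (k0 t0)); exact.
set C := laplace_density k s0; have C0 : 0 <= C by exact: laplace_density_ge0.
(* For s >= 2 s0 one has s - s0 >= s / 2, so s times the tail is at most 8 C / (d^2 s), and s >= q0
   makes this at most e / 2. *)
pose q0 := 16 * C / d ^+ 2 / e; exists (2 * s0 + q0 + 1) => s hs.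
have t0 : 0 <= q0 by rewrite !mulr_ge0 ?invr_ge0 ?(ltW e0) ?(exprn_ge0 _ (ltW d0)).
have s00 := s0_gt0; have ss0 : s0 < s by lra.
have sgt0 : 0 < s by lra.
have hl : laplace_density k s <= e / 2 / s + expR (- ((s - s0) * d)) * C.
  apply: laplace_density_split => //; [exact: ltW|exact: ltW|].
  by move=> t t1 td; rewrite ler_wpM2l ?expR_ge0 ?hd.
apply: le_trans (ler_wpM2l (ltW sgt0) hl) _.
rewrite mulrDr mulrCA divff ?gt_eqF// mulr1.
suff : s * (expR (- ((s - s0) * d)) * C) <= e / 2 by lra.
apply: le_trans (ler_wpM2l (ltW sgt0) (laplace_density_tail d0 ss0)) _.
rewrite -/C; have h1 : s / 2 <= s - s0 by lra.
have h2 : s ^+ 2 <= 4 * (s - s0) ^+ 2 by nra.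
have p0 : 0 < (s - s0) ^+ 2 by rewrite exprn_gt0 ?subr_gt0.
rewrite mulrA ler_pdivrMr//.
have h3 : 16 * C / d ^+ 2 <= e * s.
  have q0s : q0 <= s by lra.
  by rewrite [leRHS]mulrC -ler_pdivrMr.
set q := C / d ^+ 2 in h3 *; rewrite -!mulrA -/q in h3 *.
have : 2 * (s * q) <= e / 8 * s ^+ 2 by nra.
nra.
Qed.

(** Large s are covered by the limit, the others by monotonicity from s0. *)
Lemma laplace_density_bounded : k t @[t --> 0^'+] --> (0 : R) ->
  exists2 S, 0 <= S & forall s, s0 <= s -> s * laplace_density k s <= S.
Proof.
move=> /laplace_density_vanish/(_ 1 ltr01)[X hX].
have C0 := laplace_density_ge0 s0.
exists (1 + `|X| * laplace_density k s0) => [|s hs].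
  by rewrite addr_ge0 ?mulr_ge0.
have [Xs|sX] := leP X s.
  by apply: le_trans (hX _ Xs) _; rewrite lerDl mulr_ge0.
apply: le_trans (_ : `|X| * laplace_density k s0 <= _); last by rewrite lerDr.
apply: ler_pM => //.
- by rewrite (le_trans _ hs)// ltW.
- exact: laplace_density_ge0.
- by rewrite (le_trans (ltW sX))// ler_norm.
- exact: laplace_density_homo.
Qed.

Lemma powR_le_expR (p u : R) : 0 < p -> p <= 1 -> 0 <= u -> u `^ p <= 2 * expR (u / 2).
Proof.
move=> p0 p1 u0.
have h : u `^ p <= 1 + u.
  have [u1|u1] := leP u 1.
    apply: (@le_trans _ _ 1); last by rewrite lerDl.
    by rewrite -(congr1 (fun f => f p) (powR1 R)) ge0_ler_powR ?nnegrE// ltW.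
  apply: (@le_trans _ _ u); last by rewrite lerDr.
  by rewrite -[leRHS]powRr1// ler_powR// ltW.
by have := expR_ge1Dx (u / 2); lra.
Qed.

(** Writing t^p = (s t)^p / s^p and spending half of the exponential on (s t)^p leaves 2 C s^(-p)
    exp (- s t / 2), whose integral is 4 C s^(-1-p). The term in s^(-2) is the part beyond d. *)
Lemma laplace_density_rate (C p d : R) : 0 <= C -> 0 < p -> p <= 1 -> 0 < d ->
  (forall t, 0 < t -> t < d -> k t <= C * t `^ p) ->
  exists2 C', 0 <= C' & forall s, 2 * s0 <= s ->
    laplace_density k s <= C' * ((s * s `^ p)^-1 + (s ^+ 2)^-1).
Proof.
move=> C0 p0 p1 d0 hk.
pose c1 := 4 * C; pose c2 := 8 * laplace_density k s0 / d ^+ 2.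
have L0 := laplace_density_ge0 s0.
have c10 : 0 <= c1 by rewrite mulr_ge0.
have c20 : 0 <= c2 by rewrite !mulr_ge0 ?invr_ge0 ?(exprn_ge0 _ (ltW d0)).
exists (c1 + c2) => [|s hs]; first by rewrite addr_ge0.
have s00 := s0_gt0.
have sgt0 : 0 < s by lra.
have sp : 0 < s `^ p by exact: powR_gt0.
have h1 : laplace_density k s <= (2 * C / s `^ p) / (s / 2) +
     expR (- ((s - s0) * d)) * laplace_density k s0.
  apply: laplace_density_split => //; [|by rewrite divr_gt0|lra|].
    by rewrite divr_ge0 ?mulr_ge0 ?(ltW sp).
  move=> t t0 td; apply: le_trans (ler_wpM2l (expR_ge0 _) (hk _ t0 td)) _.
  have := powR_le_expR p0 p1 (mulr_ge0 (ltW sgt0) (ltW t0)).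
  rewrite powRM ?(ltW sgt0) ?(ltW t0)// => h.
  have -> : - (s / 2 * t) = - (s * t) + s * t / 2 by field.
  rewrite expRD -mulrA ler_wpM2l ?expR_ge0//.
  rewrite mulrA ler_pdivlMr//; have := ler_wpM2l C0 h; lra.
have h2 := @laplace_density_tail d s d0 ltac:(lra).
apply: le_trans h1 _; rewrite mulrDr lerD//.
  rewrite (_ : _ / (s / 2) = c1 * (s * s `^ p)^-1); last first.
    by rewrite /c1; field; rewrite !gt_eqF.
  by rewrite ler_wpM2r ?invr_ge0 ?mulr_ge0 ?(ltW sgt0) ?(ltW sp)// lerDl.
apply: le_trans h2 _.
apply: le_trans (_ : c2 * (s ^+ 2)^-1 <= _); last first.
  by rewrite ler_wpM2r ?invr_ge0 ?exprn_ge0 ?(ltW sgt0)// lerDr.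
have ss : 0 < s - s0 by lra.
rewrite ler_pdivrMr ?exprn_gt0// /c2 [leRHS]mulrAC ler_pdivlMr ?exprn_gt0//.
rewrite -[2 * _ / _]mulrA -[8 * _ / _]mulrA; set q := laplace_density k s0 / _.
have q0 : 0 <= q by rewrite mulr_ge0 ?invr_ge0 ?(exprn_ge0 _ (ltW d0)).
have : s ^+ 2 <= 4 * (s - s0) ^+ 2 by nra.
nra.
Qed.

Lemma laplace_density_psd (b c : nat -> R) n : (forall i, s0 <= c i) ->
  0 <= \sum_(i < n) \sum_(j < n) laplace_density k (c i + c j) * b i * b j.
Proof.
move=> hc; pose g i j t := expR (- ((c i + c j) * t)) * k t * (b i * b j).
have gi i j : leb.-integrable J (EFin \o g i j).
  have hs : s0 <= c i + c j by have := hc i; have := hc j; have := s0_gt0; lra.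
  by apply: eq_integrable (integrableZr mJ (b i * b j) (laplace_density_integrable hs)) => // t _ /=; rewrite EFinM.
have gE i j : laplace_density k (c i + c j) * b i * b j = \int[leb]_(t in J) g i j t.
  rewrite RintegralZr// ?mulrA//; apply: laplace_density_integrable.
  by have := hc i; have := hc j; have := s0_gt0; lra.
pose G i t := \sum_(j < n) g i j t.
have GE i := Rintegral_sum n (gi i).
have [_ h] := Rintegral_sum n (fun i => (GE i).1).
rewrite (eq_bigr (fun i : 'I_n => \int[leb]_(t in J) G i t)); last first.
  by move=> i _; rewrite (GE i).2; apply: eq_bigr => j _; rewrite gE.
rewrite -h; apply: Rintegral_ge0 => t /JP t0.
rewrite (_ : \sum_(i < n) _ = k t * (\sum_(i < n) expR (- (c i * t)) * b i) ^+ 2).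
  by rewrite mulr_ge0 ?k0 ?sqr_ge0.
rewrite expr2 mulr_suml mulr_sumr; apply: eq_bigr => i _.
rewrite !mulr_sumr; apply: eq_bigr => j _.
by rewrite /g mulrDl opprD expRD; ring.
Qed.

End kernel.
End laplace_density.

(** * The Helson matrix of a density *)

Section log_power_sum.
Variable R : realType.
Local Notation L := (ln_index R).

(** The integral test for v^(-1-p), with primitive - v^(-p) / p. It rests on (v / u)^p >= 1 + p ln
    (v / u) >= 1 + p (1 - u / v). *)
Lemma powR_inv_step (p u v : R) : 0 < p -> 0 < u -> u <= v ->
  (v - u) / (v * v `^ p) <= ((u `^ p)^-1 - (v `^ p)^-1) / p.
Proof.
move=> p0 u0 uv; have v0 : 0 < v by exact: lt_le_trans uv.
have up := powR_gt0 p u0; have vp := powR_gt0 p v0.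
have h : 1 + p * (1 - u / v) <= v `^ p / u `^ p.
  rewrite /powR !gt_eqF// -expRN -expRD -mulrBr.
  apply: le_trans (expR_ge1Dx _); rewrite lerD2l ler_wpM2l ?(ltW p0)//.
  have := @le_ln1Dx R (u / v - 1); rewrite [1 + _]addrC subrK ln_div ?posrE//.
  by rewrite ltrBrDl subrr divr_gt0// => /(_ isT); lra.
rewrite ler_pdivlMr//.
have -> : (u `^ p)^-1 - (v `^ p)^-1 = (v `^ p / u `^ p - 1) / v `^ p.
  by field; rewrite !gt_eqF.
rewrite (_ : _ / (v * _) * p = p * (1 - u / v) / v `^ p); last first.
  by field; rewrite !gt_eqF.
by rewrite ler_wpM2r ?invr_ge0 ?(ltW vp)//; lra.
Qed.

Lemma sum_inv_log_powR (p : R) : 0 < p -> exists C : R, forall k,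
  \sum_(n < k) (n.+2%:R * (L n * L n `^ p))^-1 <= C.
Proof.
move=> p0; pose f n : R := (n.+2%:R * (L n * L n `^ p))^-1.
have f0 n : 0 <= f n.
  by rewrite invr_ge0 !mulr_ge0 ?powR_ge0 ?(ltW (ln_index_gt0 R n)).
pose G n : R := (L n `^ p)^-1 / p.
have G0 n : 0 <= G n by rewrite divr_ge0 ?invr_ge0 ?powR_ge0// ltW.
(* [f 0] stands apart because the test bounds the term n + 1 by the step from n. *)
exists (f 0%N + G 0%N) => -[|k].
  by rewrite big_ord0 addr_ge0.
apply: le_trans (_ : f 0%N + G 0%N - G k <= _); last by rewrite gerBl.
elim: k => [|k ih]; first by rewrite big_ord1 addrK.
rewrite big_ord_recr/=; suff : f k.+1 <= G k - G k.+1.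
  by rewrite -/(f k.+1); lra.
rewrite -mulrBl; apply: le_trans (powR_inv_step p0 (ln_index_gt0 R k) (ln_index_homo R (leqnSn k))).
rewrite /f invfM ler_wpM2r ?ln_index_step_ge//.
by rewrite invr_ge0 mulr_ge0 ?powR_ge0 ?(ltW (ln_index_gt0 R _)).
Qed.
End log_power_sum.

Section helson_density.
Variables (R : realType) (eta : R -> R) (eta0 : R).
Variable mu : {measure set (measurableTypeR R) -> \bar R}.
Hypothesis mu_density : has_density mu eta.
Hypothesis eta_continuous : forall t, 0 < t -> {for t, continuous eta}.
Hypothesis eta_gt0 : forall t, 0 < t -> 0 < eta t.
Hypothesis eta_integrable : (\int[lebesgue_measure]_(y in `]0%R, +oo[)
        (2 `^ (- y) * eta y)%:E < +oo)%E.
Hypothesis eta_lim0 : eta t @[t --> 0^'+] --> eta0.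
Let J : set (measurableTypeR R) := `]0%R, +oo[%classic.
Let leb := (@lebesgue_measure R).
Local Notation L := (ln_index R).

Let mJ : measurable J. Proof. exact: measurable_itv. Qed.
Let JP (t : R) : J t <-> 0 < t.
Proof. by rewrite /J /= in_itv/= andbT. Qed.
Let ln20 : 0 < ln 2 :> R. Proof. exact: (ln_index_gt0 R 0). Qed.

Lemma density_measurable : measurable_fun J eta.
Proof.
apply: open_continuous_measurable_fun; first exact: interval_open.
by move=> t /set_mem /JP; exact: eta_continuous.
Qed.

Lemma density_integrable : leb.-integrable J (EFin \o (fun t => expR (- (ln 2 * t)) * eta t)).
Proof.
apply/integrableP; split.
  apply/measurable_EFinP/measurable_funM; last exact: density_measurable.
  exact: measurable_expRM.
apply: le_lt_trans eta_integrable; rewrite le_eqVlt; apply/orP; left; apply/eqP.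
apply: eq_integral => t /set_mem /JP t0.
rewrite /= ger0_norm ?mulr_ge0 ?expR_ge0 ?(ltW (eta_gt0 t0))//.
by rewrite /powR gt_eqF// mulNr (mulrC t).
Qed.

Lemma density_lim_ge0 : 0 <= eta0.
Proof.
apply: (cvgr_to_ge eta_lim0); near=> t; apply/ltW/eta_gt0; near: t; exact: nbhs_right_gt.
Unshelve. all: end_near. Qed.

Lemma laplace_densityE s : ln 2 <= s -> laplace mu s = (laplace_density eta s)%:E.
Proof.
move=> hs; rewrite /laplace (integral_density mJ density_measurable (mu := leb)).
- rewrite fineK.
    by apply: eq_integral => t _; rewrite EFinM.
  apply: integrable_fin_num => //.
  apply: laplace_density_integrable density_integrable _ _ => //.
  - exact: density_measurable.
  - by move=> t t0; apply/ltW/eta_gt0.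
- by move=> t /JP t0; exact/ltW/eta_gt0.
- by move=> A mA AJ; exact: mu_density.
- by move=> t _; rewrite lee_fin expR_ge0.
- by apply/measurable_EFinP; exact: measurable_expRM.
Qed.

Lemma laplace_lebesgue s : 0 < s -> laplace leb s = (s^-1)%:E.
Proof.
move=> s0; have [h hE] := laplace_density_cst 1 s0.
rewrite -[s^-1]mul1r -hE fineK; last exact: integrable_fin_num.
by apply: eq_integral => t _; rewrite mulr1.
Qed.

(** The sign of the case: 1 if eta is non-decreasing, -1 if it is non-increasing. *)
Variable sg : R.
Hypothesis sg2 : sg ^+ 2 = 1.
Let kappa t := sg * (eta t - eta0).
Hypothesis kappa_ge0 : forall t, 0 < t -> 0 <= kappa t.

Let etaE t : eta t = eta0 + sg * kappa t.
Proof. by rewrite /kappa mulrA -expr2 sg2 mul1r addrC subrK. Qed.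

Let norm_sg : `|sg| = 1.
Proof. by apply/eqP; rewrite -(@eqrXn2 _ 2)// ?normr_ge0// -normrX sg2 normr1 expr1n. Qed.

Lemma kappa_measurable : measurable_fun J kappa.
Proof.
apply: measurable_funM; first exact: measurable_cst.
by apply: measurable_funB; [exact: density_measurable|exact: measurable_cst].
Qed.

Lemma kappa_integrable : leb.-integrable J (EFin \o (fun t => expR (- (ln 2 * t)) * kappa t)).
Proof.
have [h _] := laplace_density_cst eta0 ln20.
apply: eq_integrable (integrableZl mJ sg (integrableB mJ density_integrable h)) => // t _ /=.
by rewrite -EFinB -EFinM /kappa; congr EFin; ring.
Qed.

Lemma kappa_lim : kappa t @[t --> 0^'+] --> (0 : R).
Proof.
have h : kappa t @[t --> 0^'+] --> sg * (eta0 - eta0).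
  by apply: cvgM; [exact: cvg_cst|apply: cvgB => //; exact: cvg_cst].
by move: h; rewrite subrr mulr0.
Qed.

Lemma laplace_mu s : ln 2 <= s -> laplace mu s = (eta0 / s + sg * laplace_density kappa s)%:E.
Proof.
move=> hs; rewrite laplace_densityE//; congr EFin.
have [h <-] := laplace_density_cst eta0 (lt_le_trans ln20 hs).
have hk : leb.-integrable J (EFin \o (fun t => expR (- (s * t)) * kappa t)).
  exact: laplace_density_integrable kappa_measurable kappa_ge0 kappa_integrable _ hs.
rewrite /laplace_density -RintegralZl// -RintegralD//; last first.
  by apply: eq_integrable (integrableZl mJ sg hk) => // t _ /=; rewrite EFinM.
by apply: eq_Rintegral => t _; rewrite {1}etaE; ring.
Qed.

Let kl := laplace_density kappa.

Lemma laplace_kappa_ge0 s : 0 <= kl s.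
Proof. exact: laplace_density_ge0. Qed.

Lemma mul_laplace_mu s : ln 2 <= s -> (s%:E * laplace mu s)%E = (eta0 + sg * (s * kl s))%:E.
Proof.
move=> hs; rewrite laplace_mu// -EFinM; congr EFin.
by rewrite -/kl; field; rewrite gt_eqF// (lt_le_trans ln20).
Qed.

Lemma mul_laplace_mu_cvg : (x%:E * laplace mu x)%E @[x --> +oo] --> eta0%:E.
Proof.
have h : eta0 + sg * (x * kl x) @[x --> +oo] --> eta0.
  apply/cvgrPdist_le => e e0.
  have [X hX] := laplace_density_vanish kappa_measurable kappa_ge0 ln20 kappa_integrable kappa_lim e0.
  near=> x.
  have x0 : 0 <= x by near: x; apply: nbhs_pinfty_ge; exact: num_real.
  have Xx : X <= x by near: x; apply: nbhs_pinfty_ge; exact: num_real.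
  rewrite opprD addrA subrr sub0r normrN normrM norm_sg mul1r.
  by rewrite ger0_norm ?mulr_ge0 ?laplace_kappa_ge0//; exact: hX.
have ge2 : \forall x \near +oo, ln 2 <= x :> R by apply: nbhs_pinfty_ge; exact: num_real.
apply: cvg_EFin; first by apply: filterS ge2 => x hx; rewrite mul_laplace_mu.
apply: cvg_trans h; apply: near_eq_cvg; near=> x.
have hx : ln 2 <= x by near: x; exact: ge2.
by rewrite /= mul_laplace_mu.
Unshelve. all: end_near. Qed.

Let A m n := helson mu m.+2 n.+2.
Let B m n := helson leb m.+2 n.+2.
Let K m n := kl (L m + L n) / Num.sqrt (m.+2 * n.+2)%:R.

Let lnM m n : ln (m.+2 * n.+2)%:R = L m + L n.
Proof. by rewrite natrM lnM ?posrE ?ltr0n. Qed.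

Let L_ge m : ln 2 <= L m. Proof. exact: (@ln_index_homo R 0). Qed.

Let LD_ge m n : ln 2 <= L m + L n.
Proof. by have := L_ge m; have := L_ge n; have := ln20; lra. Qed.

Lemma helson_lebesgue m n : B m n = hilbert_kernel R m n.
Proof.
by rewrite /B /helson lnM laplace_lebesgue ?addr_gt0 ?ln_index_gt0//= /hilbert_kernel invfM.
Qed.

Lemma helson_sub m n : A m n - eta0 * B m n = sg * K m n.
Proof.
rewrite helson_lebesgue /A /helson lnM laplace_mu//= /hilbert_kernel /K invfM.
by rewrite -/kl; ring.
Qed.

Lemma helson_sym m n : A m n = A n m.
Proof. by rewrite /A /helson mulnC. Qed.

Lemma difference_mx_sym m n : K m n = K n m.
Proof. by rewrite /K addrC mulnC. Qed.

Lemma difference_mx_psd : mx_psd K.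
Proof.
move=> n a.
have := laplace_density_psd kappa_measurable kappa_ge0 ln20 kappa_integrable
  (fun i => a i / Num.sqrt i.+2%:R) (c := L) n L_ge.
congr (_ <= _); apply: eq_bigr => i _; apply: eq_bigr => j _.
rewrite /K natrM sqrtrM ?ler0n// -/kl; field.
by rewrite !gt_eqF ?sqrtr_gt0 ?ltr0n.
Qed.

Lemma hilbert_kernel_gt0 m n : 0 < hilbert_kernel R m n.
Proof. by rewrite invr_gt0 mulr_gt0 ?addr_gt0 ?ln_index_gt0 ?sqrtr_gt0 ?ltr0n ?muln_gt0. Qed.

Lemma difference_mx_hilbert m n : K m n = (L m + L n) * kl (L m + L n) * hilbert_kernel R m n.
Proof.
rewrite /hilbert_kernel /K; field.
by rewrite !gt_eqF ?addr_gt0 ?ln_index_gt0 ?sqrtr_gt0 ?ltr0n ?muln_gt0.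
Qed.

Lemma difference_mx_ge0 m n : 0 <= K m n.
Proof. by rewrite /K mulr_ge0 ?laplace_kappa_ge0 ?invr_ge0 ?sqrtr_ge0. Qed.

(** Off the corner ln (mn) is beyond the point where s times the transform of kappa has fallen below
    e / pi; the Schur bound restores the factor pi. *)
Lemma difference_mx_section_small : section_small (fun m n => sg * K m n).
Proof.
move=> e e0; have pi0 := @pi_gt0 R.
have [X hX] := laplace_density_vanish kappa_measurable kappa_ge0 ln20
  kappa_integrable kappa_lim (divr_gt0 e0 pi0).
have [M hM] : exists M, X <= L M.
  have [M hM] : exists M : nat, expR X <= M.+2%:R.
    exists (Num.bound (expR X)); apply/ltW.
    apply: lt_le_trans (archi_boundP (expR_ge0 X)) _.
    by rewrite ler_nat; exact: leq_trans (leqnSn _) (leqnSn _).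
  by exists M; rewrite -[X]expRK ler_ln ?posrE ?expR_gt0 ?ltr0n.
have ep := divr_gt0 e0 pi0.
exists M; rewrite (_ : e = pi * (e / pi)); last by rewrite mulrC divfK// gt_eqF.
apply: hilbert_kernel_bound => [|m n]; first exact: ltW.
have hk := ltW (hilbert_kernel_gt0 m n).
rewrite /off_section; case: ifPn => [_|mn]; first by rewrite normr0 mulr_ge0// ltW.
rewrite normrM norm_sg mul1r ger0_norm ?difference_mx_ge0// difference_mx_hilbert ler_wpM2r//.
apply: hX; apply: le_trans hM _; have := ln_index_gt0 R m; have := ln_index_gt0 R n.
move: mn; rewrite negb_and -!leqNgt => /orP[/(ln_index_homo R)|/(ln_index_homo R)]; lra.
Qed.

Lemma mul_laplace_mu_bounded : exists2 S : R, 0 <= S &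
  forall s, ln 2 <= s -> (s%:E * laplace mu s <= S%:E)%E.
Proof.
have [S S0 hS] := laplace_density_bounded kappa_measurable kappa_ge0 ln20
  kappa_integrable kappa_lim.
exists (eta0 + S) => [|s hs]; first by rewrite addr_ge0 ?density_lim_ge0.
rewrite mul_laplace_mu// lee_fin lerD2l (le_trans (ler_norm _))// normrM norm_sg mul1r.
by rewrite ger0_norm ?hS// mulr_ge0 ?laplace_kappa_ge0// (le_trans (ltW ln20)).
Qed.

Lemma helson_hilbert_bound (S : R) :
  (forall s, ln 2 <= s -> (s%:E * laplace mu s <= S%:E)%E) ->
  forall m n, `|A m n| <= S * hilbert_kernel R m n.
Proof.
move=> hS m n; have := hS _ (LD_ge m n).
rewrite /A /helson lnM; set s := L m + L n.
have s0 : 0 < s by rewrite addr_gt0 ?ln_index_gt0.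
rewrite laplace_densityE ?LD_ge// -EFinM lee_fin /=.
have l0 : 0 <= laplace_density eta s.
  by apply: laplace_density_ge0 => t t0; exact/ltW/eta_gt0.
move=> h; rewrite ger0_norm ?divr_ge0 ?sqrtr_ge0//.
rewrite /hilbert_kernel -/s invfM mulrA ler_wpM2r ?invr_ge0 ?sqrtr_ge0//.
by rewrite ler_pdivlMr// mulrC.
Qed.

(** Once the supremum is seen to be finite it is a real constant S for the Schur bound, and
    [represents_bound] transfers pi S to the given H. *)
Lemma helson_opnorm (a : R) (H : {linear ell2 R -> ell2 R}) : represents A a H ->
  (opnorm H <= pi%:E * ereal_sup [set x%:E * laplace mu x | x in `[ln 2, +oo[])%E.
Proof.
move=> AH; set E := [set _ | _ in _]; have [S0 S00 hS0] := mul_laplace_mu_bounded.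
have Ele s : ln 2 <= s -> (s%:E * laplace mu s <= ereal_sup E)%E.
  by move=> hs; apply: ereal_sup_ubound; exists s => //=; rewrite in_itv/= hs.
have leE : (ereal_sup E <= S0%:E)%E.
  by apply: ge_ereal_sup => y [s /=]; rewrite in_itv/= andbT => hs <-; exact: hS0.
have E0 : (0 <= ereal_sup E)%E.
  apply: le_trans (Ele _ (lexx _)); rewrite laplace_densityE// -EFinM lee_fin.
  rewrite mulr_ge0 ?(ltW ln20)//.
  by apply: laplace_density_ge0 => t t0; exact/ltW/eta_gt0.
have Efin : ereal_sup E \is a fin_num.
  by rewrite ge0_fin_numE// (le_lt_trans leE) ?ltry.
rewrite -(fineK Efin); set S := fine _.
have S_ge0 : 0 <= S by exact: fine_ge0.
have hS : mx_bound A (pi * S).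
  apply: hilbert_kernel_bound => //; apply: helson_hilbert_bound => s hs.
  by rewrite /S fineK//; exact: Ele.
have hH := represents_bound AH (mulr_ge0 (pi_ge0 R) S_ge0) helson_sym hS.
apply: ge_ereal_sup => _ [x /= + <-]; rewrite ell2_normE lecR => x1.
rewrite -EFinM lee_fin (le_trans (represents_le hH x))// ler_piMr//.
by rewrite mulr_ge0 ?pi_ge0.
Qed.

Lemma difference_mx_trace : power_rate_at0 eta eta0 ->
  exists C : R, forall k, \sum_(n < k) K n n <= C.
Proof.
move=> [p [D [g [[p0 D0] _ g0 _ hg]]]].
have ln2le1 : ln 2 <= 1 :> R by apply: (@le_ln1Dx R 1); lra.
(* The rate lemma takes exponents up to 1, and t^p <= t^q for t < 1. *)
pose q := Num.min p 1; have q0 : 0 < q by rewrite lt_min p0 ltr01.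
have q1 : q <= 1 by rewrite ge_min lexx orbT.
have qp : q <= p by rewrite ge_min lexx.
have Dg0 : 0 <= D * g 1 by rewrite mulr_ge0 ?(ltW D0) ?(ltW (g0 _ ltr01)).
(* The hypothesis at y = 1 and x = 1 / t, admissible because 1 / t >= 1 >= ln 2. *)
have hk t : 0 < t -> t < 1 -> kappa t <= D * g 1 * t `^ q.
  move=> t0 t1; have := hg t^-1 1 _ ltr01; rewrite div1r invrK.
  rewrite (le_trans ln2le1) ?invf_ge1 ?(ltW t1)// => /(_ isT) h.
  apply: le_trans (ler_norm _) _; rewrite normrM norm_sg mul1r.
  apply: le_trans h _; rewrite mulrAC ler_wpM2l//.
  by apply: ger_powR => //; rewrite t0 ltW.
have [C C0 hC] := laplace_density_rate kappa_measurable kappa_ge0 ln20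
  kappa_integrable Dg0 q0 q1 ltr01 hk.
have [C1 hC1] := sum_inv_log_powR q0; have [C2 hC2] := sum_inv_log_powR (@ltr01 R).
(* A diagonal entry is the transform at 2 ln n divided by n, so the two terms of the rate bound give
   convergent series with exponents q and 1. *)
exists (C * C1 + C * C2) => k.
apply: (@le_trans _ _ (C * \sum_(n < k) (n.+2%:R * (L n * L n `^ q))^-1 +
   C * \sum_(n < k) (n.+2%:R * (L n * L n `^ 1))^-1)); last first.
  by rewrite lerD// ler_wpM2l.
rewrite !mulr_sumr -big_split/=; apply: ler_sum => n _.
have Ln := ln_index_gt0 R n; have L1 := L_ge n.
have h2 : 2 * ln 2 <= L n + L n by lra.
rewrite /K natrM -expr2 sqrtr_sqr ger0_norm// -!mulrDr ler_pdivrMr//.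
apply: le_trans (hC _ h2) _; rewrite -mulrA ler_wpM2l//.
rewrite !invfM mulrDl -!mulrA !(mulrCA n.+2%:R^-1) mulVf ?pnatr_eq0// !mulr1 -!invfM.
rewrite powRr1 ?(ltW Ln)//; apply: lerD.
  rewrite lef_pV2 ?posrE ?mulr_gt0 ?powR_gt0 ?addr_gt0// ler_pM ?powR_ge0 ?(ltW Ln)//.
    by rewrite lerDl ltW.
  by apply: ge0_ler_powR; rewrite ?nnegrE ?lerDl ?addr_ge0 ?(ltW Ln) ?(ltW q0).
rewrite lef_pV2 ?posrE ?exprn_gt0 ?mulr_gt0 ?addr_gt0//.
by rewrite ler_pM ?lerDl ?(ltW Ln).
Qed.

Section operators.
Variables (a b : R) (H Hl : {linear ell2 R -> ell2 R}).
Hypotheses (AH : represents A a H) (BHl : represents B b Hl).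
Let T (x : ell2 R) : ell2 R := sg%:C *: (H x - eta0%:C *: Hl x).

Let normc_sg : Normc.normc sg%:C = 1.
Proof. by rewrite /Normc.normc /= expr0n addr0 sg2 sqrtr1. Qed.

Lemma difference_represents : exists2 TK : {linear ell2 R -> ell2 R},
  T = TK & represents K (a + `|eta0| * b) TK.
Proof.
have [TK hTK] : exists TK : {linear ell2 R -> ell2 R}, T = TK.
  apply: linear_exists => s x y; rewrite /T; apply: ell2_ext => n.
  by rewrite !linearP !(ell2_add, ell2_opp, ell2_scale); ring.
exists TK => //; have [c0 hb hm] := represents_comb eta0 AH BHl; split=> // [x|m n].
  by rewrite -hTK /T l2normZ normc_sg mul1r.
by rewrite -hTK /T ell2_scale hm helson_sub -rmorphM mulrA -expr2 sg2 mul1r.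
Qed.

Lemma difference_compact : [/\ positive_op T, self_adjoint T & compact_op T].
Proof.
have [TK -> hK] := difference_represents; split.
- exact: represents_positive hK difference_mx_sym difference_mx_psd.
- exact: represents_selfadjoint hK difference_mx_sym.
apply: represents_compact hK difference_mx_sym _ => e e0.
have [M hM] := difference_mx_section_small e0; exists M => n u.
(* Smallness is known for sg K; testing it on sg u cancels the sign. *)
have := hM n (fun k => sg * u k); congr (_ <= _).
  apply: eq_bigr => i _; congr (_ ^+ 2); apply: eq_bigr => j _.
  rewrite /off_section; case: ifP => _; first by rewrite !mul0r.
  by rewrite mulrACA -expr2 sg2 mul1r.
by congr (_ * _); apply: eq_bigr => i _; rewrite exprMn sg2 mul1r.
Qed.

(** A positive self-adjoint operator is its own modulus and its own adjoint, so the trace is the sum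
    of the diagonal entries. *)
Lemma difference_trace_class : power_rate_at0 eta eta0 ->
  [/\ positive_op T, self_adjoint T & trace_class T].
Proof.
move=> hr; have [Tp Ts _] := difference_compact; split=> //.
move: Tp Ts; have [TK -> hK] := difference_represents => Tp Ts.
have cT := represents_continuous hK.
exists TK, TK; split=> //.
have [C hC] := difference_mx_trace hr; apply: le_lt_trans (ltry C).
apply: lime_le.
  by apply: is_cvg_nneseries => n _ _; rewrite (represents_inner hK) lee_fin difference_mx_ge0.
apply: nearW => k; rewrite big_mkord; apply: le_trans (_ : (\sum_(n < k) K n n)%:E <= _)%E.
  by rewrite -sumEFin le_eqVlt; apply/orP; left; apply/eqP; apply: eq_bigr => n _;
    rewrite (represents_inner hK).
by rewrite lee_fin.
Qed.

Lemma helson_lebesgue_bound : mx_bound B (pi * 1).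
Proof.
apply: hilbert_kernel_bound => // m n; rewrite helson_lebesgue mul1r ger0_norm//.
exact/ltW/hilbert_kernel_gt0.
Qed.

Lemma helson_lebesgue_sym m n : B m n = B n m.
Proof. by rewrite /B /helson mulnC. Qed.

Lemma helson_lebesgue_psd : mx_psd B.
Proof.
move=> n u.
have [h1 _] := laplace_density_cst 1 ln20.
have := laplace_density_psd (measurable_cst (1 : R)) (fun _ _ => ler01) ln20 h1
  (fun i => u i / Num.sqrt i.+2%:R) (c := L) n L_ge.
congr (_ <= _); apply: eq_bigr => i _; apply: eq_bigr => j _.
have [_ ->] := laplace_density_cst 1 (addr_gt0 (ln_index_gt0 R i) (ln_index_gt0 R j)).
rewrite helson_lebesgue /hilbert_kernel natrM sqrtrM ?ler0n//; field.
by rewrite !gt_eqF ?addr_gt0 ?ln_index_gt0 ?sqrtr_gt0 ?ltr0n.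
Qed.

(** In the perturbation result the segment ends at eta0 times the bound of H_lambda, so that bound
    is first sharpened to pi. *)
Lemma helson_ess_spectrum : ess_spectrum H = [set z | 0 <= z <= (eta0 * pi)%:C].
Proof.
have pi0 := pi_ge0 R.
have BHpi : represents B pi Hl.
  have := represents_bound BHl _ helson_lebesgue_sym helson_lebesgue_bound.
  by rewrite mulr1; exact.
apply: (ess_spectrum_perturbation AH BHpi density_lim_ge0 helson_sym helson_lebesgue_sym).
- rewrite (_ : (fun m n => _) = (fun m n => sg * K m n)); first exact: difference_mx_section_small.
  by apply/funext => m; apply/funext => n; exact: helson_sub.
- exact: represents_positive BHpi helson_lebesgue_sym helson_lebesgue_psd.
move=> t; apply: (@hilbert_weyl_point _ pi).
rewrite (_ : hilbert_kernel R = B)//.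
by apply/funext => m; apply/funext => n; rewrite helson_lebesgue.
Qed.

End operators.
End helson_density.

Theorem theorem4p1 (R : realType) (eta : R -> R) (eta0 : R)
    (mu : {measure set (measurableTypeR R) -> \bar R})
    (mu_density : has_density mu eta)
    (eta_continuous : forall t, 0 < t -> {for t, continuous eta})
    (eta_gt0 : forall t, 0 < t -> 0 < eta t)
    (eta_integrable : (\int[lebesgue_measure]_(y in `]0%R, +oo[)
        (2 `^ (- y) * eta y)%:E < +oo)%E)
    (eta_monotone :
      (forall s t, 0 < s -> s <= t -> eta s <= eta t) \/
      (forall s t, 0 < s -> s <= t -> eta t <= eta s))
    (eta_lim0 : eta t @[t --> 0^'+] --> eta0) :
  exists H H_lambda : {linear ell2 R -> ell2 R},
    [/\ is_operator_of (helson mu) H,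
        is_operator_of (helson lebesgue_measure) H_lambda,
        (forall t, 0 < t -> eta0 <= eta t) ->
          [/\ forall x : R, ln 2 <= x -> (eta0%:E <= x%:E * laplace mu x)%E,
              (x%:E * laplace mu x)%E @[x --> +oo] --> eta0%:E,
              (opnorm H <= pi%:E *
                 ereal_sup [set x%:E * laplace mu x | x in `[ln 2, +oo[])%E,
              let T := H \- eta0%:C \*: H_lambda in
                [/\ positive_op T, self_adjoint T & compact_op T] &
              ess_spectrum H = [set z | 0 <= z <= (eta0 * pi)%:C]] /\
          (power_rate_at0 eta eta0 ->
             let T := H \- eta0%:C \*: H_lambda in
               [/\ positive_op T, self_adjoint T & trace_class T]) &
        (forall t, 0 < t -> eta t <= eta0) ->
          [/\ forall x : R, ln 2 <= x -> (x%:E * laplace mu x <= eta0%:E)%E,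
              (x%:E * laplace mu x)%E @[x --> +oo] --> eta0%:E,
              (opnorm H <= pi%:E *
                 ereal_sup [set x%:E * laplace mu x | x in `[ln 2, +oo[])%E,
              let T := eta0%:C \*: H_lambda \- H in
                [/\ positive_op T, self_adjoint T & compact_op T] &
              ess_spectrum H = [set z | 0 <= z <= (eta0 * pi)%:C]] /\
          (power_rate_at0 eta eta0 ->
             let T := eta0%:C \*: H_lambda \- H in
               [/\ positive_op T, self_adjoint T & trace_class T])].
Proof.
have s1 : (1 : R) ^+ 2 = 1 by rewrite expr1n.
have sN1 : (-1 : R) ^+ 2 = 1 by rewrite sqrrN expr1n.
have mono : (forall t, 0 < t -> eta0 <= eta t) \/ (forall t, 0 < t -> eta t <= eta0).
  case: eta_monotone => h; [left|right] => t t0.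
    apply: (cvgr_to_le eta_lim0); near=> s; apply: h.
      by near: s; exact: nbhs_right_gt.
    by near: s; exact: nbhs_right_le.
  apply: (cvgr_to_ge eta_lim0); near=> s; apply: h.
    by near: s; exact: nbhs_right_gt.
  by near: s; exact: nbhs_right_le.
have kap1 : (forall t, 0 < t -> eta0 <= eta t) -> forall t, 0 < t -> 0 <= 1 * (eta t - eta0).
  by move=> h t t0; rewrite mul1r subr_ge0 h.
have kapN1 : (forall t, 0 < t -> eta t <= eta0) -> forall t, 0 < t -> 0 <= -1 * (eta t - eta0).
  by move=> h t t0; rewrite mulN1r opprB subr_ge0 h.
(* H is chosen before either case of the statement is assumed, so the a priori bound comes from
   whichever comparison monotonicity provides. *)
have [S S0 hS] : exists2 S : R, 0 <= S &
    forall s, ln 2 <= s -> (s%:E * laplace mu s <= S%:E)%E.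
  case: mono => [/kap1 h|/kapN1 h].
    exact: mul_laplace_mu_bounded mu_density eta_continuous eta_gt0 eta_integrable eta_lim0 _ s1 h.
  exact: mul_laplace_mu_bounded mu_density eta_continuous eta_gt0 eta_integrable eta_lim0 _ sN1 h.
have hA := helson_hilbert_bound mu_density eta_continuous eta_gt0 eta_integrable hS.
have [H AH] := matrix_operator_exists (mulr_ge0 (pi_ge0 R) S0) (helson_sym mu)
  (hilbert_kernel_bound S0 hA).
have [Hl BHl] := matrix_operator_exists (mulr_ge0 (pi_ge0 R) ler01)
  (@helson_lebesgue_sym R) (@helson_lebesgue_bound R).
exists H, Hl; split.
- split; first exact: represents_continuous AH.
  by move=> m n; rewrite (represents_inner AH).
- split; first exact: represents_continuous BHl.
  by move=> m n; rewrite (represents_inner BHl).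
- move=> /kap1 h.
  have -> : H \- eta0%:C \*: Hl = fun x => 1%:C *: (H x - eta0%:C *: Hl x).
    by apply/funext => x; rewrite scale1r.
  split; last by move=> hr T; exact (difference_trace_class mu_density eta_continuous eta_gt0 eta_integrable eta_lim0 s1 h AH BHl hr).
  split.
  - move=> x hx; rewrite (mul_laplace_mu mu_density eta_continuous eta_gt0 eta_integrable s1 h hx).
    rewrite lee_fin mul1r lerDl mulr_ge0 ?laplace_kappa_ge0//.
    by rewrite (le_trans (ltW (ln_index_gt0 R 0))).
  - exact (mul_laplace_mu_cvg mu_density eta_continuous eta_gt0 eta_integrable eta_lim0 s1 h).
  - exact (helson_opnorm mu_density eta_continuous eta_gt0 eta_integrable eta_lim0 s1 h AH).
  - by move=> T; exact (difference_compact mu_density eta_continuous eta_gt0 eta_integrable eta_lim0 s1 h AH BHl).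
  - exact (helson_ess_spectrum mu_density eta_continuous eta_gt0 eta_integrable eta_lim0 s1 h AH BHl).
- move=> /kapN1 h.
  have -> : eta0%:C \*: Hl \- H = fun x => (-1)%:C *: (H x - eta0%:C *: Hl x).
    by apply/funext => x; rewrite rmorphN1 scaleN1r opprB.
  split; last by move=> hr T; exact (difference_trace_class mu_density eta_continuous eta_gt0 eta_integrable eta_lim0 sN1 h AH BHl hr).
  split.
  - move=> x hx; rewrite (mul_laplace_mu mu_density eta_continuous eta_gt0 eta_integrable sN1 h hx).
    rewrite lee_fin mulN1r gerBl mulr_ge0 ?laplace_kappa_ge0//.
    by rewrite (le_trans (ltW (ln_index_gt0 R 0))).
  - exact (mul_laplace_mu_cvg mu_density eta_continuous eta_gt0 eta_integrable eta_lim0 sN1 h).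
  - exact (helson_opnorm mu_density eta_continuous eta_gt0 eta_integrable eta_lim0 sN1 h AH).
  - by move=> T; exact (difference_compact mu_density eta_continuous eta_gt0 eta_integrable eta_lim0 sN1 h AH BHl).
  - exact (helson_ess_spectrum mu_density eta_continuous eta_gt0 eta_integrable eta_lim0 sN1 h AH BHl).
Unshelve. all: end_near. Qed.
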